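(* Let $\Omega\subset\mathbb{R}^3$ be a non-empty open set such that the spectrum $\sigma(-\Delta_D)$ of the Dirichlet Laplacian in $L^2(\Omega;\mathbb{C})$ is purely discrete, and let $0<\mu_1^D\le\mu_2^D\le\mu_3^D\le\dots$ be the eigenvalues of $-\Delta_D$, repeated according to multiplicity. Let $m\in\mathbb{R}$ and let $A_m$ be the Dirac operator with zigzag type boundary conditions in $L^2(\Omega;\mathbb{C}^4)$. Then $$\sigma(A_m)=\{m\}\cup\Big\{\pm\sqrt{m^2+\mu_k^D}:k\in\mathbb{N}\Big\}$$ and $m$ is an eigenvalue of $A_m$ with infinite multiplicity.
   Context: The Pauli matrices are $\sigma_1=\begin{pmatrix}0&1\\1&0\end{pmatrix}$, $\sigma_2=\begin{pmatrix}0&-i\\i&0\end{pmatrix}$, $\sigma_3=\begin{pmatrix}1&0\\0&-1\end{pmatrix}$, and $\sigma\cdot\nabla=\sigma_1\partial_1+\sigma_2\partial_2+\sigma_3\partial_3$ (distributional derivatives). For an open set $\Omega\subset\mathbb{R}^3$, $H^1_0(\Omega;\mathbb{C}^n)$ is the closure of $C_0^\infty(\Omega;\mathbb{C}^n)$ in $H^1(\Omega;\mathbb{C}^n)$. Define operators in $L^2(\Omega;\mathbb{C}^2)$ by $$\mathcal{T}_{\max}f=-i(\sigma\cdot\nabla)f,\quad \operatorname{dom}\mathcal{T}_{\max}=\{f\in L^2(\Omega;\mathbb{C}^2):(\sigma\cdot\nabla)f\in L^2(\Omega;\mathbb{C}^2)\},$$ $$\mathcal{T}_{\min}f=-i(\sigma\cdot\nabla)f,\quad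 \operatorname{dom}\mathcal{T}_{\min}=H^1_0(\Omega;\mathbb{C}^2).$$ For $m\in\mathbb{R}$ the Dirac operator with zigzag type boundary conditions is the (self-adjoint) operator in $L^2(\Omega;\mathbb{C}^4)=L^2(\Omega;\mathbb{C}^2)\oplus L^2(\Omega;\mathbb{C}^2)$ $$A_m=\begin{pmatrix} mI_2&\mathcal{T}_{\min}\\ \mathcal{T}_{\max}&-mI_2\end{pmatrix},\qquad \operatorname{dom}A_m=\operatorname{dom}\mathcal{T}_{\max}\oplus\operatorname{dom}\mathcal{T}_{\min}.$$ The Dirichlet Laplacian $-\Delta_D$ is the self-adjoint operator in $L^2(\Omega;\mathbb{C})$ associated with the closed non-negative sesquilinear form $\mathfrak{a}_D[f,g]=\int_\Omega\nabla f\cdot\overline{\nabla g}\,dx$, $\operatorname{dom}\mathfrak{a}_D=H^1_0(\Omega;\mathbb{C})$. Its spectrum is purely discrete if it consists only of isolated eigenvalues of finite multiplicity (equivalently, its essential spectrum is empty). *)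

(* Defs.v *)
From HB Require Import structures.
From mathcomp Require Import all_boot all_order all_algebra.
From mathcomp Require Import complex.
From mathcomp Require Import all_classical all_reals all_analysis.

Set Implicit Arguments.
Unset Strict Implicit.
Unset Printing Implicit Defensive.

Import Order.TTheory GRing.Theory Num.Theory.
Import numFieldNormedType.Exports.

Local Open Scope classical_set_scope.
Local Open Scope ring_scope.
Local Open Scope complex_scope.

(* As a normed space, R3 carries the sup norm, which induces the Euclidean
   topology. *)
Notation R3 R := (Real.sort R * Real.sort R * Real.sort R)%type.

(* The library puts Lebesgue measure on [measurableTypeR R], an alias of [R];
   [mR3 R] is convertible to [R3 R] and carries the Borel sigma-algebra. *)
Notation mR3 R :=
  (measurableTypeR R * measurableTypeR R * measurableTypeR R)%type.

(* Functions with values in C^n, defined on all of R^3; only their values on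
   the open set at hand matter. *)
Notation field R n := (R3 R -> 'cV[R[i]]_n).

Definition lebesgue2 {R : realType} :
    set (measurableTypeR R * measurableTypeR R)%type -> \bar R :=
  (@lebesgue_measure R \x @lebesgue_measure R)%E.

HB.instance Definition _ (R : realType) := Measure.on (@lebesgue2 R).

Definition lebesgue3 {R : realType} : set (mR3 R) -> \bar R :=
  (@lebesgue2 R \x @lebesgue_measure R)%E.

HB.instance Definition _ (R : realType) := Measure.on (@lebesgue3 R).

Section test_functions.
Context {R : realType}.

Definition R3_basis (j : 'I_3) : R3 R :=
  ((val j == 0)%N%:R, (val j == 1)%N%:R, (val j == 2)%N%:R).

Definition partial (j : 'I_3) (phi : R3 R -> R) : R3 R -> R :=
  fun x => 'D_(R3_basis j) phi x.

Fixpoint C_k (k : nat) (phi : R3 R -> R) : Prop :=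
  continuous phi /\
  if k is k'.+1 then
    forall j, (forall x, derivable phi x (R3_basis j)) /\ C_k k' (partial j phi)
  else True.

Definition smooth (phi : R3 R -> R) := forall k, C_k k phi.

Definition support (phi : R3 R -> R) := closure [set x | phi x != 0].

Definition test_function (Om : set (R3 R)) (phi : R3 R -> R) :=
  [/\ smooth phi, compact (support phi) & support phi `<=` Om].

(* C_0^oo(Om; C^n) *)
Definition C0_infty (Om : set (R3 R)) n (f : field R n) :=
  forall i, test_function Om (fun x => complex.Re (f x i 0)) /\
            test_function Om (fun x => complex.Im (f x i 0)).

End test_functions.

(* The space L^2(Om; C^n) is represented by its representatives; the elements
   of the Hilbert space are the classes modulo [eq_ae Om]. *)
Section L2.
Context {R : realType}.
Variables (Om : set (R3 R)) (n : nat).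
Implicit Types f g : field R n.

Definition cintegral (f : R3 R -> R[i]) : R[i] :=
  (\int[lebesgue3]_(x in Om) complex.Re (f x)) +i*
  (\int[lebesgue3]_(x in Om) complex.Im (f x)).

Definition sqnorm (v : 'cV[R[i]]_n) : R :=
  \sum_i (complex.Re (v i 0) ^+ 2 + complex.Im (v i 0) ^+ 2).

Definition L2 f :=
  (forall i,
    measurable_fun (Om : set (mR3 R)) (fun x : mR3 R => complex.Re (f x i 0)) /\
    measurable_fun (Om : set (mR3 R)) (fun x : mR3 R => complex.Im (f x i 0)))
  /\ (\int[lebesgue3]_(x in Om) (sqnorm (f x))%:E < +oo)%E.

Definition eq_ae f g := f = g %[ae lebesgue3 in Om].

Definition L2inner f g : R[i] :=
  cintegral (fun x => \sum_i f x i 0 * (g x i 0)^*).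

Definition L2norm f : R :=
  Num.sqrt (\int[lebesgue3]_(x in Om) sqnorm (f x)).

End L2.

Section sobolev.
Context {R : realType}.
Variables (Om : set (R3 R)) (n : nat).
Implicit Types f g : field R n.

(* Distributional derivatives are tested against real-valued test functions;
   by linearity this is the same as testing against complex-valued ones. *)
Definition weak_partial (j : 'I_3) f g :=
  forall phi, test_function Om phi -> forall a,
    cintegral Om (fun x => f x a 0 * (partial j phi x)%:C) =
    - cintegral Om (fun x => g x a 0 * (phi x)%:C).

Definition weak_gradient f : set ('I_3 -> field R n) :=
  [set G | forall j, L2 Om (G j) /\ weak_partial j f (G j)].

Definition H1 f := L2 Om f /\ weak_gradient f !=set0.

(* The weak gradient of an element of H^1; it is unique up to a.e. equality. *)
Definition grad f : 'I_3 -> field R n :=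
  xget (fun=> 0) (weak_gradient f).

Definition H1norm f : R :=
  Num.sqrt (L2norm Om f ^+ 2 + \sum_j L2norm Om (grad f j) ^+ 2).

Definition H10 f :=
  H1 f /\
  forall e : R, 0 < e -> exists2 phi, C0_infty Om phi & H1norm (f - phi) < e.

Definition dirichlet_form f g : R[i] :=
  \sum_j L2inner Om (grad f j) (grad g j).

End sobolev.

(* An operator in L^2(Om; C^n) is represented by its graph: [A (f, h)] means
   that [f] is (a representative of an element) in dom A and that [h] is a
   representative of [A f]. *)
Notation operator R n := (set (field R n * field R n)).

Section spectral_theory.
Context {R : realType}.
Variables (Om : set (R3 R)) (n : nat) (A : operator R n).
Implicit Types (z : R[i]) (k : nat).

Definition kernel_at z : set (field R n) := [set f | A (f, z *: f)].

(* A - z is a bijection from dom A onto L^2 with bounded inverse *)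
Definition resolvent_set : set R[i] := [set z |
  [/\ forall f, kernel_at z f -> eq_ae Om f 0,
      forall g, L2 Om g -> exists f, A (f, g + z *: f) &
      exists C : R, forall f g, L2 Om g -> A (f, g + z *: f) ->
        L2norm Om f <= C * L2norm Om g]].

Definition spectrum : set R[i] := ~` resolvent_set.

Definition eigenvalue_of z := exists2 f, kernel_at z f & ~ eq_ae Om f 0.

Definition lin_indep k (v : 'I_k -> field R n) :=
  forall c : 'I_k -> R[i],
    eq_ae Om (\sum_i c i *: v i) 0 -> forall i, c i = 0.

(* dim ker (A - z) = k *)
Definition has_multiplicity z k := exists v : 'I_k -> field R n,
  [/\ forall i, kernel_at z (v i),
      lin_indep v &
      forall f, kernel_at z f ->
        exists c : 'I_k -> R[i], eq_ae Om f (\sum_i c i *: v i)].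

Definition infinite_multiplicity z :=
  forall k, exists2 v : 'I_k -> field R n,
    forall i, kernel_at z (v i) & lin_indep v.

Definition purely_discrete := forall z, spectrum z ->
  [/\ exists2 e : R, 0 < e &
        forall w, spectrum w -> w != z -> e%:C <= `|w - z|,
      eigenvalue_of z &
      exists k, has_multiplicity z k].

(* 0 < mu 0 <= mu 1 <= ... lists all the eigenvalues of A, each one repeated
   according to its multiplicity (which is 0 if z is not an eigenvalue) *)
Definition enumerates_eigenvalues (mu : nat -> R) :=
  [/\ 0 < mu 0, {homo mu : j k / (j <= k)%N >-> j <= k} &
      forall z, exists2 k, has_multiplicity z k &
        ([set j | (mu j)%:C = z] #= `I_k)%card].

End spectral_theory.

(* The operator associated with a form a with domain dom:
   h = A f iff f \in dom and a[f, g] = <h, g> for every g \in dom. *)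
Definition form_operator {R : realType} (Om : set (R3 R)) n
    (dom : set (field R n)) (a : field R n -> field R n -> R[i]) :
    operator R n :=
  [set p | [/\ dom p.1, L2 Om p.2 &
               forall g, dom g -> a p.1 g = L2inner Om p.2 g]].

Definition dirichlet_laplacian {R : realType} (Om : set (R3 R)) :
    operator R 1 :=
  form_operator Om (@H10 R Om 1) (@dirichlet_form R Om 1).

Section dirac.
Context {R : realType}.
Variable Om : set (R3 R).

Definition mx2 (a b c d : R[i]) : 'M[R[i]]_2 :=
  \matrix_(j, k) if j == 0 then if k == 0 then a else b
                           else if k == 0 then c else d.

(* pauli j is sigma_{j+1} *)
Definition pauli (j : 'I_3) : 'M[R[i]]_2 :=
  match val j with
  | 0 => mx2 0 1 1 0
  | 1 => mx2 0 (- 'i%C) 'i%C 0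
  | _ => mx2 1 0 0 (- 1)
  end.

(* (sigma . nabla) f = g in the sense of distributions on Om; the individual
   partial derivatives of f need not be functions. *)
Definition sigma_nabla (f g : field R 2) :=
  forall phi, test_function Om phi -> forall a,
    \sum_j cintegral Om (fun x => (pauli j *m f x) a 0 * (partial j phi x)%:C) =
    - cintegral Om (fun x => g x a 0 * (phi x)%:C).

(* (sigma . nabla) f is in L^2 and h = - i (sigma . nabla) f *)
Definition weyl (f h : field R 2) :=
  exists g, [/\ L2 Om g, sigma_nabla f g & h = - 'i%C *: g].

Definition Tmax : operator R 2 := [set p | L2 Om p.1 /\ weyl p.1 p.2].

Definition Tmin : operator R 2 := [set p | H10 Om p.1 /\ weyl p.1 p.2].

(* C^4 = C^2 (+) C^2 by upper and lower halves of column vectors *)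
Definition dirac_zigzag (m : R) : operator R (2 + 2) :=
  [set p | let f1 := fun x => usubmx (p.1 x) in
           let f2 := fun x => dsubmx (p.1 x) in
           exists h1 h2, [/\ Tmax (f1, h1), Tmin (f2, h2) &
             p.2 = fun x => col_mx (m%:C *: f1 x + h2 x)
                                   (h1 x - m%:C *: f2 x)]].

End dirac.

(* Main.v *)
Require Import Defs.
From HB Require Import structures.
From mathcomp Require Import all_boot all_order all_algebra.
From mathcomp Require Import complex.
From mathcomp Require Import all_classical all_reals all_analysis.
From mathcomp Require Import measurable_realfun.
From mathcomp Require Import ring lra.
Set Implicit Arguments.
Unset Strict Implicit.
Unset Printing Implicit Defensive.
Import Order.TTheory GRing.Theory Num.Theory.
Import numFieldNormedType.Exports.
Local Open Scope classical_set_scope.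
Local Open Scope ring_scope.
Local Open Scope complex_scope.

(** Write [S = sigma . nabla] and [T = - i S].  The equation [(A - z) f = g] for
    [f = (f1, f2)] reads [(m - z) f1 + T f2 = g1] and [T f1 - (m + z) f2 = g2],
    where only the lower component [f2] satisfies a boundary condition.  Since
    the Pauli matrices anticommute, [S] squares to the Laplacian: [<S f, S v>] is
    the Dirichlet form of [f] and [v] as soon as [v] has zero trace ([sip_sg]).
    For [z <> m], eliminating [f1] therefore leaves, for each of the two entries
    of [f2], a Helmholtz equation with spectral parameter [z ^ 2 - m ^ 2] and
    Dirichlet boundary condition ([dirac_helmholtz], [helmholtz_dirac]).  Its
    right-hand side contains a divergence, which is dealt with by projecting
    orthogonally on the gradients of functions of zero trace
    ([gradient_projection]); these gradients form a closed subspace by Poincare's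
    inequality ([poincare]), which holds because [0] is in the resolvent set of
    the Dirichlet Laplacian.  So [z <> m] is in the resolvent set of [A] if
    [z ^ 2 - m ^ 2] is not an eigenvalue [mu k], and otherwise an eigenvalue of
    [A].

    It remains to see that the kernel of [A - m] has infinite dimension.  It
    consists of the [(f1, 0)] with [S f1 = 0], and contains [S w] for all weakly
    harmonic spinors [w], with no boundary condition.  Suppose that it has finite
    dimension.  Subtracting from a compactly supported smooth function on the
    whole space the function of zero trace with the same projected gradient
    gives a weakly harmonic function.  Hence these functions would have finite
    rank modulo functions of zero trace ([separated_bumps]), and among many of
    them with separated supports at least one would have zero trace.  Cut an
    arbitrary such function into bumps on small cubes, by three families of
    parallel slabs: only a bounded number of the bumps can fail to have zero
    trace, however small the cubes, and their energy tends to zero with the size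
    of the cubes, because points have zero capacity in dimension three.  Hence
    every compactly supported smooth function would have zero trace on [Om]
    ([few_bad_zero_trace]).  Poincare's inequality for plateau functions on large
    cubes then contradicts the cubic growth of volume ([not_all_zero_trace]). *)

(** * Smooth functions on R^3 *)

Section smooth_calculus.
Context {R : realType}.
Implicit Types (f g phi psi : R3 R -> R) (j k : 'I_3) (x y : R3 R).

Lemma C_kS n phi : C_k n.+1 phi <-> continuous phi /\
  forall j, (forall x, derivable phi x (R3_basis j)) /\ C_k n (partial j phi).
Proof. by []. Qed.

Lemma C_kW n phi : C_k n.+1 phi -> C_k n phi.
Proof.
elim: n phi => [|n ih] phi; first by case.
case/C_kS => cphi Hphi; split => // j; have [dphi /ih ?] := Hphi j.
by split.
Qed.

Lemma smooth_continuous phi : smooth phi -> continuous phi.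
Proof. by move=> /(_ 0%N) []. Qed.

Lemma smooth_derivable phi j x : smooth phi -> derivable phi x (R3_basis j).
Proof. by move=> /(_ 1%N) /C_kS[_ /(_ j)[]]. Qed.

Lemma smooth_partial phi j : smooth phi -> smooth (partial j phi).
Proof. by move=> sphi n; have /C_kS[_ /(_ j)[]] := sphi n.+1. Qed.

Lemma smoothP phi : smooth phi <->
  continuous phi /\
  forall j, (forall x, derivable phi x (R3_basis j)) /\ smooth (partial j phi).
Proof.
split=> [sphi|[cphi Hphi] [|n]].
- split; first exact: smooth_continuous.
  by move=> j; split; [move=> x; exact: smooth_derivable|exact: smooth_partial].
- by split.
- by apply/C_kS; split => // j; have [dphi sphi] := Hphi j; split.
Qed.

Lemma partial_cst j (c : R) : partial j (fun=> c) = fun=> 0.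
Proof. by apply/funext => x; rewrite /partial derive_cst. Qed.

Lemma C_k_cst n (c : R) : C_k n (fun=> c).
Proof.
elim: n c => [|n ih] c; first by split => //; exact: cst_continuous.
apply/C_kS; split; first exact: cst_continuous.
by move=> j; rewrite partial_cst; split => // x; exact: derivable_cst.
Qed.

Lemma smooth_cst (c : R) : smooth (fun=> c).
Proof. by move=> n; exact: C_k_cst. Qed.

Lemma partialD j f g x : derivable f x (R3_basis j) ->
  derivable g x (R3_basis j) ->
  partial j (fun x => f x + g x) x = partial j f x + partial j g x.
Proof. by move=> df dg; rewrite /partial; exact: deriveD. Qed.

Lemma partialM j f g x : derivable f x (R3_basis j) ->
  derivable g x (R3_basis j) ->
  partial j (fun x => f x * g x) x = f x * partial j g x + g x * partial j f x.
Proof. by move=> df dg; rewrite /partial; exact: deriveM. Qed.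

Lemma C_kD n f g : C_k n f -> C_k n g -> C_k n (fun x => f x + g x).
Proof.
elim: n f g => [|n ih] f g.
  by move=> [cf _] [cg _]; split => // x; apply: cvgD; [exact: cf|exact: cg].
case/C_kS => cf Hf /C_kS[cg Hg]; apply/C_kS; split.
  by move=> x; apply: cvgD; [exact: cf|exact: cg].
move=> j; have [df sf] := Hf j; have [dg sg] := Hg j; split.
  by move=> x; exact: derivableD.
rewrite (_ : partial _ _ = fun x => partial j f x + partial j g x).
  exact: ih.
by apply/funext => x; exact: partialD.
Qed.

Lemma C_kM n f g : C_k n f -> C_k n g -> C_k n (fun x => f x * g x).
Proof.
elim: n f g => [|n ih] f g.
  by move=> [cf _] [cg _]; split => // x; apply: cvgM; [exact: cf|exact: cg].
move=> cf0 cg0; have [fn gn] := (C_kW cf0, C_kW cg0).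
case/C_kS: cf0 => cf Hf; case/C_kS: cg0 => cg Hg; apply/C_kS; split.
  by move=> x; apply: cvgM; [exact: cf|exact: cg].
move=> j; have [df sf] := Hf j; have [dg sg] := Hg j; split.
  by move=> x; exact: derivableM.
rewrite (_ : partial _ _ = fun x => f x * partial j g x + g x * partial j f x).
  by apply: C_kD; exact: ih.
by apply/funext => x; exact: partialM.
Qed.

Lemma smoothD f g : smooth f -> smooth g -> smooth (fun x => f x + g x).
Proof. by move=> sf sg n; exact: C_kD. Qed.

Lemma smoothM f g : smooth f -> smooth g -> smooth (fun x => f x * g x).
Proof. by move=> sf sg n; exact: C_kM. Qed.

Lemma smoothZ (c : R) f : smooth f -> smooth (fun x => c * f x).
Proof. by move=> sf; apply: smoothM => //; exact: smooth_cst. Qed.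

Lemma smoothN f : smooth f -> smooth (fun x => - f x).
Proof.
move=> /(smoothZ (-1)).
by rewrite (_ : (fun x => - f x) = fun x => -1 * f x)//; apply/funext => x; rewrite mulN1r.
Qed.

Lemma smoothB f g : smooth f -> smooth g -> smooth (fun x => f x - g x).
Proof. by move=> sf /smoothN; exact: smoothD. Qed.

Lemma smooth_exp f n : smooth f -> smooth (fun x => f x ^+ n).
Proof.
move=> sf; elim: n => [|n ih].
  rewrite (_ : (fun x => _) = fun=> 1); first exact: smooth_cst.
  by apply/funext => x; rewrite expr0.
rewrite (_ : (fun x => _) = fun x => f x * f x ^+ n); first exact: smoothM.
by apply/funext => x; rewrite exprS.
Qed.

Lemma partialV j f x : f x != 0 -> derivable f x (R3_basis j) ->
  partial j (fun x => (f x)^-1) x = - (f x)^-1 ^+ 2 * partial j f x.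
Proof. by move=> f0 df; rewrite /partial deriveV// exprVn. Qed.

Lemma C_kV n f : (forall x, f x != 0) -> C_k n f -> C_k n (fun x => (f x)^-1).
Proof.
move=> f0; elim: n => [|n ih].
  by move=> [cf _]; split => // x; apply: cvgV => //; exact: cf.
move=> Hf; have fn := C_kW Hf; move/C_kS: Hf => [cf Hf]; apply/C_kS; split.
  by move=> x; apply: cvgV => //; exact: cf.
move=> j; have [df sf] := Hf j; split; first by move=> x; exact: derivableV.
rewrite (_ : partial _ _ =
    fun x => (-1 * ((f x)^-1 * (f x)^-1)) * partial j f x).
  apply: C_kM => //; apply: C_kM; first exact: C_k_cst.
  by apply: C_kM; exact: ih.
by apply/funext => x; rewrite partialV// mulN1r expr2.
Qed.

Lemma smoothV f : (forall x, f x != 0) -> smooth f ->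
  smooth (fun x => (f x)^-1).
Proof. by move=> f0 sf n; exact: C_kV. Qed.

Definition coord j x : R :=
  match val j with 0%N => x.1.1 | 1%N => x.1.2 | _ => x.2 end.

Lemma coordD j x y : coord j (x + y) = coord j x + coord j y.
Proof. by case: j => [[|[|[|]]]]. Qed.

Lemma coordZ j (c : R) x : coord j (c *: x) = c * coord j x.
Proof. by case: j => [[|[|[|]]]]. Qed.

Lemma coord_basis j k : coord j (R3_basis k) = (k == j)%:R.
Proof. by case: j => [[|[|[|]]]] // ?; case: k => [[|[|[|]]]] // ?. Qed.

Lemma continuous_coord j : continuous (coord j).
Proof.
case: j => [[|[|[|]]]] // ? [[x y] z] /=; rewrite /coord /=.
- by apply: (@continuous_comp _ _ _ fst fst); exact: cvg_fst.
- apply: (@continuous_comp _ _ _ fst snd); [exact: cvg_fst|exact: cvg_snd].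
- exact: cvg_snd.
Qed.

(** The bridge from derivatives on the line to the directional derivatives of
    [partial]: in the direction of another coordinate the function is constant,
    in its own direction the two difference quotients coincide. *)
Lemma coord_comp_derive (h h' : R -> R) j k x :
  (forall t : R, is_derive t 1 h (h' t)) ->
  is_derive x (R3_basis k) (fun x => h (coord j x))
    ((k == j)%:R * h' (coord j x)).
Proof.
move=> dh; case: (eqVneq k j) => [->|kj].
  rewrite mul1r; have [H1 H2] := dh (coord j x).
  have E : (fun t : R => t^-1 *: (((fun x => h (coord j x)) \o shift x)
       (t *: R3_basis j) - h (coord j x))) =
     (fun t : R => t^-1 *: ((h \o shift (coord j x)) (t *: (1:R)) - h (coord j x))).
    by apply/funext => t /=; rewrite coordD coordZ coord_basis eqxx.
  by split; rewrite /derivable /derive E.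
rewrite mul0r.
have E : (fun t : R => t^-1 *: (((fun x => h (coord j x)) \o shift x)
       (t *: R3_basis k) - h (coord j x))) = fun=> 0.
  apply/funext => t /=.
  by rewrite coordD coordZ coord_basis (negbTE kj) mulr0 add0r subrr scaler0.
split; rewrite /derivable /derive E; first exact: is_cvg_cst.
exact: lim_cst.
Qed.

Lemma partial_coord_comp (h h' : R -> R) j k :
  (forall t : R, is_derive t 1 h (h' t)) ->
  partial k (fun x => h (coord j x)) = fun x => (k == j)%:R * h' (coord j x).
Proof.
move=> dh; apply/funext => x.
by have [_ E] := coord_comp_derive j k x dh.
Qed.

(** The whole sequence [d] of derivatives is given, so that the induction on the
    order of differentiability only shifts the index. *)
Lemma smooth_coord_comp (d : nat -> R -> R) j :
  (forall n (t : R), is_derive t 1 (d n) (d n.+1 t)) ->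
  smooth (fun x => d 0%N (coord j x)).
Proof.
move=> dd.
suff H : forall n m, C_k n (fun x => d m (coord j x)) by move=> n; exact: H.
have cd m : continuous (fun x => d m (coord j x)).
  move=> x; apply: continuous_comp; first exact: continuous_coord.
  apply: differentiable_continuous; apply/derivable1_diffP.
  by have [] := dd m (coord j x).
move=> n m; elim: n m => [|n ih] m; first by split.
apply/C_kS; split=> // k; split.
  by move=> x; have [] := coord_comp_derive j k x (dd m).
rewrite (partial_coord_comp _ _ (dd m)).
by apply: C_kM => //; exact: C_k_cst.
Qed.

Lemma smooth_coord j : smooth (coord j).
Proof.
pose d n : R -> R := match n with 0%N => id | 1%N => fun=> 1 | _ => fun=> 0 end.
have := @smooth_coord_comp d j; apply => -[|[|n]] t /=.
- exact: is_derive_id.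
- exact: is_derive_cst.
- exact: is_derive_cst.
Qed.

Lemma partial_coord j k : partial k (coord j) = fun=> (k == j)%:R.
Proof.
have := @partial_coord_comp id (fun=> 1) j k (fun t => is_derive_id t 1).
by move=> ->; apply/funext => x; rewrite mulr1.
Qed.

End smooth_calculus.

(** * Symmetry of second derivatives *)

Section schwarz.
Context {R : realType}.
Implicit Types (f : R3 R -> R) (j k : 'I_3) (x y e : R3 R).

Lemma is_derive_line f y e (s : R) : derivable f (y + s *: e) e ->
  is_derive s (1:R) (fun t : R => f (y + t *: e)) ('D_e f (y + s *: e)).
Proof.
move=> df.
have E : (fun t : R => t^-1 *: (((fun t : R => f (y + t *: e)) \o shift s)
       (t *: (1:R)) - f (y + s *: e))) =
     (fun t : R => t^-1 *: ((f \o shift (y + s *: e)) (t *: e) - f (y + s *: e))).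
  apply/funext => t /=; congr (_ *: (f _ - _)).
  by rewrite [t *: 1]mulr1 scalerDl addrCA.
by split; rewrite /derivable /derive E.
Qed.

Lemma mean_value_line f e y (h : R) : 0 < h -> (forall x, derivable f x e) ->
  exists2 s, 0 <= s <= h & f (y + h *: e) - f y = h * 'D_e f (y + s *: e).
Proof.
move=> h0 df.
have cf : continuous (fun t : R => f (y + t *: e)).
  move=> s; apply: differentiable_continuous; apply/derivable1_diffP.
  by have [] := is_derive_line (df (y + s *: e)).
have [s /andP[s0 sh]] := @MVT R _ (fun s => 'D_e f (y + s *: e)) 0 h h0
  (fun s _ => is_derive_line (df (y + s *: e))) (continuous_subspaceT cf).
rewrite scale0r addr0 subr0 => E; exists s; last by rewrite E mulrC.
by move: s0 sh; rewrite !bnd_simp => /ltW -> /ltW ->.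
Qed.

(** Two applications of the mean value theorem: to the difference in direction
    [k] as a function of the position along [j], then along [k]. *)
Lemma second_difference f j k x (h : R) : 0 < h -> smooth f ->
  exists s t, [/\ 0 <= s <= h, 0 <= t <= h &
    f (x + h *: R3_basis j + h *: R3_basis k) - f (x + h *: R3_basis j)
      - f (x + h *: R3_basis k) + f x =
    h * (h * partial k (partial j f)
               (x + s *: R3_basis j + t *: R3_basis k))].
Proof.
move=> h0 sf; set ej := R3_basis j; set ek := R3_basis k.
pose g y := f (y + h *: ek) - f y.
have dg y : is_derive y ej g (partial j f (y + h *: ek) - partial j f y).
  apply: is_deriveB; last by apply: DeriveDef => //; exact: smooth_derivable.
  have := @smooth_derivable R f j (y + h *: ek) sf.
  have E : (fun t : R => t^-1 *: (((fun y => f (y + h *: ek)) \o shift y)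
       (t *: ej) - f (y + h *: ek))) =
     (fun t : R => t^-1 *: ((f \o shift (y + h *: ek)) (t *: ej) - f (y + h *: ek))).
    by apply/funext => t /=; rewrite addrA.
  by move=> d; split; rewrite /derivable /partial /derive E.
have [s sh Es] := @mean_value_line g ej x h h0 (fun y => @ex_derive _ _ _ _ _ _ _ (dg y)).
have [t th Et] := @mean_value_line (partial j f) ek (x + s *: ej) h h0
  (fun y => @smooth_derivable R _ k y (smooth_partial j sf)).
exists s, t; split => //.
rewrite -[partial k _ _]/('D_ek (partial j f) _) -Et.
have <- : 'D_ej g (x + s *: ej) = partial j f (x + s *: ej + h *: ek) - partial j f (x + s *: ej).
  by have [_ ->] := dg (x + s *: ej).
by rewrite -Es /g; ring.
Qed.

Lemma continuous_corner (H : R3 R -> R) j k x (e : R) : continuous H -> 0 < e ->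
   \forall h \near (0:R)^'+, forall s t, 0 <= s <= h -> 0 <= t <= h ->
      `|H x - H (x + s *: R3_basis j + t *: R3_basis k)| < e.
Proof.
move=> cH e0.
have /cvgrPdist_lt/(_ _ e0)/nbhs_ballP[d /= d0 Hd] := cH x.
near=> h => s t /andP[s0 sh] /andP[t0 th].
apply: Hd; rewrite -ball_normE /= opprD addrA opprD addrA subrr sub0r -opprD normrN.
have nb (i : 'I_3) : `|R3_basis i : R3 R| <= 1.
  by case: i => [[|[|[|//]]] ?]; rewrite /R3_basis prod_normE /= prod_normE /=
     !(normr0, normr1) !ge_max ?ler01 ?lexx.
apply: (le_lt_trans (ler_normD _ _)).
rewrite !normrZ !ger0_norm//.
have h2 : h < d / 2 by near: h; apply: nbhs_right_lt; rewrite divr_gt0.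
have : s * `|R3_basis j : R3 R| <= h * 1 by apply: ler_pM => //.
have : t * `|R3_basis k : R3 R| <= h * 1 by apply: ler_pM => //.
by rewrite mulr1 => A B; lra.
Unshelve. all: end_near. Qed.

(** For continuous [F] and [G], agreement at some pair of points of every small
    corner at [x] is enough. *)
Lemma eq_from_corners (F G : R3 R -> R) j k x : continuous F -> continuous G ->
  (forall h : R, 0 < h -> exists s t s' t' : R,
     [/\ 0 <= s <= h /\ 0 <= t <= h, 0 <= s' <= h /\ 0 <= t' <= h &
        F (x + s *: R3_basis j + t *: R3_basis k) =
        G (x + s' *: R3_basis k + t' *: R3_basis j)]) -> F x = G x.
Proof.
move=> cF cG FG.
apply/eqP; rewrite -subr_eq0 -normr_le0; apply/ler_addgt0Pl => e e0; rewrite addr0.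
have e2 : 0 < e / 2 by rewrite divr_gt0.
near (0:R)^'+ => h.
have h0 : 0 < h by near: h; exact: nbhs_right_gt.
have [s [t [s' [t' [[sh th] [sh' th'] E]]]]] := FG _ h0.
have /ltW A : `|F x - F (x + s *: R3_basis j + t *: R3_basis k)| < e / 2.
  by apply: (near (@continuous_corner F j k x _ cF e2) h).
have /ltW B : `|G x - G (x + s' *: R3_basis k + t' *: R3_basis j)| < e / 2.
  by apply: (near (@continuous_corner G k j x _ cG e2) h).
rewrite [e]splitr; apply: le_trans (lerD A B).
by rewrite -E (distrC (G x)); exact: ler_distD.
Unshelve. all: end_near. Qed.

(** Both mixed derivatives are limits of the same symmetric second
    difference quotient. *)
Lemma partialC f j k : smooth f ->
  partial k (partial j f) = partial j (partial k f).
Proof.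
move=> sf; apply/funext => x; apply: (@eq_from_corners _ _ j k).
- by do 3!apply: smooth_continuous || apply: smooth_partial.
- by do 3!apply: smooth_continuous || apply: smooth_partial.
move=> h h0.
have [s [t [sh th]]] := @second_difference f j k x h h0 sf.
have [s' [t' [sh' th']]] := @second_difference f k j x h h0 sf.
move: (partial k (partial j f)) (partial j (partial k f)) => F G E2 E1.
exists s, t, s', t'; split => //.
have hn0 := lt0r_neq0 h0; apply: (mulfI hn0); apply: (mulfI hn0).
by rewrite -E1 -E2 (addrAC x) [X in X + f x]addrAC.
Qed.

End schwarz.

(** * Bump functions and test functions *)

Section flat.
Context {R : realType}.
Implicit Types (p : {poly R}) (x : R).

(** The class of these functions is closed under derivation, and all of them
    are flat at the origin. *)
Definition flat p x : R :=
  if 0 < x then p.[x^-1] * expR (- x^-1) else 0.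

(** [expR (- y)] beats every power of [y]: keep one term of the exponential
    series for each monomial.  The bound by [x ^+ 2] is what makes the derivative
    at the origin vanish. *)
Lemma flat_sqr_bound p : exists2 C : R, 0 <= C &
  forall x, `|flat p x| <= C * x ^+ 2.
Proof.
exists (\sum_(i < size p) `|p`_i| * (i.+2)`!%:R).
  by apply: sumr_ge0 => i _; rewrite mulr_ge0.
move=> x; rewrite /flat; case: ifPn => [x0|_]; last first.
  by rewrite normr0 mulr_ge0 ?sqr_ge0//; apply: sumr_ge0 => i _; rewrite mulr_ge0.
have xi0 : 0 < x^-1 by rewrite invr_gt0.
rewrite normrM (ger0_norm (expR_ge0 _)) expRN ler_pdivrMr ?expR_gt0//.
rewrite horner_coef; apply: (le_trans (ler_norm_sum _ _ _)).
rewrite !mulr_suml; apply: ler_sum => i _.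
rewrite [X in _ <= X](_ : _ = `|p`_i| * ((i.+2)`!%:R * (x ^+ 2 * expR x^-1))); last by ring.
rewrite normrM ler_wpM2l// normrX (ger0_norm (ltW xi0)).
have H : x^-1 ^+ i.+2 / (i.+2)`!%:R <= expR x^-1.
  by apply: le_trans (expR_ge1Dxn i.+1 (ltW xi0)); rewrite lerDr.
have f0 : 0 < (i.+2)`!%:R :> R by rewrite ltr0n fact_gt0.
rewrite ler_pdivrMr// in H.
rewrite (_ : x^-1 ^+ i = x ^+ 2 * x^-1 ^+ i.+2); last first.
  by rewrite -(addn2 i) exprD mulrCA -exprMn mulfV ?gt_eqF// expr1n mulr1.
by rewrite [X in _ <= X]mulrCA ler_wpM2l ?sqr_ge0// mulrC.
Qed.

(** the effect of derivation on the polynomial factor *)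
Definition flat_next p := 'X^2 * (p - p^`()).

Lemma is_derive_flat p x : is_derive x (1:R) (flat p) (flat (flat_next p) x).
Proof.
have [x0|x0|->] := ltgtP x 0.
- apply: (@near_eq_is_derive _ _ _ (fun=> 0)); last first.
    by rewrite /flat ltNge (ltW x0)/=; exact: is_derive_cst.
  near=> y; rewrite /flat ltNge (_ : y <= 0)//.
  by near: y; exact: lt_le_nbhsl.
- apply: (@near_eq_is_derive _ _ _ (fun y : R => p.[y^-1] * expR (- y^-1))).
    near=> y; rewrite /flat (_ : 0 < y)//.
    by near: y; exact: lt_nbhsr.
  rewrite /flat x0.
  have xn0 : x != 0 by rewrite gt_eqF.
  have dV : is_derive x (1:R) (fun y : R => y^-1) (- x ^- 2 *: 1).
    exact: is_deriveV.
  have d1 := is_derive1_comp (is_derive_poly p x^-1) dV.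
  have d2 := @is_derive1_comp R expR (fun y : R => - y^-1) x _ _ (is_derive_expR _) (is_deriveN dV).
  apply: (is_derive_eq (is_deriveM d1 d2)).
  rewrite /flat_next hornerM hornerD hornerN hornerXn /=.
  rewrite -[LHS]/(p.[x^-1] * (expR (- x^-1) * - (- x ^- 2 * 1)) +
    expR (- x^-1) * (p^`().[x^-1] * (- x ^- 2 * 1))).
  by rewrite -exprVn; ring.
- have -> : flat (flat_next p) 0 = 0 by rewrite /flat ltxx.
  have [C C0 HC] := flat_sqr_bound p.
  suff H : (fun h : R => h^-1 *: ((flat p \o shift 0) (h *: (1:R)) - flat p 0)) @ 0^' --> (0:R).
    by split; [apply/cvg_ex; exists 0|exact/cvg_lim].
  apply/cvgr0Pnorm_lt => e e0; near=> h.
  have h0 : h != 0 by near: h; exact: nbhs_dnbhs_neq.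
  rewrite /= addr0 [h *: 1]mulr1 {2}/flat ltxx subr0 normrZ normfV.
  rewrite ltr_pdivrMl ?normr_gt0//.
  apply: (le_lt_trans (HC _)); 
  have -> : h ^+ 2 = `|h| * `|h| by rewrite -normrM -expr2 ger0_norm ?sqr_ge0.
  rewrite mulrCA ltr_pM2l ?normr_gt0//.
  apply: (@le_lt_trans _ _ ((C + 1) * `|h|)); first by rewrite ler_wpM2r// lerDl.
  rewrite mulrC -ltr_pdivlMr ?ltr_wpDl//.
  near: h; apply: dnbhs0_lt; rewrite divr_gt0// ltr_wpDl//.
Unshelve. all: end_near. Qed.

End flat.

Section test_functions.
Context {R : realType}.
Implicit Types (f phi psi : R3 R -> R) (j k : 'I_3) (x y a b : R3 R)
  (Om : set (R3 R)).

Lemma support_sub phi psi : (forall x, phi x = 0 -> psi x = 0) ->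
  Defs.support psi `<=` Defs.support phi.
Proof.
move=> H; apply: closureS => x /=; apply: contra_neq; exact: H.
Qed.

Lemma notin_support phi x : ~ Defs.support phi x -> phi x = 0.
Proof.
by move=> H; apply: contrapT => /eqP n; apply: H; exact: subset_closure.
Qed.

Lemma near_notin_support phi x : ~ Defs.support phi x -> \forall y \near x, phi y = 0.
Proof.
move=> H; have oS : open (~` Defs.support phi) by apply: closed_openC; exact: closed_closure.
by near=> y; apply: notin_support; near: y; exact: open_nbhs_nbhs.
Unshelve. all: end_near. Qed.

Lemma partial_notin_support phi j x : ~ Defs.support phi x -> partial j phi x = 0.
Proof.
move=> H; rewrite /partial.
have /near_eq_is_derive/(_ (is_derive_cst (0:R) x (R3_basis j))) :
  (\near x, cst 0 x = phi x).
  by have := near_notin_support H; apply: filterS => y ->.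
by case.
Qed.

Lemma support_partial phi j : Defs.support (partial j phi) `<=` Defs.support phi.
Proof.
rewrite [X in _ `<=` X](closure_id _).1; last exact: closed_closure.
apply: closureS => x /= /eqP n; apply: contrapT => H.
by apply: n; exact: partial_notin_support.
Qed.

Lemma test_function_sub Om phi psi : test_function Om phi -> smooth psi ->
  Defs.support psi `<=` Defs.support phi -> test_function Om psi.
Proof.
move=> [_ cphi sphi] spsi H; split => //.
- apply: subclosed_compact cphi H; exact: closed_closure.
- exact: subset_trans sphi.
Qed.

Lemma test_function_partial Om phi j :
  test_function Om phi -> test_function Om (partial j phi).
Proof.
move=> t; apply: (test_function_sub t).
- by case: t => s _ _; exact: smooth_partial.
- exact: support_partial.
Qed.

Lemma test_functionMl Om phi psi : test_function Om phi -> smooth psi ->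
  test_function Om (fun x => psi x * phi x).
Proof.
move=> t s; apply: (test_function_sub t).
- by apply: smoothM => //; case: t.
- by apply: support_sub => x ->; rewrite mulr0.
Qed.

Lemma test_functionZ Om phi (c : R) : test_function Om phi ->
  test_function Om (fun x => c * phi x).
Proof. by move=> t; apply: test_functionMl => //; exact: smooth_cst. Qed.

Lemma test_functionD Om phi psi : test_function Om phi -> test_function Om psi ->
  test_function Om (fun x => phi x + psi x).
Proof.
move=> [s1 c1 i1] [s2 c2 i2].
have H : Defs.support (fun x => phi x + psi x) `<=` Defs.support phi `|` Defs.support psi.
  rewrite /Defs.support -closureU; apply: closureS => x /=.
  have [->|n] := eqVneq (phi x) 0; last by left.
  by rewrite add0r => n; right.
split; first exact: smoothD.
- apply: subclosed_compact H; first exact: closed_closure.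
  exact: compactU.
- by apply: (subset_trans H) => x [/i1|/i2].
Qed.

Lemma test_function0 Om : test_function Om (fun=> 0).
Proof.
have E : Defs.support (fun=> (0:R)) = set0 :> set (R3 R).
  rewrite /Defs.support (_ : [set x | _] = set0) ?closure0//.
  by apply/seteqP; split => x //=; rewrite eqxx.
split; rewrite ?E//; [exact: smooth_cst|exact: compact0].
Qed.

Lemma test_function_bounded Om phi : test_function Om phi ->
  exists C : R, forall x, `|phi x| <= C.
Proof.
move=> [s c _]; have cphi := smooth_continuous s.
have cn : {within Defs.support phi, continuous (fun x => `|phi x|)}.
  apply: continuous_subspaceT => x; apply: continuous_comp; first exact: cphi.
  exact: norm_continuous.
have [E|/set0P S0] := eqVneq (Defs.support phi) set0.
  by exists 0 => x; rewrite notin_support ?normr0// E.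
have [c0 _ Hc] := compact_EVT_max S0 c cn.
exists `|phi c0| => x; have [Sx|/notin_support ->] := pselect (Defs.support phi x).
  by apply: Hc; rewrite inE.
by rewrite normr0.
Qed.

Definition box a b : set (R3 R) :=
  [set x | forall j, coord j a < coord j x < coord j b].

Definition cbox a b : set (R3 R) :=
  [set x | forall j, coord j a <= coord j x <= coord j b].

Lemma cboxE a b : cbox a b =
  (`[a.1.1, b.1.1] `*` `[a.1.2, b.1.2]) `*` `[a.2, b.2].
Proof.
apply/seteqP; split => [x H|x [[/= H1 H2] H3]] /=.
  rewrite !in_itv /=; split; last exact: (H (@Ordinal 3 2 isT)).
  by split; [exact: (H (@Ordinal 3 0 isT))|exact: (H (@Ordinal 3 1 isT))].
rewrite !in_itv /= in H1 H2 H3.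
by move=> [[|[|[|//]]] ?].
Qed.

Lemma compact_cbox a b : compact (cbox a b).
Proof. by rewrite cboxE; do 2?apply: compact_setX; exact: segment_compact. Qed.

Lemma closed_cbox a b : closed (cbox a b).
Proof. by apply: compact_closed; [exact: norm_hausdorff|exact: compact_cbox]. Qed.

Lemma flat1_gt0 (t : R) : (0 < flat 1 t) = (0 < t).
Proof.
rewrite /flat; case: ifPn => [_|]; last by rewrite ltxx => /negbTE.
by rewrite hornerC mul1r expR_gt0.
Qed.

Lemma flat1_ge0 (t : R) : 0 <= flat 1 t.
Proof.
rewrite /flat; case: ifPn => // _.
by rewrite hornerC mul1r expR_ge0.
Qed.

Lemma smooth_flat (s c : R) j : smooth (fun x => flat 1 (s * coord j x + c)).
Proof.
pose d n t : R := s ^+ n * flat (iter n flat_next 1) (s * t + c).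
rewrite (_ : (fun x => _) = fun x => d 0%N (coord j x)); last first.
  by apply/funext => x; rewrite /d expr0 mul1r.
apply: smooth_coord_comp => n t.
have dl : is_derive t (1:R) (fun t : R => s * t + c) s.
  apply: (is_derive_eq (is_deriveD (is_deriveZ s (is_derive_id t 1))
    (is_derive_cst c t 1))).
  by rewrite addr0; exact: mulr1.
have df := is_derive_flat (iter n flat_next 1) (s * t + c).
have dc := @is_derive1_comp R _ (fun t : R => s * t + c) t _ _ df dl.
have := is_deriveZ (s ^+ n) dc.
rewrite /d iterS exprS => H; apply: (is_derive_eq H).
by rewrite -[_ *: _]/(_ * _); ring.
Qed.

Definition box_bump a b x : R :=
  \prod_j (flat 1 (coord j x - coord j a) * flat 1 (coord j b - coord j x)).

Lemma smooth_box_bump a b : smooth (box_bump a b).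
Proof.
have sj j : smooth (fun x => flat 1 (coord j x - coord j a) * flat 1 (coord j b - coord j x)).
  apply: smoothM.
    rewrite (_ : (fun x => _) = fun x => flat 1 (1 * coord j x + - coord j a)).
      exact: smooth_flat.
    by apply/funext => x; rewrite mul1r.
  rewrite (_ : (fun x => _) = fun x => flat 1 (-1 * coord j x + coord j b)).
    exact: smooth_flat.
  by apply/funext => x; rewrite mulN1r addrC.
rewrite (_ : box_bump a b = fun x => \prod_j (flat 1 (coord j x - coord j a) *
  flat 1 (coord j b - coord j x)))//.
elim: (index_enum _) => [|i s ih].
  rewrite (_ : (fun x => _) = fun=> 1); first exact: smooth_cst.
  by apply/funext => x; rewrite big_nil.
under eq_fun do rewrite big_cons.
exact: smoothM.
Qed.

Lemma box_bump_ge0 a b x : 0 <= box_bump a b x.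
Proof. by apply: prodr_ge0 => j _; rewrite mulr_ge0 ?flat1_ge0. Qed.

Lemma box_bump_gt0 a b x : box a b x -> 0 < box_bump a b x.
Proof.
by move=> H; apply: prodr_gt0 => j _; have /andP[? ?] := H j;
  rewrite mulr_gt0 ?flat1_gt0 ?subr_gt0.
Qed.

Lemma box_bump_eq0 a b x : ~ box a b x -> box_bump a b x = 0.
Proof.
move=> /existsNP[j] /negP H; apply/eqP/prodf_eq0; exists j => //.
have n0 (t : R) : ~~ (0 < t) -> flat 1 t == 0 by rewrite /flat => /negbTE ->.
rewrite mulf_eq0; case: (ltP (coord j a) (coord j x)) H => [_ /= H|h _].
  by rewrite [X in _ || X]n0 ?orbT// subr_gt0.
by rewrite n0// subr_gt0 -leNgt.
Qed.

(** These functions increase to the indicator of the open box. *)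
Definition box_cut a b (n : nat) x : R :=
  box_bump a b x / (box_bump a b x + n.+1%:R^-1).

Lemma box_cut_den a b n x : 0 < box_bump a b x + n.+1%:R^-1.
Proof. by rewrite ltr_wpDl ?box_bump_ge0// invr_gt0 ltr0n. Qed.

Lemma box_cut_ge0_le1 a b n x : 0 <= box_cut a b n x <= 1.
Proof.
rewrite divr_ge0 ?box_bump_ge0 ?(ltW (box_cut_den _ _ _ _))//=.
by rewrite ler_pdivrMr ?box_cut_den// mul1r lerDl.
Qed.

Lemma box_cut_test Om a b n : cbox a b `<=` Om -> test_function Om (box_cut a b n).
Proof.
move=> H.
have S : Defs.support (box_cut a b n) `<=` cbox a b.
  rewrite [X in _ `<=` X](closure_id _).1; last exact: closed_cbox.
  apply: closureS => x /=; apply: contra_neqP => nb.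
  rewrite /box_cut box_bump_eq0 ?mul0r// => xb; apply: nb => j.
  by have /andP[/ltW -> /ltW ->] := xb j.
split.
- apply: smoothM; first exact: smooth_box_bump.
  apply: smoothV => [x|]; first by rewrite gt_eqF ?box_cut_den.
  by apply: smoothD; [exact: smooth_box_bump|exact: smooth_cst].
- apply: subclosed_compact S; [exact: closed_closure|exact: compact_cbox].
- exact: subset_trans H.
Qed.

Lemma box_cut_cvg a b x : box_cut a b ^~ x @ \oo --> (\1_(box a b) x : R).
Proof.
rewrite indicE; case: (pselect (box a b x)) => [xb|nb].
  rewrite mem_set// -(@divff _ (box_bump a b x + 0)); last first.
    by rewrite addr0 gt_eqF ?box_bump_gt0.
  rewrite {1}addr0; apply: cvgM; first exact: cvg_cst.
  apply: cvgV; first by rewrite addr0 gt_eqF ?box_bump_gt0.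
  by apply: cvgD; [exact: cvg_cst|exact: cvg_harmonic].
rewrite memNset// (_ : (fun n => _) = fun=> 0); first exact: cvg_cst.
by apply/funext => n; rewrite /box_cut box_bump_eq0// mul0r.
Qed.

End test_functions.

(** * Lebesgue measure on R^3 *)

Lemma lebesgue_measure_segment_lty (R : realType) (a b : R) :
  (@lebesgue_measure R `[a, b]%classic < +oo)%E.
Proof. by rewrite lebesgue_measure_itv /=; case: ifPn => // _; rewrite -EFinB ltry. Qed.

Lemma segment_exhaust (R : realType) (x : R) :
  exists n, forall m, (n <= m)%N -> `[- m%:R, m%:R]%classic x.
Proof.
exists (Num.bound `|x|) => m nm; rewrite /= in_itv /= -ler_norml.
by apply: le_trans (ltW (archi_boundP (normr_ge0 x))) _; rewrite ler_nat.
Qed.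

Lemma lebesgue2_setX (R : realType) (A B : set R) :
  measurable (A : set (measurableTypeR R)) -> measurable (B : set (measurableTypeR R)) ->
  @lebesgue2 R (A `*` B) = (lebesgue_measure A * lebesgue_measure B)%E.
Proof. by move=> mA mB; rewrite /lebesgue2 product_measure1E. Qed.

(** Fubini's theorem on the product that defines [lebesgue3] asks for this. *)
Lemma sigma_finite_lebesgue2 (R : realType) :
  sigma_finite setT (@lebesgue2 R).
Proof.
exists (fun n => `[- n%:R, n%:R]%classic `*` `[- n%:R, n%:R]%classic).
  apply/esym/seteqP; split => // -[x y] _.
  have [n Hn] := segment_exhaust x; have [m Hm] := segment_exhaust y.
  by exists (maxn n m) => //; split; [apply: Hn; exact: leq_maxl|apply: Hm; exact: leq_maxr].
move=> n; split; first exact: measurableX.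
rewrite /lebesgue2 product_measure1E//.
by rewrite lte_mul_pinfty// ?lebesgue_measure_segment_lty// ge0_fin_numE// lebesgue_measure_segment_lty.
Qed.

HB.instance Definition _ (R : realType) :=
  Measure_isSigmaFinite.Build _ _ _ (@lebesgue2 R) (@sigma_finite_lebesgue2 R).

Section measurability.
Context {R : realType}.
Implicit Types (a b x : R3 R) (j : 'I_3).

Lemma box_prodE a b : box a b =
  (`]a.1.1, b.1.1[ `*` `]a.1.2, b.1.2[) `*` `]a.2, b.2[.
Proof.
apply/seteqP; split => [x H|x [[/= H1 H2] H3]] /=.
  rewrite !in_itv /=; split; last exact: (H (@Ordinal 3 2 isT)).
  by split; [exact: (H (@Ordinal 3 0 isT))|exact: (H (@Ordinal 3 1 isT))].
rewrite !in_itv /= in H1 H2 H3.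
by move=> [[|[|[|//]]] ?].
Qed.

Lemma measurable_box a b : measurable (box a b : set (mR3 R)).
Proof.
by rewrite box_prodE; apply: measurableX => //; apply: measurableX.
Qed.

Lemma measurable_cbox a b : measurable (cbox a b : set (mR3 R)).
Proof.
by rewrite cboxE; apply: measurableX => //; apply: measurableX.
Qed.

Lemma cbox_lty a b : (@lebesgue3 R (cbox a b) < +oo)%E.
Proof.
rewrite cboxE /lebesgue3 product_measure1E//; last exact: measurableX.
rewrite [X in (X * _ < _)%E]lebesgue2_setX//.
have fin c d : (@lebesgue_measure R `[c, d]%classic) \is a fin_num.
  by rewrite ge0_fin_numE// lebesgue_measure_segment_lty.
rewrite -ge0_fin_numE ?mule_ge0//.
by apply: fin_numM; [apply: fin_numM; exact: fin|exact: fin].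
Qed.

Definition ratR3 (q : rat * rat * rat) : R3 R :=
  (ratr q.1.1, ratr q.1.2, ratr q.2).

Lemma coord_ratR3 (q : 'I_3 -> rat) j :
  coord j (ratR3 (q (@Ordinal 3 0 isT), q (@Ordinal 3 1 isT), q (@Ordinal 3 2 isT)))
   = ratr (q j).
Proof.
by case: j => [[|[|[|//]]] p]; rewrite /coord /=; congr (ratr (q _)); exact: val_inj.
Qed.

Lemma R3_ballP x (e : R) y : ball x e y <-> forall j, `|coord j x - coord j y| < e.
Proof.
split=> [[[H1 H2] H3] [[|[|[|//]]] p]|H]; rewrite /coord//=.
split; last exact: (H (@Ordinal 3 2 isT)).
by split; [exact: (H (@Ordinal 3 0 isT))|exact: (H (@Ordinal 3 1 isT))].
Qed.

(** Boxes with rational corners make the union countable, which gives both the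
    measurability of open sets and the countable covers used for almost
    everywhere statements. *)
Lemma open_bigcup_box (Om : set (R3 R)) : open Om -> Om =
  \bigcup_(q in [set q : (rat * rat * rat) * (rat * rat * rat) |
      cbox (ratR3 q.1) (ratR3 q.2) `<=` Om]) box (ratR3 q.1) (ratR3 q.2).
Proof.
move=> oO; apply/seteqP; split; last first.
  move=> x [q /= qO xb]; apply: qO => j.
  by have /andP[/ltW -> /ltW ->] := xb j.
move=> x Ox; have /nbhs_ballP[e /= e0 He] : nbhs x Om by exact: open_nbhs_nbhs.
have /all_sig[p Hp] (j : 'I_3) : {q : rat | coord j x - e < ratr q < coord j x}.
  by apply/cid; have [|q] := @rat_in_itvoo R (coord j x - e) (coord j x);
    rewrite ?ltrBlDr ?ltrDl// in_itv; exists q.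
have /all_sig[r Hr] (j : 'I_3) : {q : rat | coord j x < ratr q < coord j x + e}.
  by apply/cid; have [|q] := @rat_in_itvoo R (coord j x) (coord j x + e);
    rewrite ?ltrDl// in_itv; exists q.
exists ((p (@Ordinal 3 0 isT), p (@Ordinal 3 1 isT), p (@Ordinal 3 2 isT)),
        (r (@Ordinal 3 0 isT), r (@Ordinal 3 1 isT), r (@Ordinal 3 2 isT))) => /=.
  move=> y yb; apply: He; apply/R3_ballP => j.
  have := yb j; rewrite !coord_ratR3 => /andP[H1 H2].
  have /andP[H3 _] := Hp j; have /andP[_ H4] := Hr j.
  by rewrite ltr_norml; apply/andP; split; lra.
move=> j; rewrite !coord_ratR3.
by have /andP[_ ->] := Hp j; have /andP[-> _] := Hr j.
Qed.

Lemma open_measurable_R3 (Om : set (R3 R)) : open Om -> measurable (Om : set (mR3 R)).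
Proof.
move=> /open_bigcup_box ->; rewrite bigcup_mkcond.
apply: (@countable_bigcupT_measurable _ (mR3 R)).
  exact: countableP.
by move=> q; case: ifPn => // _; exact: measurable_box.
Qed.

Lemma continuous_measurable_R3 (f : R3 R -> R) (D : set (mR3 R)) : continuous f ->
  measurable D -> measurable_fun D (f : mR3 R -> R).
Proof.
move=> cf mD; apply: (@measurable_funS _ _ _ _ setT) => //.
apply: (measurability _ (measurable_realfun.RGenOpens.measurableE R)).
move=> _ [_ [a [b ->] <-]]; rewrite setTI; apply: open_measurable_R3.
by move/continuousP: cf; apply; exact: interval_open.
Qed.

End measurability.

Section integration_by_parts.
Context {R : realType}.
Implicit Types (j : 'I_3) (x : R3 R) (h f : R -> R).

(** Integrating over an interval outside of which [h] vanishes leaves only the two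
    boundary terms, which are zero. *)
Lemma integral_derivative_eq0 h (h' : R -> R) (M : R) :
  (forall t : R, is_derive t 1 h (h' t)) -> continuous h' ->
  (forall t, M < `|t| -> h t = 0 /\ h' t = 0) ->
  (\int[lebesgue_measure]_t (h' t)%:E = 0)%E.
Proof.
move=> dh ch H0; pose b : R := `|M| + 1.
have b0 : 0 < b by rewrite ltr_pwDr.
have Mb : M < b by rewrite (le_lt_trans (ler_norm M))// ltrDl.
have ch0 : continuous h.
  move=> t; apply: differentiable_continuous; apply/derivable1_diffP.
  by have [] := dh t.
transitivity (\int[lebesgue_measure]_(t in `[(- b)%R, b]%classic) (h' t)%:E)%E.
  rewrite [RHS]integral_mkcond; apply: eq_integral => t _.
  rewrite patchE; case: ifPn => // /negP; rewrite inE /= in_itv /= -ler_norml => /negP.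
  by rewrite -ltNge => bt; have [_ ->] := H0 t (lt_trans Mb bt).
rewrite (@continuous_FTC2 R h' h); last 4 first.
- by rewrite -subr_gt0 opprK addr_gt0.
- exact: continuous_subspaceT.
- split.
  + by move=> t _; have [] := dh t.
  + by apply: cvg_at_right_filter; exact: ch0.
  + by apply: cvg_at_left_filter; exact: ch0.
- by move=> t _; rewrite derive1E; have [_ ->] := dh t.
have [|-> _] := H0 b; first by rewrite ger0_norm// ltW.
have [|-> _] := H0 (- b); first by rewrite normrN ger0_norm// ltW.
by rewrite sube0.
Qed.

Lemma integrable_compact_bounded (f : mR3 R -> R) (a b : R3 R) (C : R) (D : set (mR3 R)) :
  measurable D -> measurable_fun D f ->
  (forall x, D x -> `|f x| <= C) -> (forall x, ~ cbox a b x -> f x = 0) ->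
  lebesgue3.-integrable D (EFin \o f).
Proof.
move=> mD mf fC f0.
have H : lebesgue3.-integrable (D `&` cbox a b) (EFin \o f).
  apply: measurable_bounded_integrable.
  - by apply: measurableI => //; exact: measurable_cbox.
  - apply: (@le_lt_trans _ _ (lebesgue3 (cbox a b))); last exact: cbox_lty.
    apply: le_measure; rewrite ?inE; [|exact: measurable_cbox|exact: subIsetr].
    by apply: measurableI => //; exact: measurable_cbox.
  - by apply: measurable_funS mf => //; exact: subIsetl.
  - exists C; split; first exact: num_real.
    by move=> M CM x [Dx _]; apply: le_trans (fC x Dx) _; exact: ltW.
move: H; rewrite integrable_mkcond; last by apply: measurableI => //; exact: measurable_cbox.
rewrite [X in _ -> X]integrable_mkcond//; congr (integrable _ _ _).
apply/funext => x; rewrite !patchE in_setI.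
case: (boolP (x \in D)) => //= _; case: ifPn => // /negP; rewrite inE => /f0 /= ->.
by [].
Qed.

Lemma coordP (x y : R3 R) : (forall j, coord j x = coord j y) -> x = y.
Proof.
case: x y => [[x1 x2] x3] [[y1 y2] y3] H.
have := H (@Ordinal 3 0 isT); have := H (@Ordinal 3 1 isT).
by have := H (@Ordinal 3 2 isT); rewrite /coord /= => -> -> ->.
Qed.

Lemma le_norm_coord j x : `|coord j x| <= `|x|.
Proof.
by case: j => [[|[|[|//]]] p]; rewrite /coord prod_normE /= ?prod_normE /=
  !le_max lexx ?orbT.
Qed.

Lemma test_function_cube (Om : set (R3 R)) phi : test_function Om phi ->
  exists2 M : R, 0 <= M & forall x, phi x != 0 -> forall j, `|coord j x| <= M.
Proof.
move=> [_ cS _]; have [M [_ HM]] := compact_bounded cS.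
exists (`|M| + 1) => // x x0 j.
apply: le_trans (le_norm_coord j x) _.
apply: (HM (`|M| + 1)); first by rewrite (le_lt_trans (ler_norm M))// ltrDl.
exact: subset_closure.
Qed.

Lemma test_function_integrable (Om D : set (R3 R)) phi : test_function Om phi ->
  measurable (D : set (mR3 R)) -> lebesgue3.-integrable D (EFin \o (phi : mR3 R -> R)).
Proof.
move=> t mD; have [C HC] := test_function_bounded t.
have [M _ HM] := test_function_cube t.
apply: (@integrable_compact_bounded _ (- M, - M, - M) (M, M, M) C) => //.
- by apply: continuous_measurable_R3 => //; case: t => /smooth_continuous.
- move=> x xM; apply: contrapT => /eqP /HM H; apply: xM => k.
  have := H k; rewrite ler_norml.
  by case: k => [[|[|[|//]]] p].
Qed.

Lemma test_function_eq_setT (Om : set (R3 R)) phi : test_function Om phi ->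
  test_function setT phi.
Proof. by case=> ? ? ?; split. Qed.

(** By Fubini the variable [j] may be integrated first, where the fundamental
    theorem of calculus gives zero. *)
Lemma integral_partial (phi : R3 R -> R) j : test_function setT phi ->
  (\int[lebesgue3]_x (partial j phi x)%:E = 0)%E.
Proof.
move=> t; have [M M0 HM] := test_function_cube t.
have tj := test_function_partial j t; have [M' _ HM'] := test_function_cube tj.
have sphi : smooth phi by case: t.
pose F := partial j phi.
have iF : lebesgue3.-integrable setT (EFin \o (F : mR3 R -> R)).
  exact: test_function_integrable tj measurableT.
have [C HC] := test_function_bounded tj.
have cF : continuous F by case: tj => /smooth_continuous.
have vanish k x : Num.max M M' < `|coord k x| -> phi x = 0 /\ F x = 0.
  rewrite gt_max => /andP[h1 h2]; split; apply: contrapT => /eqP.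
    by move=> /HM/(_ k); rewrite leNgt h1.
  by move=> /HM'/(_ k); rewrite leNgt h2.
have line x : (\int[lebesgue_measure]_t (F (x + t *: R3_basis j))%:E = 0)%E.
  apply: (@integral_derivative_eq0 (fun t => phi (x + t *: R3_basis j)) _
     (`|coord j x| + Num.max M M')).
  - move=> s; apply: is_derive_line; exact: smooth_derivable.
  - move=> s; apply: continuous_comp; last exact: cF.
    by apply: cvgD; [exact: cvg_cst|apply: cvgZr_tmp; exact: cvg_id].
  - move=> s sM; apply: (vanish j).
    rewrite coordD coordZ coord_basis eqxx mulr1.
    have := ler_normB (coord j x + s) (coord j x); rewrite addrAC subrr add0r.
    move: sM; set m := Num.max _ _; lra.
have iF' : ((@lebesgue2 R \x @lebesgue_measure R)%E).-integrable setT (EFin \o (F : mR3 R -> R)).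
  exact: iF.
have lineE x : (\int[lebesgue_measure]_t (F (match val j with
      | 0%N => (x.1.1 + t, x.1.2, x.2) | 1%N => (x.1.1, x.1.2 + t, x.2)
      | _ => (x.1.1, x.1.2, x.2 + t) end))%:E = 0)%E.
  rewrite -[RHS](line x); apply: eq_integral => s _; congr (F _)%:E; apply/coordP => i.
  rewrite coordD coordZ coord_basis; case: (j) => [[|[|[|//]]] p];
    by case: i => [[|[|[|//]]] q]; rewrite /coord /= ?mulr1 ?mulr0 ?addr0.
have [jj|j2] := boolP (val j == 2)%N.
  apply: etrans (esym (integral12_prod_meas1 iF')) _.
  apply: integral0_eq => -[u v] _; rewrite /fubini_F.
  have := lineE (u, v, 0); rewrite (eqP jj) /= => H; rewrite -[RHS]H.
  by apply: eq_integral => s _ /=; rewrite add0r.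
apply: etrans (esym (integral21_prod_meas1 iF')) _.
have ae0 := ae_integrable2 iF'.
rewrite (ae_eq_integral (cst 0%E))//; first by rewrite integral0.
  exact: measurable_fubini_G iF'.
apply: filterS ae0 => w iw _; rewrite /fubini_G.
have [jj|j1] := boolP (val j == 1)%N.
  rewrite -[LHS]integral12_prod_meas1//.
  apply: integral0_eq => u _; rewrite /fubini_F.
  have := lineE (u, 0, w); rewrite (eqP jj) /= => H; rewrite -[RHS]H.
  by apply: eq_integral => s _ /=; rewrite add0r.
have jj : val j = 0%N by move: (j) j1 j2 => [[|[|[|]]]].
rewrite -[LHS]integral21_prod_meas1//.
apply: integral0_eq => u _; rewrite /fubini_G.
have := lineE (0, u, w); rewrite jj /= => H; rewrite -[RHS]H.
by apply: eq_integral => s _ /=; rewrite add0r.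
Qed.

End integration_by_parts.

(** * Square-integrable functions *)

Section real_L2.
Context {R : realType}.
Variables (Om : set (R3 R)) (mOm : measurable (Om : set (mR3 R))).
Implicit Types (a b c : R3 R -> R).

Definition integ a := lebesgue3.-integrable (Om : set (mR3 R)) (EFin \o (a : mR3 R -> R)).

Definition Int a : R := \int[lebesgue3]_(x in Om) a x.

Lemma integD a b : integ a -> integ b -> integ (fun x => a x + b x).
Proof. by move=> ia ib; exact: (@integrableD _ _ _ _ _ mOm _ _ ia ib). Qed.

Lemma integZ (k : R) a : integ a -> integ (fun x => k * a x).
Proof. by move=> ia; exact: (@integrableZl _ _ _ _ _ mOm k _ ia). Qed.

Lemma integN a : integ a -> integ (fun x => - a x).
Proof. by move=> /(integZ (-1)); congr integ; apply/funext => x; rewrite mulN1r. Qed.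

Lemma integ0 : integ (fun=> 0).
Proof. exact: integrable0. Qed.

Lemma integ_sum (I : Type) (s : seq I) (F : I -> R3 R -> R) :
  (forall i, integ (F i)) -> integ (fun x => \sum_(i <- s) F i x).
Proof.
move=> iF; elim: s => [|i s ih].
  by under eq_fun do rewrite big_nil; exact: integ0.
by under eq_fun do rewrite big_cons; exact: integD.
Qed.

Lemma le_integ a b : measurable_fun (Om : set (mR3 R)) (a : mR3 R -> R) ->
  (forall x, Om x -> `|a x| <= b x) -> integ b -> integ a.
Proof.
move=> ma ab ib; apply: (le_integrable mOm _ _ ib).
  exact/measurable_EFinP.
by move=> x Ox; rewrite lee_fin; apply: le_trans (ab x Ox) (ler_norm _).
Qed.

Lemma IntD a b : integ a -> integ b -> Int (fun x => a x + b x) = Int a + Int b.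
Proof. exact: RintegralD. Qed.

Lemma IntB a b : integ a -> integ b -> Int (fun x => a x - b x) = Int a - Int b.
Proof. exact: RintegralB. Qed.

Lemma IntZ (k : R) a : integ a -> Int (fun x => k * a x) = k * Int a.
Proof. exact: RintegralZl. Qed.

Lemma IntN a : integ a -> Int (fun x => - a x) = - Int a.
Proof.
by move=> ia; rewrite -mulN1r -IntZ//; congr Int; apply/funext => x; rewrite mulN1r.
Qed.

Lemma Int0 : Int (fun=> 0) = 0.
Proof. by rewrite /Int Rintegral_cst// mul0r. Qed.

Lemma Int_sum (I : Type) (s : seq I) (F : I -> R3 R -> R) :
  (forall i, integ (F i)) -> Int (fun x => \sum_(i <- s) F i x) = \sum_(i <- s) Int (F i).
Proof.
move=> iF; elim: s => [|i s ih].
  by under eq_fun do rewrite big_nil; rewrite big_nil Int0.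
by under eq_fun do rewrite big_cons; rewrite big_cons IntD ?ih//; exact: integ_sum.
Qed.

Lemma le_Int a b : integ a -> integ b -> (forall x, Om x -> a x <= b x) -> Int a <= Int b.
Proof. exact: le_Rintegral. Qed.

Lemma Int_ge0 a : (forall x, Om x -> 0 <= a x) -> 0 <= Int a.
Proof. by move=> H; rewrite /Int /Rintegral fine_ge0// integral_ge0// => x Ox; rewrite lee_fin H. Qed.

Definition aeq0 a := {ae lebesgue3, forall x : mR3 R, Om x -> a x = 0}.

Lemma Int_ae0 a : integ a -> aeq0 a -> Int a = 0.
Proof.
move=> ia a0; rewrite /Int /Rintegral.
rewrite (ae_eq_integral (cst 0%E))//; first by rewrite integral0.
  exact: measurable_int ia.
by apply: filterS a0 => x H Ox /=; rewrite H.
Qed.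

Lemma Int_eq0 a : integ a -> (forall x, Om x -> 0 <= a x) -> Int a = 0 -> aeq0 a.
Proof.
move=> ia a0 I0.
have [+ _] := ae_eq_integral_abs lebesgue3 mOm (measurable_int _ ia).
have -> : (\int[lebesgue3]_(x in (Om : set (mR3 R))) `|(EFin \o a) x|)%E = (Int a)%:E.
  rewrite /Int /Rintegral fineK; last exact: integrable_fin_num ia.
  by apply: eq_integral => x; rewrite inE => Ox; rewrite gee0_abs// lee_fin a0.
rewrite I0 => /(_ erefl); apply: filterS => x H Ox.
by have := H Ox => -[].
Qed.

Definition rL2 a := measurable_fun (Om : set (mR3 R)) (a : mR3 R -> R) /\
  integ (fun x => a x ^+ 2).

Lemma rL2_integM a b : rL2 a -> rL2 b -> integ (fun x => a x * b x).
Proof.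
move=> [ma ia] [mb ib].
apply: (@le_integ _ (fun x => a x ^+ 2 + b x ^+ 2)).
- exact: measurable_funM.
- move=> x _; rewrite ler_norml.
  have := sqr_ge0 (a x + b x); have := sqr_ge0 (a x - b x).
  by have := sqr_ge0 (a x); have := sqr_ge0 (b x); nra.
- exact: integD.
Qed.

Lemma rL2D a b : rL2 a -> rL2 b -> rL2 (fun x => a x + b x).
Proof.
move=> Ha Hb; split; first by apply: measurable_funD; [exact: Ha.1|exact: Hb.1].
rewrite (_ : (fun x => _) = fun x => a x ^+ 2 + (2 * (a x * b x) + b x ^+ 2)).
  by apply: integD; [exact: Ha.2|apply: integD; [apply: integZ; exact: rL2_integM|exact: Hb.2]].
by apply/funext => x; ring.
Qed.

Lemma rL2Z (k : R) a : rL2 a -> rL2 (fun x => k * a x).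
Proof.
move=> [ma ia]; split; first exact: measurable_funM.
rewrite (_ : (fun x => _) = fun x => k ^+ 2 * a x ^+ 2); first exact: integZ.
by apply/funext => x; rewrite exprMn.
Qed.

Lemma rL2N a : rL2 a -> rL2 (fun x => - a x).
Proof. by move=> /(rL2Z (-1)); congr rL2; apply/funext => x; rewrite mulN1r. Qed.

Lemma rL2B a b : rL2 a -> rL2 b -> rL2 (fun x => a x - b x).
Proof. by move=> ia /rL2N; exact: rL2D. Qed.

Lemma rL2_0 : rL2 (fun=> 0).
Proof.
split; first exact: measurable_cst.
by rewrite expr0n; exact: integ0.
Qed.

Lemma rL2_bounded_mul (C : R) a b : measurable_fun (Om : set (mR3 R)) (b : mR3 R -> R) ->
  (forall x, Om x -> `|b x| <= C) -> rL2 a -> rL2 (fun x => b x * a x).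
Proof.
move=> mb bC [ma ia]; split; first exact: measurable_funM.
apply: (@le_integ _ (fun x => C ^+ 2 * a x ^+ 2)).
- by apply: measurable_funX; exact: measurable_funM.
- move=> x Ox; rewrite ger0_norm ?sqr_ge0// exprMn ler_wpM2r ?sqr_ge0//.
  rewrite -[b x ^+ 2]ger0_norm ?sqr_ge0// normrX ler_pXn2r ?nnegrE//; first exact: bC.
  exact: le_trans (bC x Ox).
- exact: integZ.
Qed.

Lemma test_function_rL2 phi : test_function Om phi -> rL2 phi.
Proof.
move=> t; split.
  by apply: continuous_measurable_R3 => //; case: t => /smooth_continuous.
have : test_function Om (fun x => phi x * phi x).
  by apply: test_functionMl => //; case: t.
by move=> /(test_function_integrable)/(_ mOm).
Qed.

(** Replaces the Cauchy-Schwarz inequality throughout, which keeps square roots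
    out of the estimates. *)
Lemma young (s : R) a b : 0 < s -> rL2 a -> rL2 b ->
  2 * Int (fun x => a x * b x) <= s * Int (fun x => a x ^+ 2) + s^-1 * Int (fun x => b x ^+ 2).
Proof.
move=> s0 Ha Hb; rewrite -!IntZ; last 3 first.
- exact: Hb.2.
- exact: Ha.2.
- exact: rL2_integM.
rewrite -IntD; last 2 first.
- by apply: integZ; exact: Ha.2.
- by apply: integZ; exact: Hb.2.
apply: le_Int.
- by apply: integZ; exact: rL2_integM.
- by apply: integD; apply: integZ; [exact: Ha.2|exact: Hb.2].
move=> x _; rewrite -subr_ge0.
have -> : s * a x ^+ 2 + s^-1 * b x ^+ 2 - 2 * (a x * b x) = s^-1 * (s * a x - b x) ^+ 2.
  by field; rewrite gt_eqF.
by rewrite mulr_ge0 ?sqr_ge0// invr_ge0 ltW.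
Qed.

End real_L2.

Section completeness.
Context {R : realType}.
Variables (Om : set (R3 R)) (mOm : measurable (Om : set (mR3 R))).

Lemma half_exp_sqr k : (2^-1 ^+ k) ^+ 2 = (4 ^+ k)^-1 :> R.
Proof. by rewrite -exprM mulnC exprM !exprVn -natrX. Qed.

Lemma norm_le_sqr (x y : R) : 0 <= y -> (`|x| <= y) = (x ^+ 2 <= y ^+ 2).
Proof. by move=> y0; rewrite -(@ler_pXn2r _ 2) ?nnegrE// real_normK ?num_real. Qed.

Lemma geometric_limit (b : nat -> R) (s : R) :
  (forall n, `|b n.+1 - b n| <= s * 2^-1 ^+ n) ->
  exists l, forall n, `|l - b n| <= s * 2 * 2^-1 ^+ n.
Proof.
move=> Hb; pose e n : R := s * 2 * 2^-1 ^+ n.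
have eS n : e n.+1 = e n - s * 2^-1 ^+ n.
  by rewrite /e exprS mulrA -(mulrA s) mulfV ?pnatr_eq0// mulr1; ring.
have nd n m : (n <= m)%N -> b n - e n <= b m - e m.
  move=> /subnK <-; elim: (m - n)%N => [|k ih] //; apply: (le_trans ih).
  by rewrite addSn eS; have := Hb (k + n)%N; rewrite ler_norml => /andP[]; lra.
have ni n m : (n <= m)%N -> b m + e m <= b n + e n.
  move=> /subnK <-; elim: (m - n)%N => [|k ih] //; apply: le_trans ih.
  by rewrite addSn eS; have := Hb (k + n)%N; rewrite ler_norml => /andP[]; lra.
have s0 : 0 <= s by have := Hb 0%N; rewrite expr0 mulr1; exact: le_trans.
have e0 n : 0 <= e n by rewrite /e !mulr_ge0// exprn_ge0// invr_ge0.
have ub m n : b n - e n <= b m + e m.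
  apply: (le_trans (nd n (maxn n m) (leq_maxl _ _))).
  apply: le_trans (ni m (maxn n m) (leq_maxr _ _)).
  by have := e0 (maxn n m); lra.
pose E := range (fun n => b n - e n).
have E0 : E !=set0 by exists (b 0%N - e 0%N), 0%N.
have hE : has_sup E by split => //; exists (b 0%N + e 0%N) => _ [n _ <-]; exact: ub.
exists (sup E) => n; rewrite -/(e n).
have h1 : b n - e n <= sup E by apply: sup_upper_bound => //; exists n.
have h2 : sup E <= b n + e n by apply: ge_sup => // _ [k _ <-]; exact: ub.
by rewrite ler_norml; apply/andP; split; lra.
Qed.

Definition L2_cauchy (a : nat -> R3 R -> R) := forall e : R, 0 < e ->
  exists N, forall m n, (N <= m)%N -> (N <= n)%N ->
    Int Om (fun x => (a m x - a n x) ^+ 2) < e.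

(** The telescoping differences of a fast subsequence are dominated by
    [sqrt G * 2 ^ -k] for a single integrable [G], which gives both the
    pointwise limit and the convergence in mean. *)
Lemma rL2_complete_fast (b : nat -> R3 R -> R) : (forall n, rL2 Om (b n)) ->
  (forall k, Int Om (fun x => (b k.+1 x - b k x) ^+ 2) <= (8 ^+ k.+1)^-1) ->
  exists2 l, rL2 Om l & forall e : R, 0 < e ->
    exists N, forall n, (N <= n)%N -> Int Om (fun x => (l x - b n x) ^+ 2) < e.
Proof.
move=> Lb Hb.
have Ld k : rL2 Om (fun x => b k.+1 x - b k x) by exact: rL2B.
pose f (k : nat) (x : mR3 R) : \bar R := (4 ^+ k * (b k.+1 x - b k x) ^+ 2)%:E.
have f0 k x : (0 <= f k x)%E by rewrite /f lee_fin mulr_ge0 ?sqr_ge0 ?exprn_ge0.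
have if_ k : integ Om (fun x => 4 ^+ k * (b k.+1 x - b k x) ^+ 2).
  by apply: integZ => //; exact: (Ld k).2.
have mf k : measurable_fun (Om : set (mR3 R)) (f k) by exact: measurable_int (if_ k).
pose G x := (\sum_(k <oo) f k x)%E.
have G0 x : (0 <= G x)%E by apply: nneseries_ge0.
have mG : measurable_fun (Om : set (mR3 R)) G.
  by apply: ge0_emeasurable_sum => // k x _ _; exact: f0.
have IG : (\int[lebesgue3]_(x in (Om : set (mR3 R))) G x <= 1)%E.
  rewrite integral_nneseries//.
  apply: le_trans (@epsilon_trick0 R 1 xpredT ler01).
  apply: lee_nneseries => k _; first by move=> _; apply: integral_ge0 => x _; exact: f0.
  have := IntZ mOm (4 ^+ k) (Ld k).2; rewrite /Int /Rintegral => E.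
  rewrite -[leLHS]fineK; last exact: integrable_fin_num (if_ k).
  rewrite lee_fin [leLHS]E; apply: (@le_trans _ _ (4 ^+ k * (8 ^+ k.+1)^-1)).
    by rewrite ler_wpM2l ?exprn_ge0//; exact: Hb.
  rewrite natrX div1r -[X in _ <= X]mul1r -[8]/((4 * 2)%:R) natrM exprMn invfM mulrA.
  rewrite ler_wpM2r ?invr_ge0 ?exprn_ge0// ler_pdivrMr ?exprn_gt0// mul1r exprS.
  by rewrite ler_peMl ?exprn_ge0// ler1n.
have iG : lebesgue3.-integrable (Om : set (mR3 R)) G.
  apply/integrableP; split => //.
  apply: le_lt_trans (ltry 1); apply: le_trans IG.
  by under eq_integral do rewrite gee0_abs//.
pose D := (Om : set (mR3 R)) `&` [set x | (G x < +oo)%E].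
have mD : measurable D by exact: emeasurable_fun_infty_o.
have dG k x : (G x < +oo)%E -> (b k.+1 x - b k x) ^+ 2 <= fine (G x) * (2^-1 ^+ k) ^+ 2.
  move=> Gx; have Gf : G x \is a fin_num by rewrite ge0_fin_numE.
  have : (f k x <= G x)%E.
    apply: le_trans (nneseries_lim_ge k.+1 (fun n _ _ => f0 n x)).
    by rewrite big_nat_recr//= leeDr// sume_ge0.
  rewrite -{1}(fineK Gf) lee_fin mulrC -ler_pdivlMr ?exprn_gt0//.
  by rewrite half_exp_sqr.
have /choice[L HL] x : exists l, (G x < +oo)%E ->
    forall n, `|l - b n x| <= Num.sqrt (fine (G x)) * 2 * 2^-1 ^+ n.
  have [Gx|nG] := pselect (G x < +oo)%E; last by exists 0.
  have [|l Hl] := @geometric_limit (fun n => b n x) (Num.sqrt (fine (G x))).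
    move=> n; rewrite norm_le_sqr ?mulr_ge0 ?sqrtr_ge0 ?exprn_ge0 ?invr_ge0//.
    by rewrite exprMn sqr_sqrtr ?fine_ge0// dG.
  by exists l.
pose l x := if (G x < +oo)%E then L x else 0.
have lb n x : D x -> (l x - b n x) ^+ 2 <= 4 * (4^-1 ^+ n) * fine (G x).
  move=> [_ /= Gx]; rewrite /l Gx.
  have := HL x Gx n; rewrite norm_le_sqr ?mulr_ge0 ?sqrtr_ge0 ?exprn_ge0 ?invr_ge0//.
  move=> /le_trans; apply; rewrite !exprMn sqr_sqrtr ?fine_ge0//.
  rewrite half_exp_sqr exprVn -natrX.
  by rewrite le_eqVlt; apply/orP; left; apply/eqP; ring.
have aeD : {ae lebesgue3, forall x : mR3 R, Om x -> D x}.
  apply: filterS (integrable_ae mOm iG) => x H Ox; split => //=.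
  by have := H Ox; rewrite ge0_fin_numE.
have ml : measurable_fun (Om : set (mR3 R)) (l : mR3 R -> R).
  have -> : (Om : set (mR3 R)) = D `|` ((Om : set (mR3 R)) `\` D).
    apply/seteqP; split => x; last by case=> -[].
    by move=> Ox; have [Dx|nD] := pselect (D x); [left|right].
  apply/measurable_funU => //; first exact: measurableD.
  split.
    apply: (@measurable_fun_cvg _ _ _ D (fun n => b n : mR3 R -> R)).
      by move=> n; apply: measurable_funS (Lb n).1 => // x [].
    move=> x Dx; have Gx := Dx.2.
    apply/cvgrPdist_le => e e0 /=.
    have Hs : (Num.sqrt (fine (G x)) * 2 * 2^-1 ^+ n @[n --> \oo] --> (0:R)).
      rewrite -[X in _ --> X](mulr0 (Num.sqrt (fine (G x)) * 2)).
      by apply: cvgM; [exact: cvg_cst|apply: cvg_expr; rewrite ger0_norm ?invf_lt1 ?ltr1n].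
    move/cvgr0Pnorm_le: Hs => /(_ _ e0); apply: filterS => n Hn.
    rewrite /l Gx; apply: (le_trans (HL x Gx n)).
    exact: le_trans (ler_norm _) Hn.
  apply: (@eq_measurable_fun _ _ _ _ _ (cst (0:R))) => //.
  move=> x; rewrite inE => -[Ox nD] /=; rewrite /l; case: ifPn => // Gx.
  by exfalso; apply: nD.
pose c n : R := 4 * 4^-1 ^+ n.
have c0 n : 0 < c n by rewrite mulr_gt0 ?exprn_gt0 ?invr_gt0.
have lG n x : Om x -> (((l x - b n x) ^+ 2)%:E <= (c n)%:E * G x)%E.
  move=> Ox; case: (ltP (G x) +oo%E) => [Gx|]; last first.
    by rewrite leye_eq => /eqP ->; rewrite gt0_muley ?leey// lte_fin.
  have Gf : G x \is a fin_num by rewrite ge0_fin_numE.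
  by rewrite -(fineK Gf) -EFinM lee_fin; apply: lb.
have mlb n : measurable_fun (Om : set (mR3 R)) (fun x : mR3 R => (l x - b n x) ^+ 2).
  by apply: measurable_funX; apply: measurable_funB => //; exact: (Lb n).1.
have ilb n : integ Om (fun x => (l x - b n x) ^+ 2).
  apply: (le_integrable mOm _ _ (integrableZl mOm (c n) iG)).
    exact/measurable_EFinP.
  move=> x Ox; rewrite /= ger0_norm ?sqr_ge0// gee0_abs; first exact: lG.
  by rewrite mule_ge0// lee_fin ltW.
have Ilb n : Int Om (fun x => (l x - b n x) ^+ 2) <= c n.
  rewrite -lee_fin /Int /Rintegral fineK; last exact: integrable_fin_num (ilb n).
  apply: (@le_trans _ _ (\int[lebesgue3]_(x in (Om : set (mR3 R))) ((c n)%:E * G x))%E).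
    apply: ge0_le_integral => //.
    - by move=> x _; rewrite lee_fin sqr_ge0.
    - exact/measurable_EFinP.
    - by apply: measurable_funeM.
    - exact: lG.
  rewrite ge0_integralZl//; last by rewrite lee_fin ltW.
  by rewrite -[leRHS]mule1 lee_wpmul2l// lee_fin ltW.
exists l.
  have := rL2D mOm (conj (measurable_funB ml (Lb 0%N).1) (ilb 0%N)) (Lb 0%N).
  by congr rL2; apply/funext => x; rewrite /= subrK.
move=> e e0.
have Hs : (c n @[n --> \oo] --> (0:R)).
  rewrite -[X in _ --> X](mulr0 4).
  by apply: cvgM; [exact: cvg_cst|apply: cvg_expr; rewrite ger0_norm ?invf_lt1 ?ltr1n].
move/cvgr0Pnorm_lt: Hs => /(_ _ e0) [N _ HN].
exists N => n Nn; apply: (le_lt_trans (Ilb n)).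
by have := HN n Nn; rewrite ger0_norm// ltW.
Qed.

(** A Cauchy sequence converges as soon as a subsequence does. *)
Lemma rL2_complete (a : nat -> R3 R -> R) : (forall n, rL2 Om (a n)) -> L2_cauchy a ->
  exists2 l, rL2 Om l & forall e : R, 0 < e ->
    exists N, forall n, (N <= n)%N -> Int Om (fun x => (l x - a n x) ^+ 2) < e.
Proof.
move=> La ca.
have P k : 0 < (8 ^+ k.+1)^-1 :> R by rewrite invr_gt0 exprn_gt0.
have /choice[N HN] : forall k, exists N, forall m n, (N <= m)%N -> (N <= n)%N ->
    Int Om (fun x => (a m x - a n x) ^+ 2) < (8 ^+ k.+1)^-1 := fun k => ca _ (P k).
pose phi k := (k + \max_(i < k.+1) N i)%N.
have Nphi k : (N k <= phi k)%N.
  by apply: leq_trans (leq_addl _ _); exact: (leq_bigmax (@ord_max k)).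
have phiS k : (phi k <= phi k.+1)%N.
  by rewrite /phi [X in (_ <= _ + X)%N]big_ord_recr /= leq_add ?leq_maxl.
have [||l Ll Hl] := @rL2_complete_fast (fun k => a (phi k)).
- by move=> k; exact: La.
- by move=> k; apply/ltW/HN => //; exact: leq_trans (phiS k).
exists l => // e e0.
have e4 : 0 < e / 4 by rewrite divr_gt0.
have [N1 H1] := Hl _ e4; have [N2 H2] := ca _ e4.
exists N2 => n nN2; pose k := maxn N1 N2.
have kphi : (k <= phi k)%N by exact: leq_addr.
have A := H1 k (leq_maxl _ _).
have B := H2 (phi k) n (leq_trans (leq_maxr _ _) kphi) nN2.
have La1 := rL2B mOm Ll (La (phi k)); have La2 := rL2B mOm (La (phi k)) (La n).
apply: (@le_lt_trans _ _ (Int Om (fun x => 2 * (l x - a (phi k) x) ^+ 2 +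
   2 * (a (phi k) x - a n x) ^+ 2))).
  apply: le_Int => //.
  - exact: (rL2B mOm Ll (La n)).2.
  - by apply: integD => //; apply: integZ => //; [exact: La1.2|exact: La2.2].
  - move=> x _; have := sqr_ge0 ((l x - a (phi k) x) - (a (phi k) x - a n x)).
    by nra.
rewrite IntD//; last 2 first.
- by apply: integZ => //; exact: La1.2.
- by apply: integZ => //; exact: La2.2.
rewrite !IntZ//; [|exact: La2.2|exact: La1.2].
by move: A B; lra.
Qed.

End completeness.

Section fundamental_lemma.
Context {R : realType}.
Implicit Types (a b : R3 R).

Definition boxes : set (set (mR3 R)) := [set B | exists a b, B = box a b].

Lemma boxI a b c d : box a b `&` box c d =
  box (Num.max (coord (@Ordinal 3 0 isT) a) (coord (@Ordinal 3 0 isT) c),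
       Num.max (coord (@Ordinal 3 1 isT) a) (coord (@Ordinal 3 1 isT) c),
       Num.max (coord (@Ordinal 3 2 isT) a) (coord (@Ordinal 3 2 isT) c))
      (Num.min (coord (@Ordinal 3 0 isT) b) (coord (@Ordinal 3 0 isT) d),
       Num.min (coord (@Ordinal 3 1 isT) b) (coord (@Ordinal 3 1 isT) d),
       Num.min (coord (@Ordinal 3 2 isT) b) (coord (@Ordinal 3 2 isT) d)).
Proof.
apply/seteqP; split => [x [H1 H2] j|x H].
  have := H1 j; have := H2 j; case: j => [[|[|[|//]]] p]; rewrite /coord/=;
    by rewrite gt_max lt_min => /andP[-> ->] /andP[-> ->].
split=> j; have := H j; case: j => [[|[|[|//]]] p]; rewrite /coord/=;
    by rewrite gt_max lt_min => /andP[/andP[? ?] /andP[? ?]]; apply/andP.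
Qed.

Lemma setI_closed_boxes : setI_closed boxes.
Proof. by move=> _ _ [a [b ->]] [c [d ->]]; rewrite boxI; do 2 eexists. Qed.

Lemma measurable_boxes : @measurable _ (mR3 R) = <<s boxes >>.
Proof.
apply/seteqP; split; last first.
  apply: smallest_sub; first exact: sigma_algebra_measurable.
  by move=> _ [a [b ->]]; exact: measurable_box.
pose T := g_sigma_algebraType boxes.
have mc j : measurable_fun setT (coord j : T -> measurableTypeR R).
  apply: (measurability _ (measurable_realfun.RGenOpens.measurableE R)).
  move=> _ [_ [a [b ->] <-]]; rewrite setTI.
  have -> : coord j @^-1` `]a, b[%classic = \bigcup_n
      box (R:=R) (if val j == 0%N then a else - n%:R,
           if val j == 1%N then a else - n%:R,
           if val j == 2%N then a else - n%:R)
          (if val j == 0%N then b else n%:R,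
           if val j == 1%N then b else n%:R,
           if val j == 2%N then b else n%:R) :> set T.
    apply/seteqP; split => x; last first.
      move=> [n _ /(_ j)]; case: j => [[|[|[|//]]] p];
      by rewrite /coord /= in_itv.
    rewrite /= in_itv /= => xab.
    pose M := \big[Num.max/0]_(i : 'I_3) `|coord i x|.
    have HM i : `|coord i x| <= M by exact: le_bigmax.
    exists (Num.bound M) => // i.
    have M0 : 0 <= M by apply: le_trans (HM j).
    have : `|coord i x| < (Num.bound M)%:R by apply: le_lt_trans (HM i) (archi_boundP M0).
    rewrite ltr_norml; move: xab; case: j => [[|[|[|//]]] p];
      by case: i => [[|[|[|//]]] q]; rewrite /coord /=.
  apply: bigcupT_measurable => n; apply: sub_sigma_algebra.
  by do 2 eexists.
have mid : measurable_fun setT (fun x : T => (((coord (@Ordinal 3 0 isT) x : measurableTypeR R),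
   (coord (@Ordinal 3 1 isT) x : measurableTypeR R)), (coord (@Ordinal 3 2 isT) x : measurableTypeR R))).
  by apply: measurable_fun_pair => //; exact: measurable_fun_pair.
move=> A mA; have := mid measurableT A mA; rewrite setTI.
by congr (measurable _); apply/seteqP; split => -[[x y] z].
Qed.

Variables (Om : set (R3 R)) (oOm : open Om).
Let mOm : measurable (Om : set (mR3 R)) := open_measurable_R3 oOm.

Lemma rL2_integrable_box (g : R3 R -> R) a b : rL2 Om g -> cbox a b `<=` Om ->
  lebesgue3.-integrable (cbox a b : set (mR3 R)) (EFin \o (g : mR3 R -> R)).
Proof.
move=> [mg ig] abOm; have mb := measurable_cbox a b.
have mg' : measurable_fun (cbox a b : set (mR3 R)) (g : mR3 R -> R).
  exact: measurable_funS mg.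
have ig' : integ (cbox a b) (fun x => g x ^+ 2).
  exact: integrableS ig.
have i1 : integ (cbox a b) (fun=> 1).
  apply: measurable_bounded_integrable => //; first exact: cbox_lty.
  exists 1; split; first exact: num_real.
  by move=> M M1 x _; rewrite normr1 ltW.
apply: (@le_integ _ _ mb _ (fun x => g x ^+ 2 + 1)) => //; last exact: integD.
move=> x _; rewrite ler_norml.
have := sqr_ge0 (g x + 1); have := sqr_ge0 (g x - 1).
by have := sqr_ge0 (g x); nra.
Qed.

(** Dominated convergence along [box_cut], whose limit is the indicator of the
    box. *)
Lemma integral_box0 (g : R3 R -> R) a b : rL2 Om g ->
  (forall phi, test_function Om phi -> Int Om (fun x => g x * phi x) = 0) ->
  cbox a b `<=` Om -> (\int[lebesgue3]_(x in (box a b : set (mR3 R))) (g x)%:E = 0)%E.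
Proof.
move=> Lg g0 abOm.
have bOm : box a b `<=` Om.
  by move=> x xb; apply: abOm => j; have /andP[/ltW -> /ltW ->] := xb j.
pose f_ n (x : mR3 R) : \bar R := (g x * box_cut a b n x)%:E.
pose f (x : mR3 R) : \bar R := (g x * \1_(box a b) x)%:E.
have L0 n : (\int[lebesgue3]_(x in (Om : set (mR3 R))) f_ n x = 0)%E.
  have t := box_cut_test n abOm.
  have := g0 _ t; rewrite /Int /Rintegral => H.
  rewrite -[LHS]fineK ?H//; apply: integrable_fin_num => //.
  by apply: rL2_integM => //; exact: test_function_rL2.
have ig := rL2_integrable_box Lg abOm.
have idom : lebesgue3.-integrable (Om : set (mR3 R)) (fun x => (`|g x| * \1_(cbox a b) x)%:E).
  have := integrable_norm ig.
  rewrite integrable_mkcond; last exact: measurable_cbox.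
  rewrite [X in _ -> X]integrable_mkcond//; congr (integrable _ _ _).
  apply/funext => x; rewrite !patchE indicE.
  case: (boolP (x \in (cbox a b : set (mR3 R)))) => [xb|nxb] /=.
    rewrite mulr1 mem_set//; apply: abOm; by rewrite inE in xb.
  by rewrite mulr0; case: ifPn.
have : (\int[lebesgue3]_(x in (Om : set (mR3 R))) f_ n x)%E @[n --> \oo]
     --> (\int[lebesgue3]_(x in (Om : set (mR3 R))) f x)%E.
  apply: (dominated_cvg mOm _ _ _ idom).
  - move=> n; apply/measurable_EFinP; apply: measurable_funM; first exact: Lg.1.
    by apply: (test_function_rL2 mOm (box_cut_test n abOm)).1.
  - move=> x Ox; apply: cvg_EFin; first by near=> n.
    by apply: cvgM; [exact: cvg_cst|exact: box_cut_cvg].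
  - by [].
  - move=> n x Ox; rewrite lee_fin normrM ler_wpM2l//.
    have /andP[h0 h1] := box_cut_ge0_le1 a b n x; rewrite ger0_norm// indicE.
    case: (boolP (x \in cbox a b)) => //= /negP; rewrite inE => nb.
    rewrite /box_cut box_bump_eq0 ?mul0r// => xb; apply: nb => j.
    by have /andP[/ltW -> /ltW ->] := xb j.
have -> : (fun n => \int[lebesgue3]_(x in (Om : set (mR3 R))) f_ n x)%E = (fun=> 0%E).
  by apply/funext => n; exact: L0.
move=> H; have {H} := cvg_unique _ H (cvg_cst _) => /(_ _) E.
rewrite integral_mkcond; transitivity (\int[lebesgue3]_(x in (Om : set (mR3 R))) f x)%E.
  rewrite [RHS]integral_mkcond; congr (integral _ _ _); apply/funext => x.
  rewrite !patchE /f indicE; case: (boolP (x \in (box a b : set (mR3 R)))) => [xb|nxb] /=.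
    by rewrite mulr1 mem_set//; apply: bOm; rewrite inE in xb.
  by rewrite mulr0; case: ifPn.
exact: E.
Unshelve. all: end_near. Qed.

Lemma ae0_box (g : R3 R -> R) a b : rL2 Om g ->
  (forall phi, test_function Om phi -> Int Om (fun x => g x * phi x) = 0) ->
  cbox a b `<=` Om -> {ae lebesgue3, forall x : mR3 R, box a b x -> g x = 0}.
Proof.
move=> Lg g0 abOm; have mB := measurable_box a b.
have bc c d : box c d `<=` cbox c d.
  by move=> x xb j; have /andP[/ltW -> /ltW ->] := xb j.
have ig : lebesgue3.-integrable (box a b : set (mR3 R)) (EFin \o (g : mR3 R -> R)).
  apply: integrableS (rL2_integrable_box Lg abOm) => //; first exact: measurable_cbox.
  exact: bc.
pose P (S : set (mR3 R)) := (\int[lebesgue3]_(x in (box a b : set (mR3 R)) `&` S) (g x)%:E = 0)%E.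
have igS S : measurable S -> lebesgue3.-integrable ((box a b : set (mR3 R)) `&` S) (EFin \o (g : mR3 R -> R)).
  by move=> mS; apply: integrableS ig => //; exact: measurableI.
have HP : forall S, measurable S -> P S.
  rewrite measurable_boxes; apply: (dynkin_induction measurable_boxes setI_closed_boxes).
  - by rewrite /P setIT; exact: integral_box0.
  - move=> _ [c [d ->]]; rewrite /P boxI; apply: integral_box0 => //.
    apply: subset_trans abOm => x H j; have := H j.
    case: j => [[|[|[|//]]] p]; rewrite /coord /= ge_max le_min;
      by move=> /andP[/andP[-> _] /andP[-> _]].
  - move=> S mS PS; rewrite /P.
    have := integral_box0 Lg g0 abOm.
    rewrite -{1}(setUIDK (box a b : set (mR3 R)) S) integral_setU//.
    + by move: PS; rewrite /P setDE => ->; rewrite add0e.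
    + exact: measurableI.
    + exact: measurableD.
    + by rewrite setUIDK; exact: measurable_int ig.
    + by rewrite disj_set2E setIDA setIAC -setIDA setDv setI0.
  - move=> F mF tF PF; rewrite /P setI_bigcupr integral_bigcup.
    + by apply: eseries0 => n _ _; exact: PF.
    + exact: trivIset_setIl.
    + by move=> n; exact: measurableI.
    + by rewrite -setI_bigcupr; apply: igS; exact: bigcupT_measurable.
have := @integral_ae_eq _ _ _ _ _ mB (cst 0%E) _ ig (measurable_cst _).
move=> H; have {H} : ae_eq lebesgue3 (box a b : set (mR3 R)) (EFin \o (g : mR3 R -> R)) (cst 0%E).
  apply: H => E EB mE; rewrite integral0 -[RHS](HP E mE); congr (integral _ _ _).
  by rewrite setIidr.
by apply: filterS => x H xb; have := H xb => -[].
Qed.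

(** The fundamental lemma of the calculus of variations.  Test functions see
    the integral over every small box, boxes generate the Borel sets, and
    countably many of them cover the open set. *)
Lemma du_bois_reymond (g : R3 R -> R) : rL2 Om g ->
  (forall phi, test_function Om phi -> Int Om (fun x => g x * phi x) = 0) ->
  aeq0 Om g.
Proof.
move=> Lg g0.
pose N (n : nat) : set (mR3 R) :=
  if unpickle n is Some q then
    if `[< cbox (ratR3 q.1) (ratR3 q.2) `<=` Om >] then
      [set x | ~ (box (ratR3 q.1) (ratR3 q.2) x -> g x = 0)] else set0
  else set0.
have : lebesgue3.-negligible (\bigcup_n N n).
  apply: negligible_bigcup => n; rewrite /N.
  case: (unpickle n) => [q|]; last exact: negligible_set0.
  by case: asboolP => [qOm|_]; [exact: (ae0_box Lg g0 qOm)|exact: negligible_set0].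
apply: negligibleS => x /= /not_implyP[Ox gx].
move: (Ox); rewrite (open_bigcup_box oOm) => -[q /= qOm xq].
exists (pickle q); first exact: I.
rewrite /N pickleK /=; rewrite asboolT; last exact: qOm.
by move=> H; apply: gx; exact: H.
Qed.

End fundamental_lemma.

(** * Complex square-integrable functions *)

Section complex_parts.
Context {R : realType}.
Implicit Types (x y z : R[i]).

Lemma ReD x y : complex.Re (x + y) = complex.Re x + complex.Re y.
Proof. by case: x; case: y. Qed.
Lemma ImD x y : complex.Im (x + y) = complex.Im x + complex.Im y.
Proof. by case: x; case: y. Qed.
Lemma ReN x : complex.Re (- x) = - complex.Re x.
Proof. by case: x. Qed.
Lemma ImN x : complex.Im (- x) = - complex.Im x.
Proof. by case: x. Qed.
Lemma ReM x y : complex.Re (x * y) =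
  complex.Re x * complex.Re y - complex.Im x * complex.Im y.
Proof. by case: x; case: y. Qed.
Lemma ImM x y : complex.Im (x * y) =
  complex.Re x * complex.Im y + complex.Im x * complex.Re y.
Proof. by case: x; case: y. Qed.
Lemma ReJ x : complex.Re x^* = complex.Re x.
Proof. by case: x. Qed.
Lemma ImJ x : complex.Im x^* = - complex.Im x.
Proof. by case: x. Qed.
Lemma complexP x y : complex.Re x = complex.Re y ->
  complex.Im x = complex.Im y -> x = y.
Proof. by case: x; case: y => /= ? ? ? ? -> ->. Qed.
Lemma Re_sum (I : Type) (s : seq I) (F : I -> R[i]) :
  complex.Re (\sum_(i <- s) F i) = \sum_(i <- s) complex.Re (F i).
Proof. by elim: s => [|i s ih]; rewrite ?big_nil// !big_cons ReD ih. Qed.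
Lemma Im_sum (I : Type) (s : seq I) (F : I -> R[i]) :
  complex.Im (\sum_(i <- s) F i) = \sum_(i <- s) complex.Im (F i).
Proof. by elim: s => [|i s ih]; rewrite ?big_nil// !big_cons ImD ih. Qed.

(** the squared modulus, as a real number *)
Definition csq z : R := complex.Re z ^+ 2 + complex.Im z ^+ 2.

Lemma csq_ge0 z : 0 <= csq z.
Proof. by rewrite addr_ge0 ?sqr_ge0. Qed.

Lemma csq_eq0 z : (csq z == 0) = (z == 0).
Proof.
rewrite /csq paddr_eq0 ?sqr_ge0// !sqrf_eq0; case: z => a b /=.
by rewrite eq_complex.
Qed.

Lemma csq_gt0 z : z != 0 -> 0 < csq z.
Proof. by rewrite lt_def csq_ge0 andbT csq_eq0. Qed.

End complex_parts.

Definition Reic := (@ReD, @ImD, @ReN, @ImN, @ReM, @ImM, @ReJ, @ImJ).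

Section complex_L2.
Context {R : realType}.
Variables (Om : set (R3 R)) (mOm : measurable (Om : set (mR3 R))).
Implicit Types (a b : R3 R -> R) (f g h : R3 R -> R[i]).

Definition rp a b : R := Int Om (fun x => a x * b x).

Lemma rpC a b : rp a b = rp b a.
Proof. by rewrite /rp; congr Int; apply/funext => x; rewrite mulrC. Qed.

Lemma rpDl a a' b : rL2 Om a -> rL2 Om a' -> rL2 Om b ->
  rp (fun x => a x + a' x) b = rp a b + rp a' b.
Proof.
move=> La La' Lb; rewrite /rp -IntD//; try exact: rL2_integM.
by congr Int; apply/funext => x; rewrite mulrDl.
Qed.

Lemma rpZl (k : R) a b : rL2 Om a -> rL2 Om b -> rp (fun x => k * a x) b = k * rp a b.
Proof.
move=> La Lb; rewrite /rp -IntZ//; last exact: rL2_integM.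
by congr Int; apply/funext => x; rewrite mulrA.
Qed.

Lemma rpNl a b : rL2 Om a -> rL2 Om b -> rp (fun x => - a x) b = - rp a b.
Proof.
move=> La Lb; rewrite -mulN1r -rpZl//; congr rp.
by apply/funext => x; rewrite mulN1r.
Qed.

Lemma rpNr a b : rL2 Om a -> rL2 Om b -> rp a (fun x => - b x) = - rp a b.
Proof. by move=> La Lb; rewrite rpC rpNl// rpC. Qed.

Lemma rpZr (k : R) a b : rL2 Om a -> rL2 Om b -> rp a (fun x => k * b x) = k * rp a b.
Proof. by move=> La Lb; rewrite rpC rpZl// rpC. Qed.

Lemma rpDr a b b' : rL2 Om a -> rL2 Om b -> rL2 Om b' ->
  rp a (fun x => b x + b' x) = rp a b + rp a b'.
Proof. by move=> La Lb Lb'; rewrite rpC rpDl// (rpC b) (rpC b'). Qed.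

Definition re f : R3 R -> R := fun x => complex.Re (f x).
Definition im f : R3 R -> R := fun x => complex.Im (f x).

Lemma reD f g : re (fun x => f x + g x) = fun x => re f x + re g x.
Proof. by apply/funext => x; rewrite /re ReD. Qed.
Lemma imD f g : im (fun x => f x + g x) = fun x => im f x + im g x.
Proof. by apply/funext => x; rewrite /im ImD. Qed.
Lemma reN f : re (fun x => - f x) = fun x => - re f x.
Proof. by apply/funext => x; rewrite /re ReN. Qed.
Lemma imN f : im (fun x => - f x) = fun x => - im f x.
Proof. by apply/funext => x; rewrite /im ImN. Qed.
Lemma reZ (c : R[i]) f : re (fun x => c * f x) =
  fun x => complex.Re c * re f x + (- complex.Im c) * im f x.
Proof. by apply/funext => x; rewrite /re /im ReM mulNr. Qed.
Lemma imZ (c : R[i]) f : im (fun x => c * f x) =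
  fun x => complex.Re c * im f x + complex.Im c * re f x.
Proof. by apply/funext => x; rewrite /re /im ImM. Qed.

Definition cL2 f := rL2 Om (re f) /\ rL2 Om (im f).

Lemma cL2D f g : cL2 f -> cL2 g -> cL2 (fun x => f x + g x).
Proof. by move=> [? ?] [? ?]; split; rewrite ?reD ?imD; exact: rL2D. Qed.

Lemma cL2Z (c : R[i]) f : cL2 f -> cL2 (fun x => c * f x).
Proof.
by move=> [? ?]; split; rewrite ?reZ ?imZ; apply: rL2D => //; exact: rL2Z.
Qed.

Lemma cL2N f : cL2 f -> cL2 (fun x => - f x).
Proof. by move=> [? ?]; split; rewrite ?reN ?imN; exact: rL2N. Qed.

Lemma cL2B f g : cL2 f -> cL2 g -> cL2 (fun x => f x - g x).
Proof. by move=> ? /cL2N; exact: cL2D. Qed.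

Lemma cL2_0 : cL2 (fun=> 0).
Proof. by split; exact: rL2_0. Qed.

Lemma cL2_sum (I : Type) (s : seq I) (F : I -> R3 R -> R[i]) :
  (forall i, cL2 (F i)) -> cL2 (fun x => \sum_(i <- s) F i x).
Proof.
move=> LF; elim: s => [|i s ih].
  by under eq_fun do rewrite big_nil; exact: cL2_0.
by under eq_fun do rewrite big_cons; exact: cL2D.
Qed.

(** The underlying real inner product; the complex one is recovered from it
    by [ipE], since multiplication by [i] is an isometry. *)
Definition rip f g : R := locked (rp (re f) (re g) + rp (im f) (im g)).

Lemma ripE f g : rip f g = rp (re f) (re g) + rp (im f) (im g).
Proof. by rewrite /rip -lock. Qed.

Definition nsq f : R := rip f f.

Definition ip f g : R[i] := cintegral Om (fun x => f x * (g x)^*).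

Lemma ripC f g : rip f g = rip g f.
Proof. by rewrite !ripE rpC (rpC (im f)). Qed.

Lemma ripDl f f' g : cL2 f -> cL2 f' -> cL2 g ->
  rip (fun x => f x + f' x) g = rip f g + rip f' g.
Proof.
move=> [? ?] [? ?] [? ?]; rewrite !ripE reD imD !rpDl//.
by rewrite addrACA.
Qed.

Lemma ripDr f g g' : cL2 f -> cL2 g -> cL2 g' ->
  rip f (fun x => g x + g' x) = rip f g + rip f g'.
Proof. by move=> Lf Lg Lg'; rewrite ripC ripDl// !(ripC f). Qed.

Lemma ripZl (k : R) f g : cL2 f -> cL2 g ->
  rip (fun x => k%:C * f x) g = k * rip f g.
Proof.
move=> [Lr Li] [? ?]; rewrite !ripE reZ imZ /= oppr0.
have rz a b : (fun x => k * a x + 0 * b x) = (fun x : R3 R => k * a x).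
  by apply/funext => x; rewrite mul0r addr0.
by rewrite !rz !rpZl// mulrDr.
Qed.

Lemma ripNl f g : cL2 f -> cL2 g -> rip (fun x => - f x) g = - rip f g.
Proof. by move=> [? ?] [? ?]; rewrite !ripE reN imN !rpNl// opprD. Qed.

Lemma ripNr f g : cL2 f -> cL2 g -> rip f (fun x => - g x) = - rip f g.
Proof. by move=> Lf Lg; rewrite ripC ripNl// ripC. Qed.

Lemma ripBl f f' g : cL2 f -> cL2 f' -> cL2 g ->
  rip (fun x => f x - f' x) g = rip f g - rip f' g.
Proof. by move=> Lf Lf' Lg; rewrite ripDl ?ripNl//; exact: cL2N. Qed.

Lemma ripBr f g g' : cL2 f -> cL2 g -> cL2 g' ->
  rip f (fun x => g x - g' x) = rip f g - rip f g'.
Proof. by move=> Lf Lg Lg'; rewrite ripC ripBl// !(ripC f). Qed.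

Lemma rip0l g : rip (fun=> 0) g = 0.
Proof.
have rp0l b : rp (fun=> 0) b = 0.
  by rewrite /rp -[RHS](Int0 mOm); congr Int; apply/funext => x; rewrite mul0r.
by rewrite ripE !rp0l addr0.
Qed.

Lemma rip_suml (I : Type) (s : seq I) (F : I -> R3 R -> R[i]) g :
  (forall i, cL2 (F i)) -> cL2 g ->
  rip (fun x => \sum_(i <- s) F i x) g = \sum_(i <- s) rip (F i) g.
Proof.
move=> LF Lg; elim: s => [|i s ih].
  by under [in LHS]eq_fun do rewrite big_nil; rewrite big_nil rip0l.
under [in LHS]eq_fun do rewrite big_cons.
by rewrite big_cons ripDl ?ih//; exact: cL2_sum.
Qed.

Lemma rip_mulJ (c : R[i]) f g : cL2 f -> cL2 g ->
  rip (fun x => c * f x) g = rip f (fun x => c^* * g x).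
Proof.
move=> [Lr Li] [Mr Mi]; rewrite !ripE !reZ !imZ ReJ ImJ opprK.
do 2![rewrite rpDl; [|exact: rL2Z..|by []]].
do 2![rewrite rpDr; [|by []|exact: rL2Z..]].
do 4![rewrite rpZl; [|by []..]].
do 4![rewrite rpZr; [|by []..]].
by ring.
Qed.

Lemma nsq_ge0 f : 0 <= nsq f.
Proof.
by rewrite /nsq ripE; apply: addr_ge0; apply: Int_ge0 => x _; rewrite -expr2 sqr_ge0.
Qed.

Lemma nsqZ (c : R[i]) f : cL2 f -> nsq (fun x => c * f x) = csq c * nsq f.
Proof.
move=> Lf; rewrite /nsq rip_mulJ//; last exact: cL2Z.
have -> : (fun x => c^* * (c * f x)) = (fun x => (csq c)%:C * f x).
  apply/funext => x; rewrite mulrA; congr (_ * _).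
  by apply: complexP; rewrite ?ReM ?ImM ?ReJ ?ImJ /csq /=; ring.
by rewrite ripC ripZl.
Qed.

Lemma nsqN f : cL2 f -> nsq (fun x => - f x) = nsq f.
Proof. by move=> Lf; rewrite /nsq ripNl ?ripNr ?opprK//; exact: cL2N. Qed.

Lemma nsqD_eq f g : cL2 f -> cL2 g ->
  nsq (fun x => f x + g x) = nsq f + 2 * rip f g + nsq g.
Proof.
move=> Lf Lg; rewrite /nsq ripDl ?ripDr//; last exact: cL2D.
by rewrite (ripC g f); ring.
Qed.

Lemma nsqB_eq f g : cL2 f -> cL2 g ->
  nsq (fun x => f x - g x) = nsq f - 2 * rip f g + nsq g.
Proof.
move=> Lf Lg; rewrite nsqD_eq//; last exact: cL2N.
by rewrite nsqN// ripNr//; ring.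
Qed.

Lemma nsqD_le f g : cL2 f -> cL2 g ->
  nsq (fun x => f x + g x) <= 2 * nsq f + 2 * nsq g.
Proof.
move=> Lf Lg; have := nsq_ge0 (fun x => f x - g x).
by rewrite nsqB_eq// nsqD_eq//; lra.
Qed.

Lemma rip_young (s : R) f g : 0 < s -> cL2 f -> cL2 g ->
  2 * rip f g <= s * nsq f + s^-1 * nsq g.
Proof.
move=> s0 [Lr Li] [Mr Mi]; rewrite /nsq !ripE !mulrDr addrACA; apply: lerD.
- exact: young.
- exact: young.
Qed.

Lemma ipE f g : cL2 f -> cL2 g ->
  ip f g = (rip f g) +i* (rip f (fun x => 'i%C * g x)).
Proof.
move=> [Lr Li] [Mr Mi]; apply: complexP => /=.
  rewrite !ripE /rp -IntD//; try exact: rL2_integM.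
  by congr Int; apply/funext => x; rewrite /re /im !Reic mulrN opprK.
rewrite !ripE reZ imZ /=.
rewrite (_ : (fun x => 0 * re g x + - 1 * im g x) = fun x => - im g x); last first.
  by apply/funext => x; rewrite mul0r add0r mulN1r.
rewrite (_ : (fun x => 0 * im g x + 1 * re g x) = re g); last first.
  by apply/funext => x; rewrite mul0r add0r mul1r.
rewrite rpNr// /rp -IntN//; last exact: rL2_integM.
rewrite -IntD//; [|by apply: integN => //; exact: rL2_integM|exact: rL2_integM].
by congr Int; apply/funext => x; rewrite /re /im !Reic mulrN.
Qed.

Definition ceq0 f := {ae lebesgue3, forall x : mR3 R, Om x -> f x = 0}.

Lemma aeq0_ceq0 f : aeq0 Om (re f) -> aeq0 Om (im f) -> ceq0 f.
Proof.
move=> h1 h2; apply: filterS2 h1 h2 => x h1 h2 Ox.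
by apply: complexP; [exact: h1|exact: h2].
Qed.

Lemma nsq_eq0 f : cL2 f -> nsq f = 0 -> ceq0 f.
Proof.
move=> [Lr Li] f0.
have h a : 0 <= rp a a by apply: Int_ge0 => x _; rewrite -expr2 sqr_ge0.
have := h (re f); have := h (im f); rewrite /nsq !ripE in f0 => h1 h2.
apply: aeq0_ceq0.
  have : aeq0 Om (fun x => re f x ^+ 2).
    apply: (Int_eq0 mOm Lr.2) => [x _|]; first exact: sqr_ge0.
    by rewrite -[LHS]/(rp (re f) (re f)); lra.
  by apply: filterS => x H Ox; apply/eqP; rewrite -sqrf_eq0 H.
have : aeq0 Om (fun x => im f x ^+ 2).
  apply: (Int_eq0 mOm Li.2) => [x _|]; first exact: sqr_ge0.
  by rewrite -[LHS]/(rp (im f) (im f)); lra.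
by apply: filterS => x H Ox; apply/eqP; rewrite -sqrf_eq0 H.
Qed.

Lemma rip_ceq0 f g : cL2 f -> cL2 g -> ceq0 f -> rip f g = 0.
Proof.
move=> [Lr Li] [Mr Mi] f0; rewrite !ripE /rp !Int_ae0 ?addr0//; try exact: rL2_integM.
- by apply: filterS f0 => x H Ox; rewrite /im H// mul0r.
- by apply: filterS f0 => x H Ox; rewrite /re H// mul0r.
Qed.

End complex_L2.

(** * Weak derivatives and the Sobolev space of zero trace *)

Section sobolev_scalar.
Context {R : realType}.
Variables (Om : set (R3 R)) (oOm : open Om).
Let mOm : measurable (Om : set (mR3 R)) := open_measurable_R3 oOm.
Implicit Types (a b : R3 R -> R) (u v f g psi : R3 R -> R[i])
  (G H : 'I_3 -> R3 R -> R[i]) (j : 'I_3).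

Lemma Int_test_function phi : test_function Om phi -> Int Om phi = Int setT phi.
Proof.
move=> [_ _ sO]; rewrite /Int [LHS]Rintegral_mkcond; congr (Rintegral _ _ _).
apply/funext => x; rewrite patchE; case: ifPn => // /negP; rewrite inE => nO.
by rewrite notin_support// => /sO.
Qed.

Lemma Int_partial phi j : test_function Om phi -> Int Om (partial j phi) = 0.
Proof.
move=> t; rewrite Int_test_function; last exact: test_function_partial.
rewrite /Int /Rintegral integral_partial//; exact: test_function_eq_setT t.
Qed.

(** [b] is the [j]-th distributional derivative of [a] on [Om]. *)
Definition wd j a b := forall phi, test_function Om phi ->
  Int Om (fun x => a x * partial j phi x) = - Int Om (fun x => b x * phi x).

(** Integration by parts: the integral of [partial j (a phi)] vanishes. *)
Lemma smooth_wd j a : smooth a -> wd j a (partial j a).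
Proof.
move=> sf phi t; have sphi : smooth phi by case: t.
have tf := test_functionMl t sf.
have := Int_partial j tf.
have -> : partial j (fun x => a x * phi x) =
    fun x => a x * partial j phi x + partial j a x * phi x.
  apply/funext => x; rewrite partialM; try exact: smooth_derivable.
  by rewrite (mulrC (phi x)).
rewrite IntD//; first by move/eqP; rewrite addr_eq0 => /eqP.
- apply: (test_function_integrable _ mOm).
  apply: (test_functionMl (test_function_partial j t) sf).
- apply: (test_function_integrable _ mOm).
  apply: (test_functionMl t); exact: smooth_partial.
Qed.

Lemma wd_unique j a b b' : rL2 Om b -> rL2 Om b' -> wd j a b -> wd j a b' ->
  aeq0 Om (fun x => b x - b' x).
Proof.
move=> Lb Lb' wb wb'; apply: (du_bois_reymond oOm); first exact: rL2B.
move=> phi t; have Lt := test_function_rL2 mOm t.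
rewrite (_ : (fun x => (b x - b' x) * phi x) = fun x => b x * phi x - b' x * phi x).
  rewrite IntB//; try exact: rL2_integM.
  by apply/eqP; rewrite subr_eq0 -eqr_opp -wb// -wb'.
by apply/funext => x; rewrite mulrBl.
Qed.

Definition cwd j u g := wd j (re u) (re g) /\ wd j (im u) (im g).

Definition ctest psi := test_function Om (re psi) /\ test_function Om (im psi).

Definition csmooth psi := smooth (re psi) /\ smooth (im psi).

Definition dC j psi : R3 R -> R[i] :=
  fun x => (partial j (re psi) x) +i* (partial j (im psi) x).

Lemma ctest_cL2 psi : ctest psi -> cL2 Om psi.
Proof. by move=> [? ?]; split; exact: test_function_rL2. Qed.

Lemma ctest_dC j psi : ctest psi -> ctest (dC j psi).
Proof. by move=> [? ?]; split; exact: test_function_partial. Qed.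

Lemma ctest_dC_cL2 j psi : ctest psi -> cL2 Om (dC j psi).
Proof. by move=> t; apply: ctest_cL2; exact: ctest_dC. Qed.

Lemma ctest0 : ctest (fun=> 0).
Proof. by split; exact: test_function0. Qed.

Lemma ctestD psi psi' : ctest psi -> ctest psi' -> ctest (fun x => psi x + psi' x).
Proof. by move=> [? ?] [? ?]; split; rewrite ?reD ?imD; exact: test_functionD. Qed.

Lemma ctestZ (c : R[i]) psi : ctest psi -> ctest (fun x => c * psi x).
Proof.
move=> [? ?]; split; rewrite ?reZ ?imZ; apply: test_functionD;
  exact: test_functionZ.
Qed.

Lemma ctest_smooth psi : ctest psi -> csmooth psi.
Proof. by move=> [[? _ _] [? _ _]]. Qed.

Lemma dCD j psi psi' : csmooth psi -> csmooth psi' ->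
  dC j (fun x => psi x + psi' x) = fun x => dC j psi x + dC j psi' x.
Proof.
move=> [? ?] [? ?]; apply/funext => x; apply: complexP => /=; rewrite ?reD ?imD partialD//;
  exact: smooth_derivable.
Qed.

Lemma partialZ j (c : R) a x : smooth a -> partial j (fun x => c * a x) x = c * partial j a x.
Proof.
move=> sa; rewrite partialM; [|exact: derivable_cst|exact: smooth_derivable].
by rewrite partial_cst mulr0 addr0.
Qed.

Lemma dCZ j (c : R[i]) psi : csmooth psi ->
  dC j (fun x => c * psi x) = fun x => c * dC j psi x.
Proof.
move=> [? ?]; apply/funext => x; apply: complexP => /=; rewrite ?reZ ?imZ partialD ?partialZ//;
  try (apply: smooth_derivable; exact: smoothZ).
- by rewrite !Reic /= mulNr.
- by rewrite !Reic /=.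
Qed.

(** Closure of the test functions in the graph norm of the gradient.  The
    gradient is carried along as a second component, so that no uniqueness
    of weak derivatives is involved in its use. *)
Definition cl10 u G := [/\ cL2 Om u, forall j, cL2 Om (G j) &
  forall e : R, 0 < e -> exists psi, [/\ ctest psi, nsq Om (fun x => u x - psi x) < e &
    forall j, nsq Om (fun x => G j x - dC j psi x) < e]].

Lemma le0_eps (X K : R) : (forall e, 0 < e -> X <= e * K) -> X <= 0.
Proof.
move=> H; rewrite leNgt; apply/negP => X0.
have K0 : 0 < K.
  rewrite ltNge; apply/negP => K0.
  by have := H 1 ltr01; rewrite mul1r => XK; have := lt_le_trans X0 (le_trans XK K0); rewrite ltxx.
have e0 : 0 < X / (2 * K) by rewrite divr_gt0// mulr_gt0.
have := H _ e0; rewrite (_ : X / (2 * K) * K = X / 2); first by lra.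
by field; rewrite gt_eqF.
Qed.

(** the form in which convergence in mean is used to pass to the limit in a
    pairing *)
Lemma rip_small (e : R) f g : 0 < e -> cL2 Om f -> cL2 Om g ->
  nsq Om f < e ^+ 2 -> rip Om f g <= e * (1 + nsq Om g).
Proof.
move=> e0 Lf Lg fe.
have := rip_young mOm (s := e^-1) _ Lf Lg; rewrite invr_gt0 invrK => /(_ e0) H.
have : e^-1 * nsq Om f <= e.
  by rewrite ler_pdivrMl// -expr2 ltW.
have := mulr_ge0 (ltW e0) (nsq_ge0 Om g).
by move: H; move: (nsq Om f) (nsq Om g) (rip Om f g) => A B C; lra.
Qed.

(** An identity that is continuous in the graph norm passes from test
    functions to their closure. *)
Lemma cl10_density (w : R3 R -> R[i]) (W : 'I_3 -> R3 R -> R[i]) u G :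
  cL2 Om w -> (forall j, cL2 Om (W j)) ->
  (forall psi, ctest psi -> rip Om psi w + \sum_j rip Om (dC j psi) (W j) = 0) ->
  cl10 u G -> rip Om u w + \sum_j rip Om (G j) (W j) = 0.
Proof.
have half (w' : R3 R -> R[i]) W' : cL2 Om w' -> (forall j, cL2 Om (W' j)) ->
  (forall psi, ctest psi -> rip Om psi w' + \sum_j rip Om (dC j psi) (W' j) = 0) ->
  cl10 u G -> rip Om u w' + \sum_j rip Om (G j) (W' j) <= 0.
  move=> Lw LW H [Lu LG Hu].
  pose K := 1 + nsq Om w' + \sum_j (1 + nsq Om (W' j)).
  apply: (@le0_eps _ K) => e e0.
  have [psi [tp Hp Hj]] := Hu (e ^+ 2) (exprn_gt0 2 e0).
  have -> : rip Om u w' + \sum_j rip Om (G j) (W' j) =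
     (rip Om u w' - rip Om psi w') + \sum_j (rip Om (G j) (W' j) - rip Om (dC j psi) (W' j)).
    rewrite sumrB; have := H psi tp.
    by move: (\sum_j rip Om (dC j psi) _) (\sum_j rip Om (G j) _) => A B; lra.
  rewrite /K mulrDr mulr_sumr; apply: lerD.
    rewrite -ripBl//; last exact: ctest_cL2.
    by apply: rip_small => //; apply: cL2B => //; exact: ctest_cL2.
  apply: ler_sum => j _; rewrite -ripBl//; last exact: ctest_dC_cL2.
  by apply: rip_small => //; apply: cL2B => //; exact: ctest_dC_cL2.
move=> Lw LW H cu; apply/eqP; rewrite eq_le half//=.
have := half (fun x => - w x) (fun j x => - W j x).
have [Lu LG _] := cu.
have -> : rip Om u (fun x => - w x) + \sum_j rip Om (G j) (fun x => - W j x) =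
   - (rip Om u w + \sum_j rip Om (G j) (W j)).
  by rewrite ripNr// opprD -sumrN; congr (_ + _); apply: eq_bigr => j _; rewrite ripNr.
rewrite oppr_le0; apply => //.
- exact: cL2N.
- by move=> j; exact: cL2N.
move=> psi tp; have Lp := ctest_cL2 tp; have Ld j := ctest_dC_cL2 j tp.
rewrite ripNr// (eq_bigr (fun j => - rip Om (dC j psi) (W j))); last first.
  by move=> j _; rewrite ripNr.
by rewrite sumrN -opprD H// oppr0.
Qed.

Lemma cl10_ctest psi : ctest psi -> cl10 psi (fun j => dC j psi).
Proof.
move=> tp; split; first exact: ctest_cL2.
  by move=> j; exact: ctest_dC_cL2.
move=> e e0; exists psi; split => //; first by under eq_fun do rewrite subrr; rewrite /nsq rip0l.
by move=> j; under eq_fun do rewrite subrr; rewrite /nsq rip0l.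
Qed.

End sobolev_scalar.

Section sobolev_closure.
Context {R : realType}.
Variables (Om : set (R3 R)) (oOm : open Om).
Let mOm : measurable (Om : set (mR3 R)) := open_measurable_R3 oOm.
Implicit Types (a b phi : R3 R -> R) (u v f g psi : R3 R -> R[i])
  (G H : 'I_3 -> R3 R -> R[i]) (j : 'I_3).

Lemma lt_quarters (s t e : R) : s < e / 4 -> t < e / 4 -> 2 * s + 2 * t < e.
Proof. by move=> ? ?; lra. Qed.

Lemma rip_real u phi : rip Om u (fun x => (phi x)%:C) = rp Om (re u) phi.
Proof.
rewrite ripE -[X in _ + X = _](_ : 0 = _) ?addr0 // /rp -[LHS](Int0 mOm).
by congr Int; apply/funext => x; rewrite /im /= mulr0.
Qed.

Lemma rip_imag u phi : rip Om u (fun x => 0 +i* phi x) = rp Om (im u) phi.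
Proof.
rewrite ripE -[X in X + _ = _](_ : 0 = _) ?add0r // /rp -[LHS](Int0 mOm).
by congr Int; apply/funext => x; rewrite /re /= mulr0.
Qed.

Lemma cL2_real a : rL2 Om a -> cL2 Om (fun x => (a x)%:C).
Proof. by move=> La; split => //; exact: rL2_0. Qed.

Lemma cL2_imag a : rL2 Om a -> cL2 Om (fun x => 0 +i* a x).
Proof. by move=> La; split => //; exact: rL2_0. Qed.

Lemma sum_delta j (F : 'I_3 -> R) : (forall k, k != j -> F k = 0) -> \sum_k F k = F j.
Proof. by move=> F0; rewrite (bigD1 j)//= big1 ?addr0. Qed.

(** Integration by parts holds for test functions and is stable under the limits
    that define [cl10]. *)
Lemma cl10_cwd u G j : cl10 Om u G -> cwd Om j u (G j).
Proof.
move=> cu; have [Lu LG _] := cu; split => phi t.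
  have Lphi := test_function_rL2 mOm t.
  have Ldphi := test_function_rL2 mOm (test_function_partial j t).
  pose W k : R3 R -> R[i] := fun x => if k == j then (phi x)%:C else 0.
  have := @cl10_density _ _ oOm (fun x => (partial j phi x)%:C) W u G.
  have S H : \sum_k rip Om (H k) (W k) = rp Om (re (H j)) phi.
    rewrite (@sum_delta j) /W ?eqxx ?rip_real// => k /negbTE ->.
    by rewrite ripC rip0l.
  rewrite S rip_real => E; apply/eqP; rewrite -addr_eq0; apply/eqP; apply: E => //.
  - exact: cL2_real.
  - by move=> k; rewrite /W; case: eqP => _; [exact: cL2_real|exact: cL2_0].
  - move=> psi [tr ti]; rewrite S rip_real.
    by apply/eqP; rewrite addr_eq0; apply/eqP; apply: smooth_wd => //; case: tr.
have Lphi := test_function_rL2 mOm t.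
have Ldphi := test_function_rL2 mOm (test_function_partial j t).
pose W k : R3 R -> R[i] := fun x => if k == j then 0 +i* phi x else 0.
have := @cl10_density _ _ oOm (fun x => 0 +i* partial j phi x) W u G.
have S H : \sum_k rip Om (H k) (W k) = rp Om (im (H j)) phi.
  rewrite (@sum_delta j) /W ?eqxx ?rip_imag// => k /negbTE ->.
  by rewrite ripC rip0l.
rewrite S rip_imag => E; apply/eqP; rewrite -addr_eq0; apply/eqP; apply: E => //.
- exact: cL2_imag.
- by move=> k; rewrite /W; case: eqP => _; [exact: cL2_imag|exact: cL2_0].
- move=> psi [tr ti]; rewrite S rip_imag.
  by apply/eqP; rewrite addr_eq0; apply/eqP; apply: smooth_wd => //; case: ti.
Qed.

Lemma ceq0_nsq f : cL2 Om f -> ceq0 Om f -> nsq Om f = 0.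
Proof. by move=> Lf f0; rewrite /nsq rip_ceq0. Qed.

Lemma nsq_ae f g : cL2 Om f -> cL2 Om g -> ceq0 Om (fun x => f x - g x) ->
  nsq Om f = nsq Om g.
Proof.
move=> Lf Lg fg; have Lfg : cL2 Om (fun x => f x - g x) by exact: cL2B.
have -> : f = fun x => g x + (f x - g x) by apply/funext => x; rewrite addrC subrK.
by rewrite nsqD_eq// [nsq Om (fun x => f x - _)]ceq0_nsq// ripC rip_ceq0// mulr0 !addr0.
Qed.

Lemma cl10_ae u G u' G' : cl10 Om u G -> cL2 Om u' -> (forall j, cL2 Om (G' j)) ->
  ceq0 Om (fun x => u' x - u x) -> (forall j, ceq0 Om (fun x => G' j x - G j x)) ->
  cl10 Om u' G'.
Proof.
move=> [Lu LG Hu] Lu' LG' uu' GG'; split => // e e0.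
have [psi [tp Hp Hj]] := Hu e e0; exists psi; split => //.
  rewrite (@nsq_ae _ (fun x => u x - psi x))//.
  - by apply: cL2B => //; exact: ctest_cL2.
  - by apply: cL2B => //; exact: ctest_cL2.
  - by apply: filterS uu' => x Hx Ox; rewrite -(Hx Ox); ring.
move=> j; rewrite (@nsq_ae _ (fun x => G j x - dC j psi x))//.
- by apply: cL2B => //; exact: ctest_dC_cL2.
- by apply: cL2B => //; exact: ctest_dC_cL2.
- by apply: filterS (GG' j) => x Hx Ox; rewrite -(Hx Ox); ring.
Qed.

Lemma cl10D u G v H : cl10 Om u G -> cl10 Om v H ->
  cl10 Om (fun x => u x + v x) (fun j x => G j x + H j x).
Proof.
move=> [Lu LG Hu] [Lv LH Hv]; split.
- exact: cL2D.
- by move=> j; exact: cL2D.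
move=> e e0; have e4 : 0 < e / 4 by rewrite divr_gt0.
have [p [tp P1 P2]] := Hu _ e4; have [q [tq Q1 Q2]] := Hv _ e4.
have Lp := ctest_cL2 oOm tp; have Lq := ctest_cL2 oOm tq.
exists (fun x => p x + q x); split; first exact: ctestD.
  rewrite (_ : (fun x => _) = fun x => (u x - p x) + (v x - q x)); last first.
    by apply/funext => x; ring.
  apply: le_lt_trans (nsqD_le mOm _ _) _; [exact: cL2B|exact: cL2B|].
  exact: lt_quarters P1 Q1.
move=> j; rewrite dCD; [|exact: ctest_smooth tp|exact: ctest_smooth tq].
have Ldp := ctest_dC_cL2 oOm j tp; have Ldq := ctest_dC_cL2 oOm j tq.
rewrite (_ : (fun x => _) = fun x => (G j x - dC j p x) + (H j x - dC j q x)); last first.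
  by apply/funext => x; ring.
apply: le_lt_trans (nsqD_le mOm _ _) _; [exact: cL2B|exact: cL2B|].
exact: lt_quarters (P2 j) (Q2 j).
Qed.

Lemma cl10Z (c : R[i]) u G : cl10 Om u G ->
  cl10 Om (fun x => c * u x) (fun j x => c * G j x).
Proof.
move=> [Lu LG Hu]; split.
- exact: cL2Z.
- by move=> j; exact: cL2Z.
move=> e e0; have c1 : 0 < csq c + 1 by rewrite ltr_wpDl ?csq_ge0.
have [p [tp P1 P2]] := Hu (e / (csq c + 1)) (divr_gt0 e0 c1).
have Lp := ctest_cL2 oOm tp.
have small f : cL2 Om f -> nsq Om f < e / (csq c + 1) -> nsq Om (fun x => c * f x) < e.
  move=> Lf fe; rewrite nsqZ//; apply: (@le_lt_trans _ _ ((csq c + 1) * nsq Om f)).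
    by rewrite ler_wpM2r ?nsq_ge0// lerDl.
  by rewrite -ltr_pdivlMl// mulrC.
exists (fun x => c * p x); split; first exact: ctestZ.
  rewrite (_ : (fun x => _) = fun x => c * (u x - p x)); last first.
    by apply/funext => x; rewrite mulrBr.
  by apply: small => //; exact: cL2B.
move=> j; rewrite dCZ; last exact: ctest_smooth tp.
have Ldp := ctest_dC_cL2 oOm j tp.
rewrite (_ : (fun x => _) = fun x => c * (G j x - dC j p x)); last first.
  by apply/funext => x; rewrite mulrBr.
by apply: small => //; exact: cL2B.
Qed.

Lemma cl10N u G : cl10 Om u G -> cl10 Om (fun x => - u x) (fun j x => - G j x).
Proof.
move=> /(cl10Z (-1)); congr cl10; first by apply/funext => x; rewrite mulN1r.
by apply/funext => j; apply/funext => x; rewrite mulN1r.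
Qed.

Lemma cl10B u G v H : cl10 Om u G -> cl10 Om v H ->
  cl10 Om (fun x => u x - v x) (fun j x => G j x - H j x).
Proof. by move=> cu /cl10N; exact: cl10D. Qed.

Lemma cl10_0 : cl10 Om (fun=> 0) (fun _ _ => 0).
Proof.
have := cl10_ctest oOm (ctest0 Om); congr cl10.
apply/funext => j; apply/funext => x; rewrite /dC.
by rewrite (_ : re _ = fun=> 0)// (_ : im _ = fun=> 0)// partial_cst.
Qed.

Lemma cl10_sum (I : Type) (s : seq I) (U : I -> R3 R -> R[i]) (G : I -> 'I_3 -> R3 R -> R[i]) :
  (forall i, cl10 Om (U i) (G i)) ->
  cl10 Om (fun x => \sum_(i <- s) U i x) (fun j x => \sum_(i <- s) G i j x).
Proof.
move=> cU; elim: s => [|i s ih].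
  have := cl10_0; congr cl10; first by apply/funext => x; rewrite big_nil.
  by apply/funext => j; apply/funext => x; rewrite big_nil.
have := cl10D (cU i) ih; congr cl10; first by apply/funext => x; rewrite big_cons.
by apply/funext => j; apply/funext => x; rewrite big_cons.
Qed.

Lemma cl10_closed u G : cL2 Om u -> (forall j, cL2 Om (G j)) ->
  (forall e : R, 0 < e -> exists v H, [/\ cl10 Om v H,
     nsq Om (fun x => u x - v x) < e & forall j, nsq Om (fun x => G j x - H j x) < e]) ->
  cl10 Om u G.
Proof.
move=> Lu LG Hc; split => // e e0; have e4 : 0 < e / 4 by rewrite divr_gt0.
have [v [H [[Lv LH Hv] V1 V2]]] := Hc _ e4; have [p [tp P1 P2]] := Hv _ e4.
have Lp := ctest_cL2 oOm tp.
exists p; split => //.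
  rewrite (_ : (fun x => _) = fun x => (u x - v x) + (v x - p x)); last first.
    by apply/funext => x; ring.
  apply: le_lt_trans (nsqD_le mOm _ _) _; [exact: cL2B|exact: cL2B|].
  exact: lt_quarters V1 P1.
move=> j; have Ldp := ctest_dC_cL2 oOm j tp.
rewrite (_ : (fun x => _) = fun x => (G j x - H j x) + (H j x - dC j p x)); last first.
  by apply/funext => x; ring.
apply: le_lt_trans (nsqD_le mOm _ _) _; [exact: cL2B|exact: cL2B|].
exact: lt_quarters (V2 j) (P2 j).
Qed.

Definition cauchy_nsq (f : nat -> R3 R -> R[i]) := forall e : R, 0 < e ->
  exists N, forall m n, (N <= m)%N -> (N <= n)%N -> nsq Om (fun x => f m x - f n x) < e.

Lemma cL2_complete (f : nat -> R3 R -> R[i]) : (forall n, cL2 Om (f n)) ->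
  cauchy_nsq f -> exists2 l, cL2 Om l & forall e : R, 0 < e ->
    exists N, forall n, (N <= n)%N -> nsq Om (fun x => l x - f n x) < e.
Proof.
move=> Lf cf.
have nsqE h : nsq Om h = Int Om (fun x => re h x ^+ 2) + Int Om (fun x => im h x ^+ 2).
  by rewrite /nsq ripE.
have I0 a : 0 <= Int Om (fun x => a x ^+ 2) by apply: Int_ge0 => x _; exact: sqr_ge0.
have sub (h h' : R3 R -> R[i]) : re (fun x => h x - h' x) = (fun x => re h x - re h' x) /\
     im (fun x => h x - h' x) = (fun x => im h x - im h' x).
  by split; apply/funext => x; rewrite /re /im !Reic.
have [||r Lr Hr] := @rL2_complete _ _ mOm (fun n => re (f n)).
- by move=> n; exact: (Lf n).1.
- move=> e e0; have [N HN] := cf e e0; exists N => m n Nm Nn.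
  have := HN m n Nm Nn; rewrite nsqE (sub _ _).1; apply: le_lt_trans.
  by rewrite lerDl.
have [||s Ls Hs] := @rL2_complete _ _ mOm (fun n => im (f n)).
- by move=> n; exact: (Lf n).2.
- move=> e e0; have [N HN] := cf e e0; exists N => m n Nm Nn.
  have := HN m n Nm Nn; rewrite nsqE (sub _ _).2; apply: le_lt_trans.
  by rewrite lerDr.
exists (fun x => r x +i* s x); first by split.
move=> e e0; have e2 : 0 < e / 2 by rewrite divr_gt0.
have [N1 H1] := Hr _ e2; have [N2 H2] := Hs _ e2.
exists (maxn N1 N2) => n; rewrite geq_max => /andP[n1 n2].
rewrite nsqE (sub _ _).1 (sub _ _).2 [e]splitr; apply: ltrD.
- exact: H1.
- exact: H2.
Qed.

Lemma cL2_bounded_mul (C : R) (m : R3 R -> R) f :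
  measurable_fun (Om : set (mR3 R)) (m : mR3 R -> R) -> (forall x, `|m x| <= C) ->
  cL2 Om f -> cL2 Om (fun x => (m x)%:C * f x) /\
    nsq Om (fun x => (m x)%:C * f x) <= C ^+ 2 * nsq Om f.
Proof.
move=> mm mC [Lr Li].
have rE : re (fun x => (m x)%:C * f x) = fun x => m x * re f x.
  by apply/funext => x; rewrite /re Reic /= mul0r subr0.
have iE : im (fun x => (m x)%:C * f x) = fun x => m x * im f x.
  by apply/funext => x; rewrite /im Reic /= mul0r addr0.
have L a : rL2 Om a -> rL2 Om (fun x => m x * a x).
  by apply: rL2_bounded_mul => // x _; exact: mC.
split; first by split; rewrite ?rE ?iE; exact: L.
rewrite /nsq !ripE rE iE mulrDr.
suff le a : rL2 Om a -> rp Om (fun x => m x * a x) (fun x => m x * a x) <= C ^+ 2 * rp Om a a.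
  by apply: lerD; exact: le.
move=> La; rewrite /rp -IntZ//; last exact: La.2.
apply: le_Int => //.
- exact: (L a La).2.
- by apply: integZ => //; exact: La.2.
move=> x _; rewrite mulrACA -!expr2 ler_wpM2r ?sqr_ge0// -norm_le_sqr//.
exact: le_trans (mC x).
Qed.

Lemma ctestM (m : R3 R -> R) psi : smooth m -> ctest Om psi ->
  ctest Om (fun x => (m x)%:C * psi x) /\
  forall j, dC j (fun x => (m x)%:C * psi x) =
    fun x => (m x)%:C * dC j psi x + (partial j m x)%:C * psi x.
Proof.
move=> sm [tr ti].
have rE : re (fun x => (m x)%:C * psi x) = fun x => m x * re psi x.
  by apply/funext => x; rewrite /re Reic /= mul0r subr0.
have iE : im (fun x => (m x)%:C * psi x) = fun x => m x * im psi x.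
  by apply/funext => x; rewrite /im Reic /= mul0r addr0.
split; first by split; rewrite ?rE ?iE; exact: test_functionMl.
have [sr si] : csmooth psi by exact: ctest_smooth (conj tr ti).
move=> j; apply/funext => x; rewrite /dC rE iE !partialM; try exact: smooth_derivable.
apply: complexP; rewrite !Reic /= !mul0r ?subr0 ?addr0 /re /im.
  by rewrite (mulrC (partial j m x)).
by rewrite (mulrC (partial j m x)).
Qed.

(** Leibniz rule: the space of zero trace is a module over the bounded smooth
    functions with bounded gradient. *)
Lemma cl10_mul (C : R) (m : R3 R -> R) u G : smooth m -> (forall x, `|m x| <= C) ->
  (forall j x, `|partial j m x| <= C) -> cl10 Om u G ->
  cl10 Om (fun x => (m x)%:C * u x) (fun j x => (m x)%:C * G j x + (partial j m x)%:C * u x).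
Proof.
move=> sm mC dmC [Lu LG Hu].
have mm : measurable_fun (Om : set (mR3 R)) (m : mR3 R -> R).
  by apply: continuous_measurable_R3 => //; exact: smooth_continuous.
have mdm j : measurable_fun (Om : set (mR3 R)) (partial j m : mR3 R -> R).
  by apply: continuous_measurable_R3 => //; apply: smooth_continuous; exact: smooth_partial.
have M f := @cL2_bounded_mul C m f mm mC.
have dM j f := @cL2_bounded_mul C (partial j m) f (mdm j) (dmC j).
split; first by have [] := M _ Lu.
  by move=> j; apply: (cL2D mOm); [have [] := M _ (LG j)|have [] := dM j _ Lu].
move=> e e0; pose d := e / (4 * (C ^+ 2 + 1)).
have C1 : 0 < C ^+ 2 + 1 by rewrite ltr_wpDl ?sqr_ge0.
have d0 : 0 < d by rewrite divr_gt0// mulr_gt0.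
have dE : 4 * ((C ^+ 2 + 1) * d) = e by rewrite /d; field; rewrite gt_eqF.
have small x : 0 <= x -> x < d -> C ^+ 2 * x < e / 4.
  move=> x0 xd; apply: (@le_lt_trans _ _ ((C ^+ 2 + 1) * x)).
    by rewrite ler_wpM2r// lerDl.
  have : (C ^+ 2 + 1) * x < (C ^+ 2 + 1) * d by rewrite ltr_pM2l.
  by move: dE; lra.
have [p [tp P1 P2]] := Hu d d0; have [tmp dmp] := ctestM sm tp.
have Lp := ctest_cL2 oOm tp.
have Lup : cL2 Om (fun x => u x - p x) by exact: cL2B.
exists (fun x => (m x)%:C * p x); split => //.
  rewrite (_ : (fun x => _) = fun x => (m x)%:C * (u x - p x)); last first.
    by apply/funext => x; rewrite mulrBr.
  have [_ le] := M _ Lup; apply: (le_lt_trans le).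
  apply: lt_trans (small _ (nsq_ge0 _ _) P1) _.
  by rewrite ltr_pdivrMr// ltr_pMr// ltr1n.
move=> j; rewrite dmp; have Ldp := ctest_dC_cL2 oOm j tp.
have LGp : cL2 Om (fun x => G j x - dC j p x) by exact: cL2B.
rewrite (_ : (fun x => _) = fun x => (m x)%:C * (G j x - dC j p x) +
   (partial j m x)%:C * (u x - p x)); last first.
  by apply/funext => x; ring.
have [L1 le1] := M _ LGp; have [L2 le2] := dM j _ Lup.
apply: le_lt_trans (nsqD_le mOm L1 L2) _.
have S1 := small _ (nsq_ge0 _ _) P1; have S2 := small _ (nsq_ge0 _ _) (P2 j).
exact: lt_quarters (le_lt_trans le1 S2) (le_lt_trans le2 S1).
Qed.

End sobolev_closure.

(** * Vector fields componentwise *)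

Section bridge.
Context {R : realType}.
Variables (Om : set (R3 R)) (oOm : open Om).
Let mOm : measurable (Om : set (mR3 R)) := open_measurable_R3 oOm.

Definition entry n (i : 'I_n) (f : field R n) : R3 R -> R[i] := fun x => f x i 0.

Definition vect n (u : 'I_n -> R3 R -> R[i]) : field R n := fun x => \col_i u i x.

Lemma entry_vect n (u : 'I_n -> R3 R -> R[i]) i : entry i (vect u) = u i.
Proof. by apply/funext => x; rewrite /entry /vect mxE. Qed.

Section fixed_n.
Variable n : nat.
Implicit Types (f g : field R n).

Lemma entry_inj f g : (forall i, entry i f = entry i g) -> f = g.
Proof.
move=> H; apply/funext => x; apply/matrixP => i k; rewrite (ord1 k).
by have := congr1 (fun h : R3 R -> R[i] => h x) (H i).
Qed.

Lemma L2P f : L2 Om f <-> forall i, cL2 Om (entry i f).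
Proof.
split=> [[mf If] i|Lf].
  have [mr mi] := mf i.
  have msq : measurable_fun (Om : set (mR3 R)) (fun x : mR3 R => sqnorm (f x)).
    rewrite /sqnorm.
    have -> : (fun x : mR3 R => \sum_k (complex.Re (f x k 0) ^+ 2 + complex.Im (f x k 0) ^+ 2)) =
      (fun x => \sum_(k <- index_enum 'I_n) (complex.Re (f x k 0) ^+ 2 + complex.Im (f x k 0) ^+ 2)) by [].
    apply: measurable_sum => k; apply: measurable_funD; apply: measurable_funX.
      by have [] := mf k.
    by have [] := mf k.
  have sq0 x : 0 <= sqnorm (f x).
    by apply: sumr_ge0 => k _; rewrite addr_ge0 ?sqr_ge0.
  have isq : integ Om (fun x => sqnorm (f x)).
    apply/integrableP; split; first exact/measurable_EFinP.
    apply: le_lt_trans If; rewrite le_eqVlt; apply/orP; left; apply/eqP.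
    by apply: eq_integral => x _ /=; rewrite ger0_norm.
  have le (x : R3 R) : complex.Re (f x i 0) ^+ 2 + complex.Im (f x i 0) ^+ 2 <= sqnorm (f x).
    rewrite /sqnorm (bigD1 i)//= lerDl; apply: sumr_ge0 => k _.
    by rewrite addr_ge0 ?sqr_ge0.
  split; (split; first by []); apply: (le_integ mOm _ _ isq).
  - exact: measurable_funX.
  - move=> x _; rewrite ger0_norm ?sqr_ge0//; apply: le_trans (le x).
    by rewrite lerDl sqr_ge0.
  - exact: measurable_funX.
  - move=> x _; rewrite ger0_norm ?sqr_ge0//; apply: le_trans (le x).
    by rewrite lerDr sqr_ge0.
split=> [i|].
  by have [[? _] [? _]] := Lf i.
have isq : integ Om (fun x => sqnorm (f x)).
  apply: integ_sum => // i; apply: integD => //.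
  - by have [[_ ?] _] := Lf i.
  - by have [_ [_ ?]] := Lf i.
apply: le_lt_trans (integrableP _ _ _ isq).2.
apply: ge0_le_integral => //.
- move=> x _; rewrite lee_fin; apply: sumr_ge0 => k _; rewrite addr_ge0 ?sqr_ge0//.
- exact: measurable_int isq.
- by apply: measurableT_comp => //; exact: measurable_int isq.
- by move=> x _; exact: lee_abs.
Qed.

Lemma L2norm_sqr f : L2 Om f -> L2norm Om f ^+ 2 = \sum_i nsq Om (entry i f).
Proof.
move=> /L2P Lf; rewrite /L2norm sqr_sqrtr; last first.
  apply: Rintegral_ge0 => x _; apply: sumr_ge0 => k _; rewrite addr_ge0 ?sqr_ge0//.
rewrite -[LHS]/(Int Om (fun x => \sum_i (complex.Re (f x i 0) ^+ 2 + complex.Im (f x i 0) ^+ 2))).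
have ir i : integ Om (fun x => complex.Re (f x i 0) ^+ 2) by have [[_ ?] _] := Lf i.
have ii i : integ Om (fun x => complex.Im (f x i 0) ^+ 2) by have [_ [_ ?]] := Lf i.
rewrite Int_sum//; last by move=> i; exact: integD.
by apply: eq_bigr => i _; rewrite /nsq ripE IntD.
Qed.

Lemma L2innerE f g : L2 Om f -> L2 Om g ->
  L2inner Om f g = \sum_i ip Om (entry i f) (entry i g).
Proof.
move=> /L2P Lf /L2P Lg; apply: complexP.
  rewrite Re_sum /L2inner /cintegral /=.
  transitivity (Int Om (fun x => \sum_i (re (entry i f) x * re (entry i g) x +
     im (entry i f) x * im (entry i g) x))).
    congr (Int Om _); apply/funext => x; rewrite Re_sum; apply: eq_bigr => i _.
    by rewrite !Reic mulrN opprK.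
  rewrite Int_sum//; last first.
    by move=> i; apply: integD => //; apply: rL2_integM => //; [exact: (Lf i).1|exact: (Lg i).1|exact: (Lf i).2|exact: (Lg i).2].
  apply: eq_bigr => i _ /=; congr Int; apply/funext => x.
  by rewrite !Reic mulrN opprK.
rewrite Im_sum /L2inner /cintegral /=.
transitivity (Int Om (fun x => \sum_i (- (re (entry i f) x * im (entry i g) x) +
   im (entry i f) x * re (entry i g) x))).
  congr (Int Om _); apply/funext => x; rewrite Im_sum; apply: eq_bigr => i _.
  by rewrite !Reic mulrN.
rewrite Int_sum//; last first.
  move=> i; apply: integD => //; first apply: integN => //; apply: rL2_integM => //;
  by [exact: (Lf i).1|exact: (Lg i).1|exact: (Lf i).2|exact: (Lg i).2].
apply: eq_bigr => i _ /=; congr Int; apply/funext => x.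
by rewrite !Reic mulrN.
Qed.

Lemma eq_aeP f g : eq_ae Om f g <-> forall i, ceq0 Om (fun x => entry i f x - entry i g x).
Proof.
split=> [fg i|H].
  have fg' : {ae lebesgue3, forall x : mR3 R, Om x -> f x = g x} by exact: fg.
  by apply: filterS fg' => x Hx Ox; rewrite /entry Hx// subrr.
have H' : {ae lebesgue3, forall x : mR3 R, forall i, Om x -> entry i f x - entry i g x = 0}.
  by apply: filter_forall => i; exact: H.
suff: {ae lebesgue3, forall x : mR3 R, Om x -> f x = g x} by [].
apply: filterS H' => x Hx Ox; apply/matrixP => i k; rewrite (ord1 k).
by apply/eqP; rewrite -subr_eq0; apply/eqP; exact: Hx.
Qed.

Lemma cintegral_real (u : R3 R -> R[i]) phi : cintegral Om (fun x => u x * (phi x)%:C) =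
  Int Om (fun x => re u x * phi x) +i* Int Om (fun x => im u x * phi x).
Proof.
rewrite /cintegral; congr (_ +i* _); congr (Int Om _); apply/funext => x.
  by rewrite !Reic /= mulr0 subr0.
by rewrite !Reic /= mulr0 add0r.
Qed.

Lemma weak_partialP j f g : weak_partial Om j f g <-> forall i, cwd Om j (entry i f) (entry i g).
Proof.
split=> [H i|H phi t i].
  split=> phi t; have := H phi t i.
    rewrite (cintegral_real (entry i f)) (cintegral_real (entry i g)).
    by move/(congr1 (@complex.Re _)) => /=.
  rewrite (cintegral_real (entry i f)) (cintegral_real (entry i g)).
  by move/(congr1 (@complex.Im _)) => /=.
rewrite (cintegral_real (entry i f)) (cintegral_real (entry i g)).
by have [h1 h2] := H i; rewrite (h1 _ t) (h2 _ t).
Qed.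

End fixed_n.
End bridge.

Section zero_trace_fields.
Context {R : realType}.
Variables (Om : set (R3 R)) (oOm : open Om).
Let mOm : measurable (Om : set (mR3 R)) := open_measurable_R3 oOm.
Variable n : nat.
Implicit Types (f g phi : field R n) (G : 'I_3 -> field R n).

Lemma ler_sum_term (I : finType) (F : I -> R) i : (forall i, 0 <= F i) ->
  F i <= \sum_i F i.
Proof. by move=> F0; rewrite (bigD1 i)//= lerDl; apply: sumr_ge0. Qed.

Lemma wdB j (a b a' b' : R3 R -> R) : rL2 Om a -> rL2 Om b -> rL2 Om a' -> rL2 Om b' ->
  wd Om j a b -> wd Om j a' b' -> wd Om j (fun x => a x - a' x) (fun x => b x - b' x).
Proof.
move=> La Lb La' Lb' w w' phi t.
have Lt := test_function_rL2 mOm t.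
have Ldt := test_function_rL2 mOm (test_function_partial j t).
have E (c c' psi : R3 R -> R) : rL2 Om c -> rL2 Om c' -> rL2 Om psi ->
    Int Om (fun x => (c x - c' x) * psi x) =
    Int Om (fun x => c x * psi x) - Int Om (fun x => c' x * psi x).
  move=> Lc Lc' Lp; rewrite -IntB//; try exact: rL2_integM.
  by congr (Int Om _); apply/funext => x; rewrite mulrBl.
by rewrite !E// w// w'// opprD.
Qed.

Lemma cwdB j (u g v h : R3 R -> R[i]) : cL2 Om u -> cL2 Om g -> cL2 Om v -> cL2 Om h ->
  cwd Om j u g -> cwd Om j v h -> cwd Om j (fun x => u x - v x) (fun x => g x - h x).
Proof.
move=> [? ?] [? ?] [? ?] [? ?] [? ?] [? ?].
have sub (k k' : R3 R -> R[i]) : re (fun x => k x - k' x) = (fun x => re k x - re k' x) /\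
     im (fun x => k x - k' x) = (fun x => im k x - im k' x).
  by split; apply/funext => x; rewrite /re /im !Reic.
by split; rewrite ?(sub _ _).1 ?(sub _ _).2; apply: wdB.
Qed.

Lemma cwd_unique j (u g h : R3 R -> R[i]) : cL2 Om g -> cL2 Om h ->
  cwd Om j u g -> cwd Om j u h -> ceq0 Om (fun x => g x - h x).
Proof.
move=> [? ?] [? ?] [w1 w2] [w3 w4]; apply: aeq0_ceq0.
  have -> : re (fun x => g x - h x) = fun x => re g x - re h x.
    by apply/funext => x; rewrite /re !Reic.
  exact: wd_unique w1 w3.
have -> : im (fun x => g x - h x) = fun x => im g x - im h x.
  by apply/funext => x; rewrite /im !Reic.
exact: wd_unique w2 w4.
Qed.

Lemma weak_gradientP f G : weak_gradient Om f G <->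
  forall j i, cL2 Om (entry i (G j)) /\ cwd Om j (entry i f) (entry i (G j)).
Proof.
split=> [H j i|H j].
  by have [/(L2P oOm)/(_ i) L /weak_partialP/(_ i) w] := H j.
split; first by apply/(L2P oOm) => i; have [] := H j i.
by apply/weak_partialP => i; have [] := H j i.
Qed.

Lemma gradP f : weak_gradient Om f !=set0 -> weak_gradient Om f (grad Om f).
Proof. by move=> [G HG]; exact: (xgetI (fun=> 0) HG). Qed.

Lemma grad_unique f G j i : weak_gradient Om f G ->
  ceq0 Om (fun x => entry i (grad Om f j) x - entry i (G j) x).
Proof.
move=> HG; have /weak_gradientP/(_ j i)[L1 w1] : weak_gradient Om f (grad Om f).
  by apply: gradP; exists G.
have /weak_gradientP/(_ j i)[L2 w2] := HG.
exact: cwd_unique w1 w2.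
Qed.

Definition dfield phi : 'I_3 -> field R n := fun j => vect (fun i => dC j (entry i phi)).

Lemma entry_dfield phi j i : entry i (dfield phi j) = dC j (entry i phi).
Proof. exact: entry_vect. Qed.

Lemma entry_sub f g i : entry i (f - g) = fun x => entry i f x - entry i g x.
Proof. by apply/funext => x; rewrite /entry !mxE. Qed.

Lemma csmooth_cwd j (psi : R3 R -> R[i]) : csmooth psi -> cwd Om j psi (dC j psi).
Proof. by move=> [? ?]; split; exact: smooth_wd. Qed.

(** The gradient of a difference with a test function is known explicitly, which
    is what allows the graph norm in [H10] to be computed componentwise. *)
Lemma weak_gradient_sub f G phi : L2 Om f -> weak_gradient Om f G -> C0_infty Om phi ->
  weak_gradient Om (f - phi) (fun j => G j - dfield phi j).
Proof.
move=> /(L2P oOm) Lf /weak_gradientP HG tphi; apply/weak_gradientP => j i.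
have ti : ctest Om (entry i phi) by exact: tphi.
have [LG wG] := HG j i; have Ldp := ctest_dC_cL2 oOm j ti; have Lp := ctest_cL2 oOm ti.
rewrite !entry_sub entry_dfield; split; first exact: cL2B.
by apply: cwdB => //; apply: csmooth_cwd; exact: ctest_smooth ti.
Qed.

Lemma H1norm_sqr f : H1 Om f ->
  H1norm Om f ^+ 2 = \sum_i nsq Om (entry i f) + \sum_j \sum_i nsq Om (entry i (grad Om f j)).
Proof.
move=> [Lf /gradP Hg]; rewrite /H1norm sqr_sqrtr; last first.
  by rewrite addr_ge0 ?sqr_ge0//; apply: sumr_ge0 => j _; exact: sqr_ge0.
rewrite L2norm_sqr//; congr (_ + _); apply: eq_bigr => j _.
by rewrite L2norm_sqr//; have [] := Hg j.
Qed.

Lemma H1_sub f phi : H1 Om f -> C0_infty Om phi -> H1 Om (f - phi).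
Proof.
move=> [Lf Hg] tphi; split.
  apply/(L2P oOm) => i; rewrite entry_sub; apply: cL2B => //.
    by move/(L2P oOm) : Lf.
  by apply: ctest_cL2 => //; exact: tphi.
by eexists; apply: weak_gradient_sub (gradP Hg) tphi.
Qed.

Lemma H1norm_sub_sqr f G phi : L2 Om f -> weak_gradient Om f G -> C0_infty Om phi ->
  H1norm Om (f - phi) ^+ 2 = \sum_i nsq Om (fun x => entry i f x - entry i phi x) +
    \sum_j \sum_i nsq Om (fun x => entry i (G j) x - dC j (entry i phi) x).
Proof.
move=> Lf HG tphi; have H1f : H1 Om f by split => //; exists G.
rewrite H1norm_sqr; last exact: H1_sub.
congr (_ + _); first by apply: eq_bigr => i _; rewrite entry_sub.
apply: eq_bigr => j _; apply: eq_bigr => i _.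
have Hsub := weak_gradient_sub Lf HG tphi.
have /weak_gradientP/(_ j i)[L1 _] := gradP (ex_intro _ _ Hsub).
have /weak_gradientP/(_ j i)[L2' _] := Hsub.
have := grad_unique j i Hsub; rewrite entry_sub entry_dfield in L2' * => /(nsq_ae oOm) -> //.
Qed.

(** The gradient chosen in the definition of the norm may be replaced by any
    representative, by uniqueness of weak derivatives. *)
Lemma H10_cl10 f : H10 Om f ->
  forall i, cl10 Om (entry i f) (fun j => entry i (grad Om f j)).
Proof.
move=> [[Lf Hg] He] i; have Gf := gradP Hg.
have LG j : cL2 Om (entry i (grad Om f j)) by have /weak_gradientP/(_ j i)[] := Gf.
split => //; first by move/(L2P oOm) : Lf.
move=> e e0; have [|phi tphi] := He (Num.sqrt e); first by rewrite sqrtr_gt0.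
move=> lt0; have lt_e : H1norm Om (f - phi) ^+ 2 < e.
  by rewrite -[ltRHS](sqr_sqrtr (ltW e0)) ltr_pXn2r ?nnegrE ?sqrtr_ge0.
rewrite (H1norm_sub_sqr Lf Gf tphi) in lt_e.
exists (entry i phi); split; first exact: tphi.
- apply: le_lt_trans lt_e.
  pose F i := nsq Om (fun x => entry i f x - entry i phi x).
  have F0 k : 0 <= F k by exact: nsq_ge0.
  apply: (le_trans (y := \sum_i F i)); first exact: (@ler_sum_term _ F).
  by rewrite lerDl; apply: sumr_ge0 => j _; apply: sumr_ge0 => k _; exact: nsq_ge0.
- move=> j; apply: le_lt_trans lt_e.
  pose F j i := nsq Om (fun x => entry i (grad Om f j) x - dC j (entry i phi) x).
  have F0 k l : 0 <= F k l by exact: nsq_ge0.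
  apply: (le_trans (y := \sum_i F j i)); first exact: (@ler_sum_term _ (F j)).
  apply: (le_trans (y := \sum_j \sum_i F j i)).
    by apply: (@ler_sum_term _ (fun j => \sum_i F j i)) => k; apply: sumr_ge0.
  by rewrite lerDr; apply: sumr_ge0 => k _; exact: nsq_ge0.
Qed.

Lemma cl10_H10 f G : (forall i, cl10 Om (entry i f) (fun j => entry i (G j))) -> H10 Om f.
Proof.
move=> cf; have Lf : L2 Om f by apply/(L2P oOm) => i; have [] := cf i.
have HG : weak_gradient Om f G.
  apply/weak_gradientP => j i; split; first by have [_ ? _] := cf i.
  by apply: (cl10_cwd oOm j (cf i)).
split; first by split => //; exists G.
move=> e e0; pose d := e ^+ 2 / (n%:R + 3 * n%:R + 1).
have N0 : 0 <= n%:R :> R by [].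
have d0 : 0 < d by rewrite divr_gt0 ?exprn_gt0//; lra.
have /choice[psi Hpsi] : forall i, exists p, [/\ ctest Om p, nsq Om (fun x => entry i f x - p x) < d &
    forall j, nsq Om (fun x => entry i (G j) x - dC j p x) < d].
  by move=> i; have [_ _] := cf i; apply.
have tphi : C0_infty Om (vect psi).
  by move=> i; have [? _ _] := Hpsi i; rewrite -/(ctest Om (entry i (vect psi))) entry_vect.
exists (vect psi) => //.
rewrite -(@ltr_pXn2r _ 2) ?nnegrE ?sqrtr_ge0 ?(ltW e0)//.
rewrite (H1norm_sub_sqr Lf HG tphi).
apply: (@le_lt_trans _ _ (\sum_(i < n) d + \sum_(j < 3) \sum_(i < n) d)).
  apply: lerD; first by apply: ler_sum => i _; rewrite entry_vect; have [_ /ltW ? _] := Hpsi i.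
  apply: ler_sum => j _; apply: ler_sum => i _; rewrite entry_vect.
  by have [_ _ /(_ j)/ltW ?] := Hpsi i.
rewrite !sumr_const !card_ord -!mulrnA -[d *+ n]mulr_natl -[d *+ _]mulr_natl natrM.
rewrite -mulrDl /d mulrA ltr_pdivrMr; last by lra.
rewrite mulrC ltr_pM2l ?exprn_gt0//; lra.
Qed.

End zero_trace_fields.

(** * The Dirichlet Laplacian *)

Section dirichlet.
Context {R : realType}.
Variables (Om : set (R3 R)) (oOm : open Om).
Let mOm : measurable (Om : set (mR3 R)) := open_measurable_R3 oOm.
Implicit Types (u v g h : R3 R -> R[i]) (G H : 'I_3 -> R3 R -> R[i]).

Definition grip G H : R := \sum_j rip Om (G j) (H j).

Definition gsq G : R := grip G G.

(** [- Delta u = h] in the weak sense, with [G] the gradient of [u].  Real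
    parts suffice, because [v] may be replaced by [i v]. *)
Definition weak_poisson u G h := [/\ cl10 Om u G, cL2 Om h &
  forall v H, cl10 Om v H -> grip G H = rip Om h v].

Lemma rip_aer f g g' : cL2 Om f -> cL2 Om g -> cL2 Om g' ->
  ceq0 Om (fun x => g x - g' x) -> rip Om f g = rip Om f g'.
Proof.
move=> Lf Lg Lg' gg'; apply/eqP; rewrite -subr_eq0 -ripBr// ripC.
by rewrite rip_ceq0//; exact: cL2B.
Qed.

Lemma rip_ael f f' g : cL2 Om f -> cL2 Om f' -> cL2 Om g ->
  ceq0 Om (fun x => f x - f' x) -> rip Om f g = rip Om f' g.
Proof. by move=> Lf Lf' Lg ff'; rewrite ripC (rip_aer Lg Lf Lf' ff') ripC. Qed.

Lemma Re_ip f g : cL2 Om f -> cL2 Om g -> complex.Re (ip Om f g) = rip Om f g.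
Proof. by move=> Lf Lg; rewrite (ipE mOm Lf Lg). Qed.

Lemma H10_L2 n (f : field R n) : H10 Om f -> L2 Om f.
Proof. by case=> -[]. Qed.

Lemma H10_grad_L2 n (f : field R n) j : H10 Om f -> L2 Om (grad Om f j).
Proof. by move=> [[_ /gradP Hg] _]; have [] := Hg j. Qed.

(** This and the converse [weak_poisson_dirichlet] translate the operator of the
    form, with its chosen gradients, into weak equations for given gradients. *)
Lemma dirichlet_laplacianP (f h : field R 1) : dirichlet_laplacian Om (f, h) ->
  exists G, weak_poisson (entry ord0 f) G (entry ord0 h).
Proof.
move=> [/= Hf Lh E]; exists (fun j => entry ord0 (grad Om f j)).
have /(L2P oOm)/(_ ord0) Lh0 := Lh.
split => //; first exact: H10_cl10.
move=> v H cv; have [Lv LH _] := cv.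
pose g : field R 1 := vect (fun=> v).
have gE : entry ord0 g = v by rewrite entry_vect.
have cg : forall i, cl10 Om (entry i g) (fun j => entry i (vect (fun _ : 'I_1 => H j) : field R 1)).
  by move=> i; rewrite entry_vect; under eq_fun do rewrite entry_vect.
have Hg : H10 Om g by exact: (cl10_H10 oOm cg).
have Lg := H10_L2 Hg.
have gradg j : ceq0 Om (fun x => entry ord0 (grad Om g j) x - H j x).
  have HG : weak_gradient Om g (fun j => vect (fun _ : 'I_1 => H j)).
    apply/(weak_gradientP oOm) => k i; rewrite !entry_vect; split => //.
    exact: (cl10_cwd oOm _ cv).
  have := grad_unique oOm j ord0 HG; by rewrite entry_vect.
have := congr1 (@complex.Re _) (E g Hg).
rewrite /dirichlet_form Re_sum (L2innerE oOm)// big_ord1 Re_ip//; last first.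
  by move/(L2P oOm) : Lg.
rewrite gE => <-; rewrite /grip; apply: eq_bigr => j _.
have Lgf := H10_grad_L2 j Hf; have Lgg := H10_grad_L2 j Hg.
rewrite (L2innerE oOm)// big_ord1.
move/(L2P oOm) : Lgf => /(_ ord0) Lgf; move/(L2P oOm) : Lgg => /(_ ord0) Lgg.
by rewrite Re_ip//; apply/esym; apply: rip_aer.
Qed.

Lemma weak_poisson_dirichlet u G h : weak_poisson u G h ->
  dirichlet_laplacian Om (vect (fun _ : 'I_1 => u), vect (fun _ : 'I_1 => h)).
Proof.
move=> [cu Lh E]; have [Lu LG _] := cu.
set f : field R 1 := vect _; set k : field R 1 := vect _.
have cf : forall i, cl10 Om (entry i f) (fun j => entry i (vect (fun _ : 'I_1 => G j) : field R 1)).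
  by move=> i; rewrite entry_vect; under eq_fun do rewrite entry_vect.
have Hf : H10 Om f by exact: (cl10_H10 oOm cf).
have Lk : L2 Om k by apply/(L2P oOm) => i; rewrite entry_vect.
have gradf j : ceq0 Om (fun x => entry ord0 (grad Om f j) x - G j x).
  have HG : weak_gradient Om f (fun j => vect (fun _ : 'I_1 => G j)).
    apply/(weak_gradientP oOm) => l i; rewrite !entry_vect; split => //.
    exact: (cl10_cwd oOm _ cu).
  have := grad_unique oOm j ord0 HG; by rewrite entry_vect.
split => //= g Hg.
have cg := H10_cl10 oOm Hg ord0; have [Lg LGg _] := cg.
have Lgf j : cL2 Om (entry ord0 (grad Om f j)).
  by have /(L2P oOm) := H10_grad_L2 j Hf.
have rE (c : R[i]) : \sum_j rip Om (entry ord0 (grad Om f j)) (fun x => c * entry ord0 (grad Om g j) x) =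
    rip Om h (fun x => c * entry ord0 g x).
  rewrite -(E _ _ (cl10Z oOm c cg)); apply: eq_bigr => j _.
  by apply: rip_ael => //; exact: cL2Z.
have E1 : \sum_j rip Om (entry ord0 (grad Om f j)) (entry ord0 (grad Om g j)) = rip Om h (entry ord0 g).
  by rewrite -(E _ _ cg); apply: eq_bigr => j _; apply: rip_ael.
rewrite (L2innerE oOm)//; last exact: H10_L2.
rewrite big_ord1 entry_vect (ipE mOm)// /dirichlet_form.
have dE j : L2inner Om (grad Om f j) (grad Om g j) =
   rip Om (entry ord0 (grad Om f j)) (entry ord0 (grad Om g j)) +i*
   rip Om (entry ord0 (grad Om f j)) (fun x => 'i%C * entry ord0 (grad Om g j) x).
  rewrite (L2innerE oOm) ?big_ord1 ?(ipE mOm)//; exact: H10_grad_L2.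
apply: complexP => /=.
  by rewrite Re_sum -E1; apply: eq_bigr => j _; rewrite dE.
by rewrite Im_sum -rE; apply: eq_bigr => j _; rewrite dE.
Qed.

Variables (mu : nat -> R).
Hypothesis discr : purely_discrete Om (dirichlet_laplacian Om).
Hypothesis muP : enumerates_eigenvalues Om (dirichlet_laplacian Om) mu.

Lemma mu_gt0 k : 0 < mu k.
Proof. by have [mu0 muS _] := muP; apply: (lt_le_trans mu0); exact: muS. Qed.

Lemma eigenvalue_enumerated z : eigenvalue_of Om (dirichlet_laplacian Om) z ->
  exists k, z = (mu k)%:C.
Proof.
move=> [f kf nf]; have [_ _ /(_ z)[k [v [kv lv sv]] ck]] := muP.
apply: contrapT => nz.
have A0 : [set j | (mu j)%:C = z] = set0.
  by apply/seteqP; split => // j /= jz; apply: nz; exists j.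
have k0 : k = 0%N.
  move: ck; rewrite A0 => ck; case: k ck {v kv lv sv} => // k.
  rewrite card_eq_sym card_eq0 => /eqP E.
  by have : `I_k.+1 0%N by []; rewrite E.
subst k; have [c fE] := sv f kf; apply: nf.
by move: fE; rewrite big_ord0.
Qed.

Lemma mu_eigenfunction k : exists u G,
  weak_poisson u G (fun x => (mu k)%:C * u x) /\ ~ ceq0 Om u.
Proof.
have [_ _ /(_ (mu k)%:C)[K [v [kv lv sv]] ck]] := muP.
case: K v kv lv sv ck => [|K] v kv lv sv ck.
  exfalso; move: ck; rewrite II0 card_eq0 => /eqP E.
  have : [set j | (mu j)%:C = (mu k)%:C] k by [].
  by rewrite E.
have [G HG] := dirichlet_laplacianP (kv ord0).
exists (entry ord0 (v ord0)), G; split.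
  by move: HG; congr weak_poisson; apply/funext => x; rewrite /entry !mxE.
move=> v0.
have := lv (fun i => if i == ord0 then 1 else 0) _ ord0; rewrite eqxx.
have H : eq_ae Om (\sum_i (if i == ord0 then 1 else 0 : R[i]) *: v i) 0.
  rewrite (bigD1 ord0)//= big1 ?addr0 ?scale1r; last first.
    by move=> i /negbTE ->; rewrite scale0r.
  apply/(eq_aeP) => i; rewrite (ord1 i).
  by apply: filterS v0 => x Hx Ox; rewrite Hx// /entry !mxE subrr.
by move=> /(_ H)/eqP; rewrite oner_eq0.
Qed.

Lemma resolvent_dirichlet z : (forall k, z <> (mu k)%:C) ->
  resolvent_set Om (dirichlet_laplacian Om) z.
Proof.
move=> nz; apply: contrapT => sz.
have [_ /eigenvalue_enumerated[k zk] _] := discr sz.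
exact: (nz k).
Qed.

(** For a purely discrete spectrum every point that is not an enumerated eigenvalue
    lies in the resolvent set. *)
Lemma weak_poisson_solvable z g : (forall k, z <> (mu k)%:C) -> cL2 Om g ->
  exists u G, weak_poisson u G (fun x => g x + z * u x).
Proof.
move=> /resolvent_dirichlet[_ sol _] Lg.
have [|f Hf] := sol (vect (fun _ : 'I_1 => g)).
  by apply/(L2P oOm) => i; rewrite entry_vect.
have [G HG] := dirichlet_laplacianP Hf.
exists (entry ord0 f), G; move: HG; congr weak_poisson.
by apply/funext => x; rewrite /entry /vect !mxE.
Qed.

Lemma weak_poisson_bound z : (forall k, z <> (mu k)%:C) -> exists2 C : R, 0 <= C &
  forall u G g, cL2 Om g -> weak_poisson u G (fun x => g x + z * u x) ->
    nsq Om u <= C * nsq Om g.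
Proof.
move=> /resolvent_dirichlet[_ _ [C HC]]; exists (C ^+ 2); first exact: sqr_ge0.
move=> u G g Lg W; have [[Lu _ _] _ _] := W.
have := weak_poisson_dirichlet W.
have -> : vect (fun _ : 'I_1 => fun x => g x + z * u x) =
   vect (fun _ : 'I_1 => g) + z *: vect (fun _ : 'I_1 => u).
  by apply/funext => x; apply/matrixP => i k; rewrite /vect !mxE.
have Lg1 : L2 Om (vect (fun _ : 'I_1 => g)) by apply/(L2P oOm) => i; rewrite entry_vect.
have Lu1 : L2 Om (vect (fun _ : 'I_1 => u)) by apply/(L2P oOm) => i; rewrite entry_vect.
move=> /(HC _ _ Lg1) H.
have := L2norm_sqr oOm Lg1; have := L2norm_sqr oOm Lu1.
rewrite !big_ord1 !entry_vect => <- <-; rewrite -exprMn.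
by rewrite ler_pXn2r// nnegrE ?sqrtr_ge0//; apply: le_trans H; exact: sqrtr_ge0.
Qed.

End dirichlet.

Section gradient_projection.
Context {R : realType}.
Variables (Om : set (R3 R)) (oOm : open Om).
Let mOm : measurable (Om : set (mR3 R)) := open_measurable_R3 oOm.
Implicit Types (u v g h : R3 R -> R[i]) (F G H : 'I_3 -> R3 R -> R[i]).

Definition gL2 G := forall j, cL2 Om (G j).

Lemma gripC F G : grip Om F G = grip Om G F.
Proof. by apply: eq_bigr => j _; rewrite ripC. Qed.

Lemma gripDl F G H : gL2 F -> gL2 G -> gL2 H ->
  grip Om (fun j x => F j x + G j x) H = grip Om F H + grip Om G H.
Proof. by move=> LF LG LH; rewrite -big_split; apply: eq_bigr => j _; exact: ripDl. Qed.

Lemma gripBl F G H : gL2 F -> gL2 G -> gL2 H ->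
  grip Om (fun j x => F j x - G j x) H = grip Om F H - grip Om G H.
Proof. by move=> LF LG LH; rewrite -sumrB; apply: eq_bigr => j _; exact: ripBl. Qed.

Lemma gripZl (t : R) F H : gL2 F -> gL2 H ->
  grip Om (fun j x => t%:C * F j x) H = t * grip Om F H.
Proof. by move=> LF LH; rewrite mulr_sumr; apply: eq_bigr => j _; exact: ripZl. Qed.

Lemma gripNr F H : gL2 F -> gL2 H -> grip Om F (fun j x => - H j x) = - grip Om F H.
Proof. by move=> LF LH; rewrite -sumrN; apply: eq_bigr => j _; exact: ripNr. Qed.

Lemma gsq_ge0 G : 0 <= gsq Om G.
Proof. by apply: sumr_ge0 => j _; exact: nsq_ge0. Qed.

Lemma nsq_le_gsq G j : nsq Om (G j) <= gsq Om G.
Proof. by apply: (@ler_sum_term _ _ (fun j => nsq Om (G j))) => k; exact: nsq_ge0. Qed.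

Lemma grip_young (s : R) F G : 0 < s -> gL2 F -> gL2 G ->
  2 * grip Om F G <= s * gsq Om F + s^-1 * gsq Om G.
Proof.
move=> s0 LF LG; rewrite /gsq /grip !mulr_sumr -big_split /=.
by apply: ler_sum => j _; exact: rip_young.
Qed.

Lemma gL2B F G : gL2 F -> gL2 G -> gL2 (fun j x => F j x - G j x).
Proof. by move=> LF LG j; exact: cL2B. Qed.

Lemma gL2D F G : gL2 F -> gL2 G -> gL2 (fun j x => F j x + G j x).
Proof. by move=> LF LG j; exact: cL2D. Qed.

Lemma gL2Z (c : R[i]) F : gL2 F -> gL2 (fun j x => c * F j x).
Proof. by move=> LF j; exact: cL2Z. Qed.

Lemma gsqB_eq F G : gL2 F -> gL2 G ->
  gsq Om (fun j x => F j x - G j x) = gsq Om F - 2 * grip Om F G + gsq Om G.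
Proof.
move=> LF LG; rewrite /gsq /grip mulr_sumr -sumrB -big_split /=.
by apply: eq_bigr => j _; exact: nsqB_eq.
Qed.

Lemma gsqZ (t : R) F : gL2 F -> gsq Om (fun j x => t%:C * F j x) = t ^+ 2 * gsq Om F.
Proof.
move=> LF; rewrite /gsq gripZl//; last exact: gL2Z.
by rewrite gripC gripZl// mulrA expr2.
Qed.

Lemma gsqD_eq F G : gL2 F -> gL2 G ->
  gsq Om (fun j x => F j x + G j x) = gsq Om F + 2 * grip Om F G + gsq Om G.
Proof.
move=> LF LG; rewrite /gsq /grip mulr_sumr -!big_split /=.
by apply: eq_bigr => j _; exact: nsqD_eq.
Qed.

Lemma parallelogram_midpoint (d p q : R) F G : gL2 F -> gL2 G ->
  d <= gsq Om (fun j x => (2^-1)%:C * (F j x + G j x)) ->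
  gsq Om F < d + p -> gsq Om G < d + q ->
  gsq Om (fun j x => G j x - F j x) <= 2 * p + 2 * q.
Proof.
move=> LF LG; rewrite gsqZ; last exact: gL2D.
rewrite gsqD_eq// gsqB_eq// (gripC G); move: (gsq Om F) (gsq Om G) (grip Om F G) => A B C.
by rewrite exprVn; lra.
Qed.

Lemma gsq_line (t : R) F G : gL2 F -> gL2 G ->
  gsq Om (fun j x => F j x - t%:C * G j x) = gsq Om F - 2 * (t * grip Om F G) + t ^+ 2 * gsq Om G.
Proof.
move=> LF LG; rewrite gsqB_eq//; last exact: gL2Z.
by rewrite gripC gripZl// gsqZ// (gripC G).
Qed.

(** Poincare's inequality: the solution [w] of [- Delta w = u] satisfies
    [|u|^2 = <grad w, grad u>] and [|grad w|^2 = <u, w>]. *)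
Lemma poincare (C : R) : 0 <= C ->
  (forall g, cL2 Om g -> exists u G, weak_poisson Om u G g) ->
  (forall u G g, weak_poisson Om u G g -> nsq Om u <= C * nsq Om g) ->
  forall u G, cl10 Om u G -> nsq Om u <= (1 + C) * gsq Om G.
Proof.
move=> C0 sol bnd u G cu; have [Lu LG _] := cu.
have [w [W Hw]] := sol u Lu; have [cw _ E] := Hw; have [Lw LW _] := cw.
have e1 : grip Om W G = nsq Om u by exact: E.
have e2 : gsq Om W = rip Om u w by exact: E.
have b := bnd _ _ _ Hw.
have y1 := rip_young mOm (s := 1) ltr01 Lu Lw; rewrite invr1 !mul1r -e2 in y1.
have C1 : 0 < 1 + C by lra.
have y2 := @grip_young (1 + C)^-1 W G _ LW LG.
rewrite invr_gt0 invrK e1 in y2; have {}y2 := y2 C1.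
have : (1 + C)^-1 * gsq Om W <= nsq Om u.
  rewrite ler_pdivrMl//; move: y1 b (nsq_ge0 Om u) (gsq_ge0 W).
  move: (gsq Om W) (nsq Om u) (nsq Om w) => A B D; nra.
move: y2; move: (_ * gsq Om W) (_ * gsq Om G) (nsq Om u) => A B D; lra.
Qed.

Variable K : R.
Hypothesis poinc : forall u G, cl10 Om u G -> nsq Om u <= K * gsq Om G.

(** By Poincare's inequality, functions of zero trace with a Cauchy sequence of
    gradients are themselves Cauchy, so the gradients form a closed subspace. *)
Lemma cl10_complete (v : nat -> R3 R -> R[i]) (H : nat -> 'I_3 -> R3 R -> R[i]) :
  (forall n, cl10 Om (v n) (H n)) ->
  (forall e : R, 0 < e -> exists N, forall m n, (N <= m)%N -> (N <= n)%N ->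
     gsq Om (fun j x => H m j x - H n j x) < e) ->
  exists u G, cl10 Om u G /\ forall e : R, 0 < e -> forall j,
     exists N, forall n, (N <= n)%N -> nsq Om (fun x => G j x - H n j x) < e.
Proof.
move=> cv ch.
have K1 : 0 < `|K| + 1 by rewrite ltr_pwDr.
have [||u Lu Hu] := @cL2_complete _ _ oOm v.
- by move=> n; have [] := cv n.
- move=> e e0; have [N HN] := ch (e / (`|K| + 1)) (divr_gt0 e0 K1).
  exists N => m n Nm Nn; apply: le_lt_trans (poinc (cl10B oOm (cv m) (cv n))) _.
  have := HN m n Nm Nn; rewrite ltr_pdivlMr// => /le_lt_trans; apply.
  rewrite mulrC ler_wpM2l ?gsq_ge0//; apply: le_trans (ler_norm _) _.
  by rewrite lerDl.
have /choice[G HG] : forall j, exists l, cL2 Om l /\ forall e : R, 0 < e ->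
    exists N, forall n, (N <= n)%N -> nsq Om (fun x => l x - H n j x) < e.
  move=> j; have [||l Ll Hl] := @cL2_complete _ _ oOm (fun n => H n j).
  - by move=> n; have [_ + _] := cv n; apply.
  - move=> e e0; have [N HN] := ch e e0; exists N => m n Nm Nn.
    apply: le_lt_trans (HN m n Nm Nn).
    exact: (nsq_le_gsq (fun j x => H m j x - H n j x)).
  by exists l; split.
exists u, G; split; last by move=> e e0 j; have [_ ] := HG j; apply.
apply: (cl10_closed oOm) => //; first by move=> j; have [] := HG j.
move=> e e0; have [N0 HN0] := Hu e e0.
have /choice[N HN] : forall j, exists N, forall n, (N <= n)%N -> nsq Om (fun x => G j x - H n j x) < e.
  by move=> j; have [_ ] := HG j; apply.
pose n := maxn N0 (\max_j N j).
exists (v n), (H n); split => //; first by apply: HN0; exact: leq_maxl.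
move=> j; apply: HN; apply: leq_trans (leq_maxr _ _); exact: leq_bigmax.
Qed.

Lemma grip_small (e : R) F G : 0 < e -> gL2 F -> gL2 G ->
  (forall j, nsq Om (F j) < e ^+ 2) -> grip Om F G <= e * (3 + gsq Om G).
Proof.
move=> e0 LF LG Fe; apply: (@le_trans _ _ (\sum_j e * (1 + nsq Om (G j)))).
  by apply: ler_sum => j _; exact: rip_small.
by rewrite -mulr_sumr big_split /= sumr_const card_ord -mulr_natr mul1r.
Qed.

(** The parallelogram law makes every minimizing sequence for the distance of [F]
    to the gradients of zero trace a Cauchy sequence; at the minimum, the first
    variation gives orthogonality. *)
Lemma gradient_projection F : gL2 F ->
  exists u G, cl10 Om u G /\ forall v H, cl10 Om v H -> grip Om G H = grip Om F H.
Proof.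
move=> LF.
pose E := [set r | exists v H, cl10 Om v H /\ r = gsq Om (fun j x => F j x - H j x)].
have E0 : has_inf E.
  split; last by exists 0 => _ [v [H [_ ->]]]; exact: gsq_ge0.
  by eexists; exists (fun=> 0), (fun _ _ => 0); split; [exact: cl10_0|].
pose d := inf E.
have dle v H : cl10 Om v H -> d <= gsq Om (fun j x => F j x - H j x).
  by move=> cv; apply: ge_inf; [exact: E0.2|exists v, H].
have ex n : exists vH : (R3 R -> R[i]) * ('I_3 -> R3 R -> R[i]), cl10 Om vH.1 vH.2 /\
    gsq Om (fun j x => F j x - vH.2 j x) < d + n.+1%:R^-1.
  have [|r [v [H [cv ->]]] lt] := @inf_adherent _ E n.+1%:R^-1 _ E0; first by rewrite invr_gt0.
  by exists (v, H).
have [vH HvH] := choice ex.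
pose v n := (vH n).1; pose H n := (vH n).2.
have cv n : cl10 Om (v n) (H n) by have [] := HvH n.
have LH n : gL2 (H n) by have [_ ? _] := cv n.
have lt n : gsq Om (fun j x => F j x - H n j x) < d + n.+1%:R^-1 by have [] := HvH n.
have par m n : gsq Om (fun j x => H m j x - H n j x) <= 2 * m.+1%:R^-1 + 2 * n.+1%:R^-1.
  have := dle _ _ (cl10Z oOm (2^-1)%:C (cl10D oOm (cv m) (cv n))).
  have -> : (fun j x => F j x - (2^-1)%:C * (H m j x + H n j x)) =
    (fun j x => (2^-1)%:C * ((F j x - H m j x) + (F j x - H n j x))).
    apply/funext => j; apply/funext => x.
    have h2 : (2^-1)%:C + (2^-1)%:C = 1 :> R[i].
      by apply: complexP; rewrite !Reic /=; lra.
    by rewrite -[X in X - _ = _]mul1r -h2; ring.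
  have La := gL2B LF (LH m); have Lb := gL2B LF (LH n).
  have -> : (fun j x => H m j x - H n j x) =
     (fun j x => (F j x - H n j x) - (F j x - H m j x)).
    by apply/funext => j; apply/funext => x; ring.
  move=> hd; exact: (parallelogram_midpoint La Lb hd (lt m) (lt n)).
have small (e : R) : 0 < e -> exists N, forall n, (N <= n)%N -> n.+1%:R^-1 < e.
  move=> e0; exists (Num.bound e^-1) => n Nn.
  rewrite invf_plt ?posrE//; apply: lt_trans (archi_boundP _) _; first by rewrite invr_ge0 ltW.
  by rewrite ltr_nat.
have [|u [G [cu HG]]] := cl10_complete cv.
  move=> e e0; have [|N HN] := small (e / 4); first by rewrite divr_gt0.
  exists N => m n /HN h1 /HN h2; apply: (le_lt_trans (par m n)).
  exact: lt_quarters.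
exists u, G; split => // w W cw; have [_ LG _] := cu; have [_ LW _] := cw.
suff le (w' : R3 R -> R[i]) W' : cl10 Om w' W' -> grip Om (fun j x => F j x - G j x) W' <= 0.
  apply/eqP; rewrite eq_sym -subr_eq0 -gripBl// eq_le (le _ _ cw)/=.
  by have := le _ _ (cl10N oOm cw); rewrite gripNr ?oppr_le0//; exact: gL2B.
move=> cw'; have [_ LW' _] := cw'.
apply: (@le0_eps _ _ (1 + gsq Om W' + (3 + gsq Om W'))) => e e0.
have e2 : 0 < e ^+ 2 by rewrite exprn_gt0.
have [N0 HN0] := small _ e2.
have /choice[N HN] := HG _ e2.
pose n := maxn N0 (\max_j N j).
have n1 : n.+1%:R^-1 < e ^+ 2 by apply: HN0; exact: leq_maxl.
have n2 j : nsq Om (fun x => H n j x - G j x) < e ^+ 2.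
  have -> : nsq Om (fun x => H n j x - G j x) = nsq Om (fun x => G j x - H n j x).
    rewrite -(nsqN mOm (cL2B mOm (LG j) (LH n j))).
    by congr nsq; apply/funext => x; rewrite opprB.
  by apply: HN; apply: leq_trans (leq_maxr _ _); exact: leq_bigmax.
have -> : grip Om (fun j x => F j x - G j x) W' =
   grip Om (fun j x => F j x - H n j x) W' + grip Om (fun j x => H n j x - G j x) W'.
  by rewrite !gripBl//; ring.
rewrite mulrDr; apply: lerD; last by apply: grip_small => //; exact: gL2B.
have := dle _ _ (cl10D oOm (cv n) (cl10Z oOm e%:C cw')).
have -> : (fun j x => F j x - (H n j x + e%:C * W' j x)) =
    (fun j x => (F j x - H n j x) - e%:C * W' j x).
  by apply/funext => j; apply/funext => x; ring.
have La := gL2B LF (LH n).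
rewrite gsq_line//.
have := lt n; move: n1 (gsq_ge0 W').
move: (n.+1%:R^-1) (gsq Om W') (grip Om (fun j x => F j x - H n j x) W') => p A B.
move: (gsq Om (fun j x => F j x - H n j x)) => D.
move=> h1 h2 h3 h4.
have : e * (2 * B) <= e * (e * (1 + A)) by nra.
rewrite ler_pM2l// => h5.
have : 0 <= e * (1 + A) by rewrite mulr_ge0 ?(ltW e0)//; lra.
by lra.
Qed.

End gradient_projection.

(** * The Dirac operator in weak form *)

Section weyl_operator.
Context {R : realType}.
Variables (Om : set (R3 R)) (oOm : open Om).
Let mOm : measurable (Om : set (mR3 R)) := open_measurable_R3 oOm.
Implicit Types (u : R3 R -> R[i]) (G H : 'I_3 -> R3 R -> R[i]).
Implicit Types (f g v w : 'I_2 -> R3 R -> R[i]) (F V : 'I_2 -> 'I_3 -> R3 R -> R[i]).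

Definition has_grad u G := [/\ cL2 Om u, gL2 Om G & forall j, cwd Om j u (G j)].

Lemma cl10_has_grad u G : cl10 Om u G -> has_grad u G.
Proof. by move=> cu; have [? ? _] := cu; split => // j; exact: cl10_cwd. Qed.

Lemma has_grad_ibp_ctest j u G (psi : R3 R -> R[i]) : has_grad u G -> ctest Om psi ->
  rip Om u (dC j psi) = - rip Om (G j) psi.
Proof. by move=> [_ _ /(_ j)[w1 w2]] [t1 t2]; rewrite !ripE opprD -w1// -w2. Qed.

(** Integration by parts when only one of the two functions vanishes on the
    boundary. *)
Lemma has_grad_ibp j u G (v : R3 R -> R[i]) H : has_grad u G -> cl10 Om v H ->
  rip Om u (H j) = - rip Om (G j) v.
Proof.
move=> hu cv; have [Lu LG _] := hu; have [Lv LH _] := cv.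
have L k : cL2 Om (if k == j then u else fun=> 0) by case: eqP => // _; exact: cL2_0.
suff: rip Om v (G j) + \sum_k rip Om (H k) (if k == j then u else fun=> 0) = 0.
  rewrite (sum_delta (j := j)); last first.
    by move=> k /negbTE ->; rewrite ripC rip0l.
  by rewrite eqxx ripC [X in _ + X]ripC => /eqP; rewrite addrC addr_eq0 => /eqP.
apply: (cl10_density oOm (LG j) L _ cv).
move=> psi t; rewrite (sum_delta (j := j)); last first.
  by move=> k /negbTE ->; rewrite ripC rip0l.
rewrite eqxx ripC [X in _ + X]ripC (has_grad_ibp_ctest j hu t); ring.
Qed.

Lemma dC_dC j k (psi : R3 R -> R[i]) : ctest Om psi -> dC j (dC k psi) = dC k (dC j psi).
Proof.
move=> [[s1 _ _] [s2 _ _]]; rewrite /dC /re /im /=.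
by rewrite (partialC j k s1) (partialC j k s2).
Qed.

(** Both sides are minus the pairing of [u] with the mixed second derivative
    of [v] when [v] is a test function. *)
Lemma rip_gradC j k u G (v : R3 R -> R[i]) H : has_grad u G -> cl10 Om v H ->
  rip Om (G j) (H k) = rip Om (G k) (H j).
Proof.
move=> hu cv; have [Lu LG _] := hu; have [Lv LH _] := cv.
have [->//|jk] := eqVneq j k.
pose W l := if l == k then G j else if l == j then fun x => - G k x else fun=> 0.
have LW l : cL2 Om (W l).
  by rewrite /W; case: eqP => // _; case: eqP => _; [exact: cL2N|exact: cL2_0].
have sumW (X : 'I_3 -> R3 R -> R[i]) : gL2 Om X ->
    \sum_l rip Om (X l) (W l) = rip Om (X k) (G j) - rip Om (X j) (G k).
  move=> LX; rewrite (bigD1 k)//= (bigD1 j)//= big1 ?addr0; last first.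
    by move=> l /andP[/negbTE lk /negbTE lj]; rewrite /W lk lj ripC rip0l.
  by rewrite /W eqxx (negbTE jk) eqxx ripNr.
have := @cl10_density _ _ oOm (fun=> 0) W v H (cL2_0 Om) LW _ cv.
rewrite ripC rip0l// add0r sumW// => E; apply/eqP; rewrite -subr_eq0; apply/eqP.
rewrite ripC [X in _ - X]ripC; apply: E => psi t.
rewrite ripC rip0l// add0r sumW; last by move=> l; exact: ctest_dC_cL2.
rewrite ripC [X in _ - X]ripC.
have := has_grad_ibp_ctest j hu (ctest_dC k t); rewrite (dC_dC j k t).
rewrite (has_grad_ibp_ctest k hu (ctest_dC j t)) => /oppr_inj ->; exact: subrr.
Qed.

Definition sL2 f := forall a, cL2 Om (f a).

Definition sip f g : R := \sum_a rip Om (f a) (g a).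

Definition ssq f : R := sip f f.

(** [sigma . nabla], from the gradients of the components *)
Definition sg F : 'I_2 -> R3 R -> R[i] :=
  fun a x => \sum_j \sum_b pauli j a b * F b j x.

(** the formal adjoint of [sg], see [sip_adj] *)
Definition sw w : 'I_2 -> 'I_3 -> R3 R -> R[i] :=
  fun b j x => \sum_a pauli j b a * w a x.

Definition scl10 v V := forall b, cl10 Om (v b) (V b).

(** [sigma . nabla f = g], tested against spinors of zero trace instead of test
    functions; [sigma_nablaP] shows that this is the distributional equation. *)
Definition weakS f g := forall v V, scl10 v V -> sip f (sg V) = - sip g v.

Lemma pauli_conj j a b : Num.conj (pauli j a b : R[i]) = pauli j b a.
Proof.
by rewrite /pauli /mx2; case: j => -[|[|[|//]]] ? /=; rewrite !mxE;
   case: a => -[|[|//]] ?; case: b => -[|[|//]] ? /=; apply: complexP => /=; rewrite ?oppr0 ?opprK.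
Qed.

Lemma pauli_anticomm j k b c :
  \sum_a (pauli j c a * pauli k a b + pauli k c a * pauli j a b) =
  2 * ((j == k) && (b == c))%:R :> R[i].
Proof.
rewrite !big_ord_recl big_ord0 addr0 /pauli /mx2.
case: j => -[|[|[|//]]] ?; case: k => -[|[|[|//]]] ? /=; rewrite !mxE;
  case: c => -[|[|//]] ?; case: b => -[|[|//]] ? /=;
  apply: complexP => /=; ring.
Qed.

Lemma sg_L2 F : (forall b, gL2 Om (F b)) -> sL2 (sg F).
Proof.
by move=> LF a; apply: (cL2_sum mOm) => j; apply: (cL2_sum mOm) => b; apply: cL2Z => //; exact: LF.
Qed.

Lemma sw_L2 w : sL2 w -> forall b, gL2 Om (sw w b).
Proof. by move=> Lw b j; apply: (cL2_sum mOm) => a; apply: cL2Z => //; exact: Lw. Qed.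

Lemma rip_sumr (I : Type) (s : seq I) (U : I -> R3 R -> R[i]) u :
  (forall i, cL2 Om (U i)) -> cL2 Om u ->
  rip Om u (fun x => \sum_(i <- s) U i x) = \sum_(i <- s) rip Om u (U i).
Proof. by move=> LU Lu; rewrite ripC rip_suml//; apply: eq_bigr => i _; rewrite ripC. Qed.

Lemma sip_adj w F : sL2 w -> (forall b, gL2 Om (F b)) ->
  sip w (sg F) = \sum_b grip Om (sw w b) (F b).
Proof.
move=> Lw LF; have L c a j : cL2 Om (fun x => c * F a j x) by exact: (cL2Z mOm c (LF a j)).
rewrite /sip /grip.
transitivity (\sum_a \sum_j \sum_b rip Om (fun x => pauli j b a * w a x) (F b j)).
  apply: eq_bigr => a _; rewrite rip_sumr//; last by move=> j; exact: cL2_sum.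
  apply: eq_bigr => j _; rewrite rip_sumr//.
  by apply: eq_bigr => b _; rewrite (rip_mulJ mOm _ (Lw a) (LF b j)) pauli_conj.
rewrite exchange_big [RHS]exchange_big; apply: eq_bigr => j _.
rewrite exchange_big; apply: eq_bigr => b _ /=.
rewrite rip_suml//; last exact: LF.
by move=> a; exact: (cL2Z mOm _ (Lw a)).
Qed.

(** Spinors with square-integrable gradient satisfy the equation because the Pauli
    matrices are Hermitian. *)
Lemma weakS_sg f F : (forall b, has_grad (f b) (F b)) -> weakS f (sg F).
Proof.
move=> hf v V cv.
have Lf : sL2 f by move=> a; have [] := hf a.
have LF b : gL2 Om (F b) by have [] := hf b.
have LcF c b j : cL2 Om (fun x => c * F b j x) by exact: (cL2Z mOm c (LF b j)).
have Lv : sL2 v by move=> a; have [] := cv a.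
have LV b : gL2 Om (V b) by have [] := cv b.
rewrite sip_adj// /grip.
transitivity (- \sum_b \sum_j \sum_a rip Om (fun x => pauli j b a * F a j x) (v b)).
  rewrite -sumrN; apply: eq_bigr => b _; rewrite -sumrN; apply: eq_bigr => j _.
  rewrite -sumrN (rip_suml mOm); [|by move=> a; exact: (cL2Z mOm _ (Lf a))|exact: LV].
  apply: eq_bigr => a _; rewrite (rip_mulJ mOm _ (LF a j) (Lv b)).
  rewrite -(has_grad_ibp j (hf a) (cl10Z oOm (Num.conj (pauli j b a)) (cv b))).
  by rewrite (rip_mulJ mOm _ (Lf a) (LV b j)).
congr (- _); apply: eq_bigr => b _.
rewrite rip_suml//; last by move=> j; exact: cL2_sum.
by apply: eq_bigr => j _; rewrite rip_suml.
Qed.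

(** The square of [sigma . nabla] is the Laplacian: by [rip_gradC] the product
    [sigma_j sigma_k] may be symmetrized. *)
Lemma sip_sg f F v V : (forall b, has_grad (f b) (F b)) -> scl10 v V ->
  sip (sg F) (sg V) = \sum_b grip Om (F b) (V b).
Proof.
move=> hf cv.
have LF b : gL2 Om (F b) by have [] := hf b.
have LV b : gL2 Om (V b) by have [] := cv b.
have LcF c b j : cL2 Om (fun x => c * F b j x) by exact: (cL2Z mOm c (LF b j)).
pose q j k b c : R[i] := \sum_a pauli j c a * pauli k a b.
pose X j k b c := rip Om (fun x => q j k b c * F b k x) (V c j).
have E : sip (sg F) (sg V) = \sum_c \sum_b \sum_j \sum_k X j k b c.
  rewrite (sip_adj (sg_L2 LF) LV) /grip; apply: eq_bigr => c _.
  rewrite exchange_big; apply: eq_bigr => j _ /=; rewrite exchange_big /=.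
  transitivity (rip Om (fun x => \sum_k \sum_b q j k b c * F b k x) (V c j)); last first.
    rewrite (rip_suml mOm); [|by move=> k; exact: cL2_sum|exact: LV].
    by apply: eq_bigr => k _; rewrite (rip_suml mOm); [|by move=> b; exact: LcF|exact: LV].
  congr rip; apply/funext => x; rewrite /sw /sg.
  under eq_bigr do rewrite mulr_sumr.
  rewrite exchange_big; apply: eq_bigr => k _ /=.
  under eq_bigr do rewrite mulr_sumr.
  rewrite exchange_big; apply: eq_bigr => b _ /=.
  by rewrite mulr_suml; apply: eq_bigr => a _; rewrite mulrA.
have sym j k b c : X j k b c + X k j b c = 2 * ((j == k) && (b == c))%:R * rip Om (F b k) (V c j).
  have -> : X k j b c = rip Om (fun x => q k j b c * F b k x) (V c j).
    rewrite /X (rip_mulJ mOm _ (LF b j) (LV c k)) (rip_mulJ mOm _ (LF b k) (LV c j)).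
    exact: (rip_gradC j k (hf b) (cl10Z oOm (Num.conj (q k j b c)) (cv c))).
  rewrite -(ripDl mOm); [|exact: LcF|exact: LcF|exact: LV].
  have -> : (fun x => q j k b c * F b k x + q k j b c * F b k x) =
      (fun x => (2 * ((j == k) && (b == c))%:R)%:C * F b k x).
    apply/funext => x; rewrite -mulrDl -big_split /= pauli_anticomm; congr (_ * _).
    by rewrite !rmorphM /= !rmorph_nat.
  exact: (ripZl mOm _ (LF b k) (LV c j)).
apply: (@mulfI _ 2) => //; rewrite mulr_natl mulr2n {1}E.
have -> : sip (sg F) (sg V) = \sum_c \sum_b \sum_j \sum_k X k j b c.
  by rewrite E; apply: eq_bigr => c _; apply: eq_bigr => b _; rewrite exchange_big.
rewrite -big_split mulr_sumr; apply: eq_bigr => c _ /=.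
transitivity (\sum_b \sum_j \sum_k 2 * ((j == k) && (b == c))%:R * rip Om (F b k) (V c j)).
  rewrite -big_split; apply: eq_bigr => b _; rewrite -big_split; apply: eq_bigr => j _.
  by rewrite -big_split; apply: eq_bigr => k _; exact: sym.
rewrite (bigD1 c)//= [X in _ + X]big1 ?addr0; last first.
  by move=> b /negbTE bc; do 2 (apply: big1 => ? _); rewrite bc andbF mulr0 mul0r.
rewrite mulr_sumr; apply: eq_bigr => j _; rewrite (bigD1 j)//= big1 ?addr0; last first.
  by move=> k; rewrite eq_sym => /negbTE ->; rewrite mulr0 mul0r.
by rewrite !eqxx mulr1.
Qed.

Lemma ceq0_ctest u : cL2 Om u -> (forall psi, ctest Om psi -> rip Om u psi = 0) -> ceq0 Om u.
Proof.
move=> Lu H; apply: aeq0_ceq0; apply: (du_bois_reymond oOm); try by case: Lu.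
  move=> phi t; rewrite -/(rp Om (re u) phi) -(rip_real oOm); apply: H.
  by split => //; exact: test_function0.
move=> phi t; rewrite -/(rp Om (im u) phi) -(rip_imag oOm); apply: H.
by split => //; exact: test_function0.
Qed.

Definition single (a : 'I_2) u : 'I_2 -> R3 R -> R[i] :=
  fun b => if b == a then u else fun=> 0.

Definition gsingle (a : 'I_2) G : 'I_2 -> 'I_3 -> R3 R -> R[i] :=
  fun b => if b == a then G else fun _ _ => 0.

Lemma scl10_single a u G : cl10 Om u G ->
  scl10 (single a u) (gsingle a G).
Proof. by move=> cu b; rewrite /single /gsingle; case: eqP => // _; exact: cl10_0. Qed.

Lemma sip_single g a u : sip g (single a u) = rip Om (g a) u.
Proof.
rewrite /sip (bigD1 a)//= big1 ?addr0 /single ?eqxx// => b /negbTE ->.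
by rewrite ripC rip0l.
Qed.

Lemma sum_grip_single (X : 'I_2 -> 'I_3 -> R3 R -> R[i]) a G :
  \sum_b grip Om (X b) (gsingle a G b) = grip Om (X a) G.
Proof.
rewrite (bigD1 a)//= big1 ?addr0 /gsingle ?eqxx// => b /negbTE ->.
by rewrite /grip big1// => j _; rewrite ripC rip0l.
Qed.

(** Testing one component at a time reduces [weakS] to a divergence equation for each
    row of [sw f], to which the density of test functions applies. *)
Lemma weakSP f g : sL2 f -> sL2 g -> (weakS f g <->
  forall a psi, ctest Om psi -> grip Om (sw f a) (fun j => dC j psi) = - rip Om (g a) psi).
Proof.
move=> Lf Lg; split=> [H a psi t|H v V cv].
  have cs := scl10_single a (cl10_ctest oOm t).
  have := H _ _ cs; rewrite sip_single sip_adj ?sum_grip_single// => b.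
  by have [] := cs b.
rewrite sip_adj//; last by move=> b; have [] := cv b.
rewrite /sip -sumrN; apply: eq_bigr => a _.
have := @cl10_density _ _ oOm (g a) (sw f a) (v a) (V a) (Lg a) (sw_L2 Lf a) _ (cv a).
rewrite ripC /grip => E; apply/eqP; rewrite -addr_eq0 addrC; apply/eqP.
under eq_bigr do rewrite ripC; apply: E => psi t.
rewrite ripC; under eq_bigr do rewrite ripC.
by have := H a psi t; rewrite /grip => ->; exact: subrr.
Qed.

Lemma sigma_nablaP (f g : field R 2) : L2 Om f -> L2 Om g ->
  sigma_nabla Om f g <-> weakS (fun a => entry a f) (fun a => entry a g).
Proof.
move=> /(L2P oOm) Lf /(L2P oOm) Lg.
have E (phi : R3 R -> R) a j : cintegral Om (fun x => (pauli j *m f x) a 0 * (partial j phi x)%:C) =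
    rp Om (re (sw (fun a => entry a f) a j)) (partial j phi) +i*
    rp Om (im (sw (fun a => entry a f) a j)) (partial j phi).
  rewrite -(cintegral_real Om (sw (fun a => entry a f) a j)); congr cintegral.
  by apply/funext => x; congr (_ * _); rewrite mxE.
rewrite weakSP//; split=> [H a psi [t1 t2]|H phi t a].
  have h phi : test_function Om phi ->
      \sum_j rp Om (re (sw (fun a => entry a f) a j)) (partial j phi) = - rp Om (re (entry a g)) phi /\
      \sum_j rp Om (im (sw (fun a => entry a f) a j)) (partial j phi) = - rp Om (im (entry a g)) phi.
    move=> t; have := H phi t a; under eq_bigr do rewrite E.
    rewrite (cintegral_real Om (entry a g)) => h.
    split; [have := congr1 (@complex.Re _) h|have := congr1 (@complex.Im _) h].
      by rewrite Re_sum.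
    by rewrite Im_sum.
  rewrite ripE opprD -(h _ t1).1 -(h _ t2).2 -big_split; apply: eq_bigr => j _ /=.
  by rewrite ripE.
under eq_bigr do rewrite E.
rewrite (cintegral_real Om (entry a g)); apply: complexP.
  have := H a (fun x => (phi x)%:C); rewrite (rip_real oOm) /grip Re_sum /= => <-.
    apply: eq_bigr => j _; rewrite -(rip_real oOm); congr rip.
    by apply/funext => x; rewrite /dC /re /im /= partial_cst.
  by split => //; exact: test_function0.
have := H a (fun x => 0 +i* phi x); rewrite (rip_imag oOm) /grip Im_sum /= => <-.
  apply: eq_bigr => j _; rewrite -(rip_imag oOm); congr rip.
  by apply/funext => x; rewrite /dC /re /im /= partial_cst.
by split => //; exact: test_function0.
Qed.

Lemma weakS_unique f g g' : sL2 g -> sL2 g' -> weakS f g -> weakS f g' ->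
  forall a, ceq0 Om (fun x => g a x - g' a x).
Proof.
move=> Lg Lg' H H' a; apply: ceq0_ctest; first exact: (cL2B mOm (Lg a) (Lg' a)).
move=> psi t; have := scl10_single a (cl10_ctest oOm t) => cs.
rewrite (ripBl mOm (Lg a) (Lg' a)); last exact: ctest_cL2.
by have := H _ _ cs; rewrite (H' _ _ cs) !sip_single => /oppr_inj ->; exact: subrr.
Qed.

End weyl_operator.

(** * Solving the equation for the lower component *)

Section scalar_problem.
Context {R : realType}.
Variables (Om : set (R3 R)) (oOm : open Om).
Let mOm : measurable (Om : set (mR3 R)) := open_measurable_R3 oOm.
Variables (mu : nat -> R).
Hypothesis discr : purely_discrete Om (dirichlet_laplacian Om).
Hypothesis muP : enumerates_eigenvalues Om (dirichlet_laplacian Om) mu.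
Implicit Types (u v h : R3 R -> R[i]) (P U G H : 'I_3 -> R3 R -> R[i]).

Lemma poincare_dirichlet : exists2 K : R, 0 <= K &
  forall u G, cl10 Om u G -> nsq Om u <= K * gsq Om G.
Proof.
have n0 k : (0 : R[i]) <> (mu k)%:C.
  by move=> /(congr1 (@complex.Re _)) /= E; have := mu_gt0 muP k; rewrite -E ltxx.
have [C C0 bnd] := weak_poisson_bound oOm discr muP n0.
exists (1 + C); first by rewrite addr_ge0.
have e (u g : R3 R -> R[i]) : (fun x => g x + 0 * u x) = g.
  by apply/funext => x; rewrite mul0r addr0.
apply: (poincare oOm C0) => [g Lg|u G g W].
  have [u [G]] := weak_poisson_solvable oOm discr muP n0 Lg.
  by rewrite e => W; exists u, G.
have [_ Lg _] := W; apply: (bnd u G g Lg); by rewrite e.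
Qed.

(** [- Delta u = - div P + h + lam u] weakly, for a vector field [P] that need
    not be differentiable *)
Definition weak_helmholtz (lam : R[i]) u U P h := cl10 Om u U /\
  forall v H, cl10 Om v H -> grip Om U H = grip Om P H + rip Om (fun x => lam * u x + h x) v.

Variable lam : R[i].
Hypothesis lamP : forall k, lam <> (mu k)%:C.

(** The projection of [P] on the gradients accounts for the divergence term; the
    remainder solves a Poisson problem with square-integrable right-hand side. *)
Lemma weak_helmholtz_solvable P h : gL2 Om P -> cL2 Om h ->
  exists u U, weak_helmholtz lam u U P h.
Proof.
move=> LP Lh; have [K K0 HK] := poincare_dirichlet.
have [u0 [U0 [c0 E0]]] := gradient_projection oOm HK LP.
have [L0 LU0 _] := c0.
have Lr : cL2 Om (fun x => lam * u0 x + h x) by exact: (cL2D mOm (cL2Z mOm _ L0) Lh).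
have [u1 [U1 [c1 _ E1]]] := weak_poisson_solvable oOm discr muP lamP Lr.
have [_ LU1 _] := c1.
exists (fun x => u0 x + u1 x), (fun j x => U0 j x + U1 j x); split; first exact: cl10D.
move=> v H cv; have [_ LH _] := cv.
have -> : (fun x => lam * (u0 x + u1 x) + h x) = (fun x => lam * u0 x + h x + lam * u1 x).
  by apply/funext => x; rewrite mulrDr addrAC.
by rewrite (gripDl oOm LU0 LU1 LH) (E0 _ _ cv) (E1 _ _ cv).
Qed.

(** Estimates the two summands of the solution separately, then the gradient by
    testing the equation against [u] itself. *)
Lemma weak_helmholtz_bound : exists2 C : R, 0 <= C & forall u U P h,
  gL2 Om P -> cL2 Om h -> weak_helmholtz lam u U P h ->
  nsq Om u <= C * (gsq Om P + nsq Om h) /\ gsq Om U <= C * (gsq Om P + nsq Om h).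
Proof.
have [K K0 HK] := poincare_dirichlet.
have [C C0 HC] := weak_poisson_bound oOm discr muP lamP.
have L0 := csq_ge0 lam; set L := csq lam in L0.
pose A := 2 * (C * (2 * L * K + 2)) + 2 * K.
have LK : 0 <= L * K by rewrite mulr_ge0.
have CL : 0 <= C * (2 * L * K + 2) by rewrite mulr_ge0//; lra.
have A0 : 0 <= A by rewrite /A; lra.
have LA : 0 <= L * A by rewrite mulr_ge0.
exists (A + (1 + 2 + 2 * (L * A) + A)); first by lra.
move=> u U P h LP Lh [cu E]; have [Lu LU _] := cu.
have [u0 [U0 [c0 E0]]] := gradient_projection oOm HK LP.
have [Lu0 LU0 _] := c0.
have p0 := gsq_ge0 Om P; have h0 := nsq_ge0 Om h.
have b1 : gsq Om U0 <= gsq Om P.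
  have e : grip Om P U0 = gsq Om U0 by rewrite -(E0 _ _ c0).
  have := grip_young oOm ltr01 LP LU0; rewrite e invr1 !mul1r.
  by move: (gsq Om P) (gsq Om U0) => x y; lra.
have b2 : nsq Om u0 <= K * gsq Om P.
  by apply: le_trans (HK _ _ c0) _; exact: ler_wpM2l.
have Lr : cL2 Om (fun x => lam * u0 x + h x) by exact: (cL2D mOm (cL2Z mOm _ Lu0) Lh).
have W : weak_poisson Om (fun x => u x - u0 x) (fun j x => U j x - U0 j x)
    (fun x => (lam * u0 x + h x) + lam * (u x - u0 x)).
  split; first exact: cl10B.
    by apply: (cL2D mOm Lr); apply: (cL2Z mOm); exact: (cL2B mOm Lu Lu0).
  move=> v H cv; have [_ LH _] := cv.
  have -> : (fun x => lam * u0 x + h x + lam * (u x - u0 x)) = (fun x => lam * u x + h x).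
    by apply/funext => x; rewrite mulrBr addrC addrA addrNK.
  by rewrite (gripBl oOm LU LU0 LH) (E _ _ cv) (E0 _ _ cv) addrAC subrr add0r.
have b3 := HC _ _ _ Lr W.
have b4 := nsqD_le mOm (cL2Z mOm lam Lu0) Lh; rewrite nsqZ// -/L in b4.
have b5 : nsq Om u <= 2 * nsq Om (fun x => u x - u0 x) + 2 * nsq Om u0.
  have := nsqD_le mOm (cL2B mOm Lu Lu0) Lu0.
  by have -> : (fun x => u x - u0 x + u0 x) = u by apply/funext => x; rewrite subrK.
have b6 : nsq Om u <= A * (gsq Om P + nsq Om h).
  move: b2 b3 b4 b5 p0 h0; move: (nsq Om u) (nsq Om u0) (nsq Om (fun x => u x - u0 x)).
  move: (nsq Om (fun x => lam * u0 x + h x)) (gsq Om P) (nsq Om h) => r p q x x0 y.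
  move=> b2 b3 b4 b5 p0 h0.
  have c1 : L * x0 <= L * (K * p) by rewrite ler_wpM2l.
  have c2 : C * r <= C * ((2 * L * K + 2) * (p + q)).
    rewrite ler_wpM2l//; apply: le_trans b4 _.
    have : 0 <= L * K * q by rewrite mulr_ge0.
    by move: c1 p0; lra.
  have : 0 <= K * q by rewrite mulr_ge0.
  rewrite /A; move: c2 b2 b3 b5; rewrite mulrA.
  move: (C * (2 * L * K + 2)) => M; nra.
have b7 : gsq Om U <= gsq Om P + (2 * L * nsq Om u + 2 * nsq Om h) + nsq Om u.
  have e : gsq Om U = grip Om P U + rip Om (fun x => lam * u x + h x) u by exact: E.
  have Lr' : cL2 Om (fun x => lam * u x + h x) by exact: (cL2D mOm (cL2Z mOm _ Lu) Lh).
  have := grip_young oOm ltr01 LP LU; have := rip_young mOm ltr01 Lr' Lu.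
  have := nsqD_le mOm (cL2Z mOm lam Lu) Lh; rewrite nsqZ// -/L invr1 !mul1r.
  move: e; move: (gsq Om U) (gsq Om P) (grip Om P U) (rip Om _ u) (nsq Om (fun x => lam * u x + h x)).
  move: (nsq Om u) (nsq Om h) => a b c d e f g; lra.
move: b6 b7 p0 h0; move: (nsq Om u) (gsq Om U) (gsq Om P) (nsq Om h) => a b p q b6 b7 p0 h0.
have pq : 0 <= p + q by lra.
have c1 : 0 <= (1 + 2 + 2 * (L * A) + A) * (p + q) by rewrite mulr_ge0//; lra.
have c2 : 0 <= A * (p + q) by rewrite mulr_ge0.
have c3 : L * a <= L * A * (p + q) by rewrite -mulrA ler_wpM2l.
have c4 : 0 <= L * A * (p + q) by rewrite mulr_ge0.
by rewrite [_ * (p + q)]mulrDl; split; move: c1 c2 c3 c4 b6 b7; lra.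
Qed.

End scalar_problem.

(** * Reduction of the Dirac operator to its lower component *)

Section dirac_operator.
Context {R : realType}.
Variables (Om : set (R3 R)) (oOm : open Om).
Let mOm : measurable (Om : set (mR3 R)) := open_measurable_R3 oOm.
Variable m : R.
Implicit Types (p q s : 'I_2 -> R3 R -> R[i]) (F V : 'I_2 -> 'I_3 -> R3 R -> R[i]).
Implicit Types (f g k : field R (2 + 2)).

Definition upper f a : R3 R -> R[i] := entry (lshift 2 a) f.
Definition lower f a : R3 R -> R[i] := entry (rshift 2 a) f.
Definition bispinor p q : field R (2 + 2) := fun x => col_mx (vect p x) (vect q x).

Lemma upper_bispinor p q a : upper (bispinor p q) a = p a.
Proof. by apply/funext => x; rewrite /upper /bispinor /entry col_mxEu mxE. Qed.

Lemma lower_bispinor p q a : lower (bispinor p q) a = q a.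
Proof. by apply/funext => x; rewrite /lower /bispinor /entry col_mxEd mxE. Qed.

Lemma bispinor_inj f g : (forall a, upper f a = upper g a) ->
  (forall a, lower f a = lower g a) -> f = g.
Proof. by move=> u l; apply: entry_inj => i; case: (split_ordP i) => a ->; [exact: u|exact: l]. Qed.

Lemma L2_bispinor f : L2 Om f <-> sL2 Om (upper f) /\ sL2 Om (lower f).
Proof.
split=> [/(L2P oOm) Lf|[Lu Ll]]; first by split => a; exact: Lf.
by apply/(L2P oOm) => i; case: (split_ordP i) => a ->; [exact: Lu|exact: Ll].
Qed.

Lemma L2norm_bispinor f : L2 Om f ->
  L2norm Om f ^+ 2 = ssq Om (upper f) + ssq Om (lower f).
Proof. by move=> Lf; rewrite (L2norm_sqr oOm Lf) big_split_ord. Qed.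

Lemma eq_ae0_bispinor f : eq_ae Om f 0 <->
  (forall a, ceq0 Om (upper f a)) /\ (forall a, ceq0 Om (lower f a)).
Proof.
have E i : (fun x => entry i f x - entry i (0 : field R (2 + 2)) x) = entry i f.
  by apply/funext => x; rewrite /entry !mxE subr0.
split=> [/eq_aeP H|[Hu Hl]].
  by split=> a; [have := H (lshift 2 a)|have := H (rshift 2 a)]; rewrite E.
by apply/eq_aeP => i; rewrite E; case: (split_ordP i) => a ->; [exact: Hu|exact: Hl].
Qed.

Lemma sgZ (c : R[i]) F : sg (fun b j x => c * F b j x) = fun a x => c * sg F a x.
Proof.
apply/funext => a; apply/funext => x; rewrite /sg mulr_sumr; apply: eq_bigr => j _.
by rewrite mulr_sumr; apply: eq_bigr => b _; rewrite mulrCA.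
Qed.

Lemma weakSZ (c : R[i]) p s : sL2 Om p -> sL2 Om s -> weakS Om p s ->
  weakS Om (fun a x => c * p a x) (fun a x => c * s a x).
Proof.
move=> Lf Ls H v V cv.
have Lv : sL2 Om v by move=> a; have [] := cv a.
have LV : sL2 Om (sg V) by apply: (sg_L2 oOm) => b; have [] := cv b.
have := H _ _ (fun b => cl10Z oOm (Num.conj c) (cv b)); rewrite sgZ /sip => E.
transitivity (\sum_a rip Om (p a) (fun x => Num.conj c * sg V a x)).
  by apply: eq_bigr => a _; rewrite (rip_mulJ mOm _ (Lf a) (LV a)).
rewrite E; congr (- _); apply: eq_bigr => a _.
by rewrite (rip_mulJ mOm _ (Ls a) (Lv a)).
Qed.

Lemma sipBl p q s : sL2 Om p -> sL2 Om q -> sL2 Om s ->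
  sip Om (fun a x => p a x - q a x) s = sip Om p s - sip Om q s.
Proof.
move=> L1 L2 Ls; rewrite /sip -sumrB; apply: eq_bigr => a _.
exact: (ripBl mOm (L1 a) (L2 a) (Ls a)).
Qed.

Lemma sip_ael p q s : sL2 Om p -> sL2 Om q -> sL2 Om s ->
  (forall a, ceq0 Om (fun x => p a x - q a x)) -> sip Om p s = sip Om q s.
Proof. by move=> L1 L2 Ls E; apply: eq_bigr => a _; apply: (rip_ael oOm (L1 a) (L2 a) (Ls a)). Qed.

Lemma entry_usubmx f a : entry a (fun x => usubmx (f x)) = upper f a.
Proof. by apply/funext => x; rewrite /entry mxE. Qed.

Lemma entry_dsubmx f a : entry a (fun x => dsubmx (f x)) = lower f a.
Proof. by apply/funext => x; rewrite /entry mxE. Qed.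

Lemma dirac_bispinor p q s F : sL2 Om p -> sL2 Om s -> weakS Om p s -> scl10 Om q F ->
  dirac_zigzag Om m (bispinor p q,
    bispinor (fun a x => m%:C * p a x - 'i%C * sg F a x) (fun a x => - ('i%C * s a x) - m%:C * q a x)).
Proof.
move=> L1 Ls W c2.
have L2' : sL2 Om q by move=> a; have [] := c2 a.
have LF : sL2 Om (sg F) by apply: (sg_L2 oOm) => b; have [] := c2 b.
have E1 : (fun x => usubmx (bispinor p q x)) = vect p.
  by apply: entry_inj => a; rewrite entry_usubmx upper_bispinor entry_vect.
have E2 : (fun x => dsubmx (bispinor p q x)) = vect q.
  by apply: entry_inj => a; rewrite entry_dsubmx lower_bispinor entry_vect.
have cv (w : 'I_2 -> R3 R -> R[i]) : (fun a => entry a (vect w)) = w.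
  by apply/funext => a; rewrite entry_vect.
have L2v (w : 'I_2 -> R3 R -> R[i]) : sL2 Om w -> L2 Om (vect w).
  by move=> Lw; apply/(L2P oOm) => a; rewrite entry_vect.
rewrite /dirac_zigzag /= E1 E2.
exists (- 'i%C *: vect s), (- 'i%C *: vect (sg F)); split.
- split; first exact: L2v.
  exists (vect s); split => //; first exact: L2v.
  by apply/(sigma_nablaP oOm (L2v _ L1) (L2v _ Ls)); rewrite !cv.
- split.
    apply: (cl10_H10 oOm (G := fun j => vect (fun b => F b j))) => a /=.
    by rewrite entry_vect; under eq_fun do rewrite entry_vect; exact: c2.
  exists (vect (sg F)); split => //; first exact: L2v.
  apply/(sigma_nablaP oOm (L2v _ L2') (L2v _ LF)); rewrite !cv.
  by apply: (weakS_sg oOm) => b; apply: (cl10_has_grad oOm); exact: c2.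
- apply: bispinor_inj => a; apply/funext => x.
    by rewrite upper_bispinor /upper /entry /bispinor col_mxEu col_mxKu !mxE mulNr.
  by rewrite lower_bispinor /lower /entry /bispinor col_mxEd col_mxKd !mxE mulNr.
Qed.

(** Of the second component of [A f] only its almost everywhere class is determined,
    hence the representative [s2] next to [sg F]. *)
Lemma dirac_inv f k : dirac_zigzag Om m (f, k) -> exists s1 s2 F,
  [/\ sL2 Om (upper f) /\ weakS Om (upper f) s1, sL2 Om s1 /\ sL2 Om s2, scl10 Om (lower f) F,
      forall a, ceq0 Om (fun x => s2 a x - sg F a x) &
      forall a x, upper k a x = m%:C * upper f a x - 'i%C * s2 a x /\
                  lower k a x = - ('i%C * s1 a x) - m%:C * lower f a x].
Proof.
move=> [h1 [h2 [[/= L1 [s1 [Ls1 W1 ->]]] [/= H2 [s2 [Ls2 W2 ->]]] ->]]].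
have L2' := H10_L2 H2.
exists (fun a => entry a s1), (fun a => entry a s2), (fun b j => entry b (grad Om (fun x => dsubmx (f x)) j)).
have eU : (fun a => entry a (fun x => usubmx (f x))) = upper f.
  by apply/funext => a; exact: entry_usubmx.
have eL : (fun a => entry a (fun x => dsubmx (f x))) = lower f.
  by apply/funext => a; exact: entry_dsubmx.
have c2 : scl10 Om (lower f) (fun b j => entry b (grad Om (fun x => dsubmx (f x)) j)).
  by move=> b; rewrite -entry_dsubmx; exact: (H10_cl10 oOm H2).
move/(sigma_nablaP oOm L1 Ls1) : W1; rewrite eU => W1.
move/(sigma_nablaP oOm L2' Ls2) : W2; rewrite eL => W2.
move/(L2P oOm) : Ls1 => Ls1; move/(L2P oOm) : Ls2 => Ls2.
split => //.
- by split => // a; rewrite -entry_usubmx; move/(L2P oOm) : L1.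
- apply: (weakS_unique oOm Ls2 _ W2); last first.
    by apply: (weakS_sg oOm) => b; apply: (cl10_has_grad oOm); exact: c2.
  by apply: (sg_L2 oOm) => b; have [] := c2 b.
- move=> a x; split.
    by rewrite /upper /entry col_mxEu !mxE mulNr.
  by rewrite /lower /entry col_mxEd !mxE mulNr.
Qed.

End dirac_operator.

Section dirac_helmholtz.
Context {R : realType}.
Variables (Om : set (R3 R)) (oOm : open Om).
Let mOm : measurable (Om : set (mR3 R)) := open_measurable_R3 oOm.
Variable m : R.
Implicit Types (p q s : 'I_2 -> R3 R -> R[i]) (F V : 'I_2 -> 'I_3 -> R3 R -> R[i]).
Implicit Types (f g k : field R (2 + 2)) (z : R[i]).

Lemma mulii : 'i%C * 'i%C = -1 :> R[i].
Proof. by rewrite -expr2 sqr_i. Qed.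

Lemma upper_shift z f g a x : upper (g + z *: f) a x = upper g a x + z * upper f a x.
Proof. by rewrite /upper /entry !mxE. Qed.

Lemma lower_shift z f g a x : lower (g + z *: f) a x = lower g a x + z * lower f a x.
Proof. by rewrite /lower /entry !mxE. Qed.

(** [sigma . nabla] squares to the Laplacian, so eliminating the upper
    component leaves a Helmholtz equation for each entry of the lower one. *)
Lemma dirac_helmholtz z f g : L2 Om g -> dirac_zigzag Om m (f, g + z *: f) ->
  exists F, [/\ scl10 Om (lower f) F,
    forall b, weak_helmholtz Om (z ^+ 2 - m%:C ^+ 2) (lower f b) (F b)
      (sw (fun a x => 'i%C * upper g a x) b) (fun x => - ((m%:C - z) * lower g b x)) &
    forall a, ceq0 Om (fun x => (m%:C - z) * upper f a x - (upper g a x + 'i%C * sg F a x))].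
Proof.
move=> /(L2_bispinor oOm)[Lgu Lgl] /(dirac_inv oOm)[s1 [s2 [F [[Lp W] [Ls1 Ls2] cq sF E]]]].
pose c := m%:C - z.
have Eu a x : upper g a x + z * upper f a x = m%:C * upper f a x - 'i%C * s2 a x.
  by have [<- _] := E a x; rewrite upper_shift.
have El a x : lower g a x + z * lower f a x = - ('i%C * s1 a x) - m%:C * lower f a x.
  by have [_ <-] := E a x; rewrite lower_shift.
have e2 a x : 'i%C * s2 a x = c * upper f a x - upper g a x.
  have := Eu a x; move: (s2 a x) (upper f a x) (upper g a x) => t u w h.
  have -> : c * u - w = m%:C * u - (w + z * u) by rewrite /c; ring.
  by rewrite h; ring.
have e1 a x : 'i%C * s1 a x = - (lower g a x + (m%:C + z) * lower f a x).
  have := El a x; move: (s1 a x) (lower f a x) (lower g a x) => t u w h.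
  have -> : w + (m%:C + z) * u = (w + z * u) + m%:C * u by ring.
  by rewrite h; ring.
have LF : sL2 Om (sg F) by apply: (sg_L2 oOm) => b; have [] := cq b.
have Liu : sL2 Om (fun a x => 'i%C * upper g a x) by move=> a; exact: (cL2Z mOm _ (Lgu a)).
exists F; split => //; last first.
  move=> a; apply: filterS (sF a) => x H /H {H} /eqP; rewrite subr_eq0 => /eqP <-.
  by rewrite e2 -/c addrCA subrr addr0 subrr.
move=> b; split=> // v H cv; have [Lv LH _] := cv.
have cs := scl10_single oOm b cv; set S := gsingle b H in cs.
have LS : sL2 Om (sg S) by apply: (sg_L2 oOm) => a; have [] := cs a.
have hF a : has_grad Om (lower f a) (F a) by apply: (cl10_has_grad oOm); exact: cq.
have Ei := sip_adj oOm Liu (fun a => let: And3 _ L _ := cs a in L).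
have es : (fun a x => 'i%C * c * upper f a x) = (fun a x => 'i%C * upper g a x - s2 a x).
  apply/funext => a; apply/funext => x.
  have h : c * upper f a x = 'i%C * s2 a x + upper g a x by rewrite e2 subrK.
  by rewrite -mulrA h mulrDr mulrA mulii mulN1r addrC.
have := weakSZ oOm ('i%C * c) Lp Ls1 W cs.
rewrite es (sipBl oOm Liu Ls2 LS) (sip_ael oOm Ls2 LF LS sF) (sip_sg oOm hF cs).
move=> /(etrans (congr1 (fun t => t - _) (esym Ei))).
rewrite !(sum_grip_single oOm) (sip_single oOm) => /eqP; rewrite subr_eq => /eqP ->.
have -> : (fun x => 'i%C * c * s1 b x) =
    (fun x => (z ^+ 2 - m%:C ^+ 2) * lower f b x + - (c * lower g b x)).
  apply/funext => x; rewrite mulrAC e1 /c; ring.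
ring.
Qed.

(** The upper component is recovered from the first row of [A f = g + z f], which can
    be solved for it because [z] differs from [m]. *)
Lemma helmholtz_dirac z g q F : z != m%:C -> L2 Om g ->
  (forall b, weak_helmholtz Om (z ^+ 2 - m%:C ^+ 2) (q b) (F b)
      (sw (fun a x => 'i%C * upper g a x) b) (fun x => - ((m%:C - z) * lower g b x))) ->
  exists f, dirac_zigzag Om m (f, g + z *: f) /\ lower f = q.
Proof.
move=> zm /(L2_bispinor oOm)[Lgu Lgl] W.
have cq : scl10 Om q F by move=> b; have [] := W b.
have Lq : sL2 Om q by move=> b; have [] := cq b.
pose c := m%:C - z; have c0 : c != 0 by rewrite subr_eq0 eq_sym.
have LF : sL2 Om (sg F) by apply: (sg_L2 oOm) => b; have [] := cq b.
have Liu : sL2 Om (fun a x => 'i%C * upper g a x) by move=> a; exact: (cL2Z mOm _ (Lgu a)).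
have hF a : has_grad Om (q a) (F a) by apply: (cl10_has_grad oOm); exact: cq.
pose r a x := (z ^+ 2 - m%:C ^+ 2) * q a x + - (c * lower g a x).
have Lr : sL2 Om r.
  by move=> a; apply: (cL2D mOm (cL2Z mOm _ (Lq a))); exact: (cL2N mOm (cL2Z mOm _ (Lgl a))).
have Ws : weakS Om (fun a x => 'i%C * upper g a x - sg F a x) r.
  move=> v V cv; have LV : sL2 Om (sg V) by apply: (sg_L2 oOm) => a; have [] := cv a.
  rewrite (sipBl oOm Liu LF LV) (sip_sg oOm hF cv) (sip_adj oOm Liu (fun a => let: And3 _ L _ := cv a in L)).
  rewrite -sumrB -sumrN; apply: eq_bigr => b _; have [_ E] := W b.
  by rewrite (E _ _ (cv b)) opprD addrA subrr add0r.
have Lpi : sL2 Om (fun a x => 'i%C * upper g a x - sg F a x).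
  by move=> a; exact: (cL2B mOm (Liu a) (LF a)).
have Wp := weakSZ oOm (- 'i%C / c) Lpi Lr Ws.
pose p a x := - 'i%C / c * ('i%C * upper g a x - sg F a x).
have := dirac_bispinor oOm m _ _ Wp cq => D.
have {}D := D (fun a => cL2Z mOm _ (Lpi a)) (fun a => cL2Z mOm _ (Lr a)).
exists (bispinor p q); split; last by apply/funext => a; exact: lower_bispinor.
move: D; congr (dirac_zigzag Om m (_, _)).
have zc : z = m%:C - c by rewrite /c; ring.
apply: bispinor_inj => a; apply/funext => x.
  rewrite upper_shift !upper_bispinor /p.
  move: (upper g a x) (sg F a x) => u t; rewrite {1}zc.
  have e : c * (- 'i%C / c * ('i%C * u - t)) = u + 'i%C * t.
    rewrite mulrA (mulrC c) divfK// mulrBr mulrA mulNr mulii; ring.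
  by rewrite mulrBl e; ring.
rewrite lower_shift !lower_bispinor /r.
move: (lower g a x) (q a x) => u t.
have e : 'i%C * (- 'i%C / c * ((z ^+ 2 - m%:C ^+ 2) * t - c * u)) = - (m%:C + z) * t - u.
  have -> : (z ^+ 2 - m%:C ^+ 2) * t - c * u = c * (- (m%:C + z) * t - u) by rewrite /c; ring.
  by rewrite (mulrA _ c) divfK// mulrA mulrN mulii opprK mul1r.
by rewrite e; ring.
Qed.

End dirac_helmholtz.

(** * The spectrum away from [m] *)

Section dirac_spectrum.
Context {R : realType}.
Variables (Om : set (R3 R)) (oOm : open Om).
Let mOm : measurable (Om : set (mR3 R)) := open_measurable_R3 oOm.
Variables (mu : nat -> R).
Hypothesis discr : purely_discrete Om (dirichlet_laplacian Om).
Hypothesis muP : enumerates_eigenvalues Om (dirichlet_laplacian Om) mu.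
Variable m : R.
Implicit Types (p q s : 'I_2 -> R3 R -> R[i]) (F V : 'I_2 -> 'I_3 -> R3 R -> R[i]).
Implicit Types (f g : field R (2 + 2)) (z : R[i]) (k : nat).

Lemma ssq_ge0 p : 0 <= ssq Om p.
Proof. by apply: sumr_ge0 => a _; exact: nsq_ge0. Qed.

Lemma csq_pauli j a b : csq (pauli j a b : R[i]) <= 1.
Proof.
by rewrite /pauli /mx2 /csq; case: j => -[|[|[|//]]] ? /=; rewrite !mxE;
   case: a => -[|[|//]] ?; case: b => -[|[|//]] ? /=; lra.
Qed.

Lemma gsq_sw p b : sL2 Om p -> gsq Om (sw p b) <= 6 * ssq Om p.
Proof.
move=> Lp; apply: (@le_trans _ _ (\sum_(j < 3) 2 * ssq Om p)).
  apply: ler_sum => j _; rewrite -/(nsq Om _) /sw.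
  under eq_fun do rewrite big_ord_recl big_ord_recl big_ord0 addr0.
  have le a : nsq Om (fun x => pauli j b a * p a x) <= nsq Om (p a).
    rewrite (nsqZ mOm _ (Lp a)) -[leRHS]mul1r; apply: ler_wpM2r; first exact: nsq_ge0.
    exact: csq_pauli.
  apply: le_trans (nsqD_le mOm (cL2Z mOm _ (Lp _)) (cL2Z mOm _ (Lp _))) _.
  rewrite -mulrDr ler_pM2l// /ssq /sip big_ord_recl big_ord_recl big_ord0 addr0.
  by apply: lerD; exact: le.
by rewrite sumr_const card_ord -[_ *+ 3]mulr_natl mulrA -natrM.
Qed.

Lemma dirac_L2 f (h : field R (2 + 2)) : dirac_zigzag Om m (f, h) -> L2 Om f.
Proof.
move=> /(dirac_inv oOm)[s1 [s2 [F [[Lp _] _ cq _ _]]]].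
by apply/(L2_bispinor oOm); split => // b; have [] := cq b.
Qed.

(** [sip_sg] bounds the upper component by the gradient of the lower one. *)
Lemma dirac_bound z : z != m%:C -> (forall k, z ^+ 2 - m%:C ^+ 2 <> (mu k)%:C) ->
  exists2 C : R, 0 <= C & forall f g, L2 Om g -> dirac_zigzag Om m (f, g + z *: f) ->
    L2norm Om f ^+ 2 <= C * L2norm Om g ^+ 2.
Proof.
move=> zm lamP; have [D D0 HD] := weak_helmholtz_bound oOm discr muP lamP.
have c0 : m%:C - z != 0 by rewrite subr_eq0 eq_sym.
have q0 := csq_gt0 c0; set q := csq (m%:C - z) in q0.
have E0 : 0 <= D * (12 + q) by rewrite mulr_ge0//; lra.
exists (D * (12 + q) + q^-1 * (2 + 2 * (D * (12 + q)))).
  by rewrite addr_ge0// mulr_ge0 ?invr_ge0 ?ltW//; lra.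
move=> f g Lg Hf; have Lf := dirac_L2 Hf.
rewrite (L2norm_bispinor oOm Lf) (L2norm_bispinor oOm Lg).
have /(L2_bispinor oOm)[Lgu Lgl] := Lg; have /(L2_bispinor oOm)[Lfu Lfl] := Lf.
have [F [cq W up]] := dirac_helmholtz oOm Lg Hf.
set ug := ssq Om (upper g); set lg := ssq Om (lower g).
have ug0 : 0 <= ug by exact: ssq_ge0.
have lg0 : 0 <= lg by exact: ssq_ge0.
have Liu : sL2 Om (fun a x => 'i%C * upper g a x) by move=> a; exact: (cL2Z mOm _ (Lgu a)).
have Lh b : cL2 Om (fun x => - ((m%:C - z) * lower g b x)).
  by exact: (cL2N mOm (cL2Z mOm _ (Lgl b))).
have nh b : nsq Om (fun x => - ((m%:C - z) * lower g b x)) = q * nsq Om (lower g b).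
  by rewrite (nsqN mOm (cL2Z mOm _ (Lgl b))) (nsqZ mOm _ (Lgl b)).
have ni : ssq Om (fun a x => 'i%C * upper g a x) = ug.
  apply: eq_bigr => a _; rewrite -/(nsq Om _) (nsqZ mOm _ (Lgu a)).
  by rewrite /csq /= expr0n add0r expr1n mul1r.
pose rhs b := gsq Om (sw (fun a x => 'i%C * upper g a x) b) + q * nsq Om (lower g b).
have rhs_le : \sum_b rhs b <= (12 + q) * (ug + lg).
  apply: (@le_trans _ _ (\sum_(b < 2) (6 * ug + q * nsq Om (lower g b)))).
    apply: ler_sum => b _; rewrite lerD2r -ni; exact: gsq_sw.
  have -> : \sum_(b < 2) (6 * ug + q * nsq Om (lower g b)) = 12 * ug + q * lg.
    have -> : q * lg = \sum_(b < 2) q * nsq Om (lower g b) by rewrite /lg /ssq /sip mulr_sumr.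
    rewrite big_split /= sumr_const card_ord -[_ *+ 2]mulr_natl mulrA -natrM; congr (_ * _ + _).
  have -> : (12 + q) * (ug + lg) = 12 * ug + q * lg + (12 * lg + q * ug) by ring.
  by rewrite lerDl addr_ge0// mulr_ge0// ltW.
have b1 b : nsq Om (lower f b) <= D * rhs b.
  by have [] := HD _ _ _ _ (sw_L2 oOm Liu b) (Lh b) (W b); rewrite nh.
have b2 b : gsq Om (F b) <= D * rhs b.
  by have [] := HD _ _ _ _ (sw_L2 oOm Liu b) (Lh b) (W b); rewrite nh.
have b3 : ssq Om (lower f) <= D * ((12 + q) * (ug + lg)).
  apply: (@le_trans _ _ (D * \sum_b rhs b)); last exact: ler_wpM2l.
  by rewrite mulr_sumr; apply: ler_sum => b _; exact: b1.
have LF : sL2 Om (sg F) by apply: (sg_L2 oOm) => b; have [] := cq b.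
have b4 : ssq Om (sg F) <= D * ((12 + q) * (ug + lg)).
  rewrite /ssq (sip_sg oOm (fun b => cl10_has_grad oOm (cq b)) cq).
  apply: (@le_trans _ _ (D * \sum_b rhs b)); last exact: ler_wpM2l.
  by rewrite mulr_sumr; apply: ler_sum => b _; exact: b2.
have b5 : q * ssq Om (upper f) <= 2 * ug + 2 * ssq Om (sg F).
  rewrite /ssq /sip !mulr_sumr -big_split; apply: ler_sum => a _ /=.
  rewrite -!/(nsq Om _) -(nsqZ mOm _ (Lfu a)).
  have LiF : cL2 Om (fun x => 'i%C * sg F a x) by exact: (cL2Z mOm _ (LF a)).
  rewrite (nsq_ae oOm (cL2Z mOm _ (Lfu a)) (cL2D mOm (Lgu a) LiF) (up a)).
  apply: le_trans (nsqD_le mOm (Lgu a) LiF) _.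
  by rewrite (nsqZ mOm _ (LF a)) /csq /= expr0n add0r expr1n mul1r.
have b6 : ssq Om (upper f) <= q^-1 * (2 + 2 * (D * (12 + q))) * (ug + lg).
  rewrite -mulrA ler_pdivlMl//; apply: le_trans b5 _.
  move: b4 ug0 lg0; rewrite mulrA; move: (D * (12 + q)) (ssq Om (sg F)) => A B; nra.
rewrite [leRHS]mulrDl [leLHS]addrC; apply: lerD => //.
by move: b3; rewrite mulrA.
Qed.

Lemma resolvent_dirac z : z != m%:C -> (forall k, z ^+ 2 - m%:C ^+ 2 <> (mu k)%:C) ->
  resolvent_set Om (dirac_zigzag Om m) z.
Proof.
move=> zm lamP; have [C C0 HC] := dirac_bound zm lamP.
have L0 : L2 Om (0 : field R (2 + 2)).
  by apply/(L2P oOm) => i; move: (cL2_0 Om); congr cL2; apply/funext => x; rewrite /entry !mxE.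
split.
- move=> f; rewrite /kernel_at /= -[z *: f]add0r => Hf; have Lf := dirac_L2 Hf.
  have := HC _ _ L0 Hf.
  rewrite (L2norm_bispinor oOm Lf) [X in _ <= _ * X](L2norm_bispinor oOm L0).
  have n0 (i : 'I_(2 + 2)) : nsq Om (entry i (0 : field R (2 + 2))) = 0.
    have -> : entry i (0 : field R (2 + 2)) = fun=> 0 by apply/funext => x; rewrite /entry !mxE.
    exact: (rip0l mOm).
  rewrite /ssq /sip [X in _ <= _ * (X + _)]big1 ?[X in _ <= _ * (_ + X)]big1; try by move=> a _; exact: n0.
  rewrite addr0 mulr0 => le0.
  have u0 := ssq_ge0 (upper f); have l0 := ssq_ge0 (lower f).
  have [eu el] : ssq Om (upper f) = 0 /\ ssq Om (lower f) = 0.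
    by move: le0 u0 l0; rewrite /ssq /sip; lra.
  have /(L2_bispinor oOm)[Lfu Lfl] := Lf.
  apply/(eq_ae0_bispinor) => //; split => a.
    apply: (nsq_eq0 mOm (Lfu a)); apply/eqP; rewrite eq_le nsq_ge0 andbT -eu.
    by apply: (@ler_sum_term _ _ (fun a => nsq Om (upper f a))) => b; exact: nsq_ge0.
  apply: (nsq_eq0 mOm (Lfl a)); apply/eqP; rewrite eq_le nsq_ge0 andbT -el.
  by apply: (@ler_sum_term _ _ (fun a => nsq Om (lower f a))) => b; exact: nsq_ge0.
- move=> g Lg; have /(L2_bispinor oOm)[Lgu Lgl] := Lg.
  have Liu : sL2 Om (fun a x => 'i%C * upper g a x) by move=> a; exact: (cL2Z mOm _ (Lgu a)).
  have /choice[q /choice[F W]] : forall b, exists u U, weak_helmholtz Om (z ^+ 2 - m%:C ^+ 2) u U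
      (sw (fun a x => 'i%C * upper g a x) b) (fun x => - ((m%:C - z) * lower g b x)).
    move=> b; apply: (weak_helmholtz_solvable oOm discr muP lamP); first exact: (sw_L2 oOm Liu).
    by exact: (cL2N mOm (cL2Z mOm _ (Lgl b))).
  by have [f [Hf _]] := helmholtz_dirac oOm zm Lg W; exists f.
- exists (Num.sqrt C) => f g Lg Hf.
  rewrite -(@ler_pXn2r _ 2) ?nnegrE ?mulr_ge0 ?sqrtr_ge0//.
  by rewrite exprMn (sqr_sqrtr C0); exact: HC.
Qed.

Lemma eigenvalue_spectrum n (A : set (field R n * field R n)) z :
  eigenvalue_of Om A z -> spectrum Om A z.
Proof. by move=> [f kf nf] [inj _ _]; apply: nf; exact: inj. Qed.

(** The lower spinor [(u, 0)] with [- Delta u = mu k u] solves the Helmholtz equation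
    with zero data. *)
Lemma dirac_eigenvalue z k : z != m%:C -> z ^+ 2 - m%:C ^+ 2 = (mu k)%:C ->
  eigenvalue_of Om (dirac_zigzag Om m) z.
Proof.
move=> zm lam; have [u [G [[cu Lu E] nu]]] := mu_eigenfunction oOm muP k.
have L0 : L2 Om (0 : field R (2 + 2)).
  by apply/(L2P oOm) => i; move: (cL2_0 Om); congr cL2; apply/funext => x; rewrite /entry !mxE.
have e1 b : sw (fun a x => 'i%C * upper (0 : field R (2 + 2)) a x) b = fun _ _ => 0.
  apply/funext => j; apply/funext => x; rewrite /sw big1// => a _.
  by rewrite /upper /entry !mxE !mulr0.
have e2 b : (fun x => - ((m%:C - z) * lower (0 : field R (2 + 2)) b x)) = fun=> 0.
  by apply/funext => x; rewrite /lower /entry !mxE mulr0 oppr0.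
have g0 H : grip Om (fun _ _ => 0) H = 0 by rewrite /grip big1// => j _; exact: (rip0l mOm).
have [|f [Hf lf]] := @helmholtz_dirac _ _ oOm m z 0 (single ord0 u) (gsingle ord0 G) zm L0.
  move=> b; rewrite e1 e2 lam /single /gsingle; case: eqP => _; split => //; last first.
  - by move=> v H _; rewrite !g0 add0r; under eq_fun do rewrite mulr0 addr0; rewrite (rip0l mOm).
  - exact: (cl10_0 oOm).
  - move=> v H cv; rewrite g0 add0r (E _ _ cv); congr rip.
    by apply/funext => x; rewrite addr0.
exists f; first by move: Hf; rewrite add0r.
move=> /(eq_ae0_bispinor)[_ /(_ ord0)]; rewrite lf /single eqxx; exact: nu.
Qed.

Lemma dirac_spectrum : eigenvalue_of Om (dirac_zigzag Om m) m%:C ->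
  spectrum Om (dirac_zigzag Om m) =
    [set m%:C] `|`
    [set z | exists k : nat, z = (Num.sqrt (m ^+ 2 + mu k))%:C \/
                             z = - (Num.sqrt (m ^+ 2 + mu k))%:C].
Proof.
move=> em.
have sq k : (Num.sqrt (m ^+ 2 + mu k))%:C ^+ 2 = m%:C ^+ 2 + (mu k)%:C :> R[i].
  by rewrite -!rmorphXn /= -rmorphD sqr_sqrtr// addr_ge0 ?sqr_ge0// ltW// (mu_gt0 muP).
have eig z k : z ^+ 2 = m%:C ^+ 2 + (mu k)%:C -> spectrum Om (dirac_zigzag Om m) z.
  move=> e; apply: eigenvalue_spectrum; apply: (@dirac_eigenvalue _ k).
    apply/eqP => zm; have := mu_gt0 muP k; move: e; rewrite zm.
    move=> /eqP; rewrite -[X in X == _]addr0 => /eqP/addrI/(congr1 (@complex.Re _)) /= <-.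
    by rewrite ltxx.
  by rewrite e addrC addKr.
apply/seteqP; split => [z sz|z [->|[k [->|->]]]].
- apply: contrapT => nz; apply: sz; apply: resolvent_dirac.
    by apply/eqP => zm; apply: nz; left.
  move=> k e; apply: nz; right; exists k.
  have /eqP : z ^+ 2 = (Num.sqrt (m ^+ 2 + mu k))%:C ^+ 2 by rewrite sq -e addrC subrK.
  by rewrite eqf_sqr => /orP[/eqP ->|/eqP ->]; [left|right].
- exact: eigenvalue_spectrum.
- by apply: (eig _ k); exact: sq.
- by apply: (eig _ k); rewrite sqrrN; exact: sq.
Qed.

End dirac_spectrum.

(** * Linear dependence modulo a subspace *)

Section finite_corank.
Variables (F : fieldType) (E : lmodType F) (X N : E -> Prop).
Hypothesis ND : forall x y, N x -> N y -> N (x + y).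
Hypothesis NZ : forall (c : F) x, N x -> N (c *: x).
Hypothesis N0 : N 0.

Definition indep_mod k (v : 'I_k -> E) :=
  forall c : 'I_k -> F, N (\sum_i c i *: v i) -> forall i, c i = 0.

Lemma N_sum (I : Type) (s : seq I) (G : I -> E) : (forall i, N (G i)) -> N (\sum_(i <- s) G i).
Proof. by move=> NG; elim: s => [|i s ih]; rewrite ?big_nil// big_cons; exact: ND. Qed.

(** Otherwise [f] would extend the independent family. *)
Lemma maximal_indep_spans r (v : 'I_r -> E) : (forall i, X (v i)) -> indep_mod v ->
  ~ (exists2 w : 'I_r.+1 -> E, forall i, X (w i) & indep_mod w) ->
  forall f, X f -> exists d : 'I_r -> F, N (f - \sum_l d l *: v l).
Proof.
move=> Xv iv nw f Xf; apply: contrapT => nd; apply: nw.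
pose w i := if unlift ord0 i is Some l then v l else f.
exists w; first by move=> i; rewrite /w; case: unliftP.
move=> c; rewrite big_ord_recl {1}/w unlift_none.
have -> : \sum_(i < r) c (lift ord0 i) *: w (lift ord0 i) = \sum_(i < r) c (lift ord0 i) *: v i.
  by apply: eq_bigr => i _; rewrite /w liftK.
move=> Nc; have c0 : c ord0 = 0.
  apply/eqP/negPn/negP => c0; apply: nd.
  exists (fun l => - (c ord0)^-1 * c (lift ord0 l)).
  have := NZ (c ord0)^-1 Nc; rewrite scalerDr scalerA mulVf// scale1r; congr (N (_ + _)).
  rewrite scaler_sumr -sumrN; apply: eq_bigr => l _.
  by rewrite scalerA mulNr scaleNr opprK.
move: Nc; rewrite c0 scale0r add0r => Nc i; case: (unliftP ord0 i) => [l ->|->//].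
exact: (iv (fun l => c (lift ord0 l))).
Qed.

(** In terms of a maximal independent family of [r] vectors, the [s] vectors with a
    given index have [s r] coordinates altogether; more than [s r] such lists of
    coordinates are linearly dependent. *)
Lemma common_relation k :
  ~ (exists2 v : 'I_k -> E, forall i, X (v i) & indep_mod v) ->
  exists r, forall s n (t : 'I_s -> 'I_n -> E), (s * r < n)%N -> (forall a i, X (t a i)) ->
    exists2 c : 'I_n -> F, exists i, c i != 0 & forall a, N (\sum_i c i *: t a i).
Proof.
pose P r := exists2 v : 'I_r -> E, forall i, X (v i) & indep_mod v.
move=> nPk; have [r [[v Xv iv] nr]] : exists r, P r /\ ~ P r.+1.
  apply: contrapT => H; apply: nPk; rewrite -/(P k); elim: k => [|k ih].
    by exists (fun i : 'I_0 => 0); [case|move=> c _; case].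
  by apply: contrapT => n; apply: H; exists k.
exists r => s n t sr Xt.
have /choice[D HD] : forall ai : 'I_s * 'I_n, exists d : 'I_r -> F,
    N (t ai.1 ai.2 - \sum_l d l *: v l).
  by move=> [a i]; exact: (maximal_indep_spans Xv iv nr).
pose A : 'M[F]_(n, s * r) := \matrix_i mxvec (\matrix_(a, l) D (a, i) l).
have AE i a l : A i (mxvec_index a l) = D (a, i) l by rewrite mxE mxvecE mxE.
have : kermx A != 0.
  rewrite -mxrank_eq0 mxrank_ker -lt0n subn_gt0; apply: leq_ltn_trans sr.
  exact: rank_leq_col.
move=> /rowV0Pn[c /sub_kermxP cA c0].
exists (fun i => c 0 i); first by apply/rV0Pn.
move=> a.
have -> : \sum_i c 0 i *: t a i = \sum_i c 0 i *: (t a i - \sum_l D (a, i) l *: v l).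
  have -> : \sum_i c 0 i *: (t a i - \sum_l D (a, i) l *: v l) =
      \sum_i c 0 i *: t a i - \sum_i \sum_l (c 0 i * D (a, i) l) *: v l.
    rewrite -sumrB; apply: eq_bigr => i _; rewrite scalerBr scaler_sumr.
    by congr (_ - _); apply: eq_bigr => l _; rewrite scalerA.
  rewrite exchange_big [X in _ - X]big1 ?subr0// => l _.
  rewrite -scaler_suml; have := congr1 (fun M : 'rV_(s * r) => M 0 (mxvec_index a l)) cA.
  rewrite !mxE => h; have e0 : \sum_i c 0 i * D (a, i) l = 0.
    by rewrite -[RHS]h; apply: eq_bigr => i _; rewrite AE.
  by rewrite e0 scale0r.
by apply: N_sum => i; apply: NZ; exact: (HD (a, i)).
Qed.

End finite_corank.

(** * A smooth step function *)

Section step.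
Context {R : realType}.
Implicit Types (t s c : R) (j k : 'I_3).

Definition step t : R := flat 1 t / (flat 1 t + flat 1 (1 - t)).

Definition step' t : R :=
  (flat (flat_next 1) t * flat 1 (1 - t) + flat 1 t * flat (flat_next 1) (1 - t)) /
  (flat 1 t + flat 1 (1 - t)) ^+ 2.

Lemma flat_le0 p t : t <= 0 -> flat p t = 0.
Proof. by move=> t0; rewrite /flat ltNge t0. Qed.

Lemma flat1_mono t s : t <= s -> flat 1 t <= flat 1 s :> R.
Proof.
move=> ts; have [t0|t0] := leP t 0; first by rewrite flat_le0// flat1_ge0.
rewrite /flat t0 (lt_le_trans t0 ts) !hornerC !mul1r ler_expR lerN2.
by rewrite lef_pV2 ?posrE// (lt_le_trans t0 ts).
Qed.

Lemma step_den t : flat 1 (2^-1) <= flat 1 t + flat 1 (1 - t).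
Proof.
have [h|h] := leP 2^-1 t.
  by apply: le_trans (flat1_mono h) _; rewrite lerDl flat1_ge0.
have h2 : 2^-1 <= 1 - t by lra.
by apply: le_trans (flat1_mono h2) _; rewrite lerDr flat1_ge0.
Qed.

Lemma flat_half_gt0 : 0 < flat 1 (2^-1) :> R.
Proof. by rewrite flat1_gt0 invr_gt0. Qed.

Lemma step_den_gt0 t : 0 < flat 1 t + flat 1 (1 - t).
Proof. exact: lt_le_trans flat_half_gt0 (step_den t). Qed.

Lemma step0 t : t <= 0 -> step t = 0.
Proof. by move=> t0; rewrite /step flat_le0// mul0r. Qed.

Lemma step1 t : 1 <= t -> step t = 1.
Proof.
move=> t1; rewrite /step [X in _ + X]flat_le0; last by lra.
by rewrite addr0 divff// gt_eqF// flat1_gt0; lra.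
Qed.

Lemma step_ge0 t : 0 <= step t.
Proof. by rewrite divr_ge0 ?flat1_ge0// ltW// step_den_gt0. Qed.

Lemma step_le1 t : step t <= 1.
Proof. by rewrite ler_pdivrMr ?step_den_gt0// mul1r lerDl flat1_ge0. Qed.

Lemma is_derive_flat_rev p t :
  is_derive t 1 (fun t => flat p (1 - t)) (- flat (flat_next p) (1 - t)).
Proof.
have H : is_derive t 1 (fun t : R => 1 - t) (-1).
  by rewrite -[X in is_derive _ _ _ X]add0r; apply: is_deriveB.
have := @is_derive1_comp _ (flat p) (fun t : R => 1 - t) t _ _ (is_derive_flat p (1 - t)) H.
by rewrite mulrN1.
Qed.

Lemma is_derive_step t : is_derive t 1 step (step' t).
Proof.
have d0 : flat 1 t + flat 1 (1 - t) != 0 by rewrite gt_eqF// step_den_gt0.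
have h1 := is_derive_flat (1 : {poly R}) t; have h2 := is_derive_flat_rev 1 t.
have h3 : is_derive t 1 (fun t => flat 1 t + flat 1 (1 - t))
    (flat (flat_next 1) t - flat (flat_next 1) (1 - t)) by exact: is_deriveD.
have h4 := @is_deriveV R (fun t => flat 1 t + flat 1 (1 - t)) t _ 1 d0 h3.
have h5 := is_deriveM h1 h4.
apply: is_derive_eq h5 _; rewrite /step' /GRing.scale /=.
by move: d0; move: (flat 1 t) (flat 1 (1 - t)) => a b d0; field.
Qed.

Lemma step'_bound : exists2 C : R, 0 <= C & forall t, `|step' t| <= C.
Proof.
have [C C0 HC] := flat_sqr_bound (flat_next 1 : {poly R}).
have [D D0 HD] := flat_sqr_bound (1 : {poly R}).
have h0 := flat_half_gt0.
exists (2 * (C * D) / flat 1 (2^-1) ^+ 2).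
  by rewrite divr_ge0 ?exprn_ge0 ?(ltW h0)//; rewrite mulr_ge0// mulr_ge0.
move=> t; have [t0|t0] := leP t 0.
  rewrite /step' !(flat_le0 _ t0) !mul0r addr0 mul0r normr0.
  by rewrite divr_ge0 ?exprn_ge0 ?(ltW h0)//; rewrite mulr_ge0// mulr_ge0.
have [t1|t1] := leP 1 t.
  have t1' : 1 - t <= 0 by lra.
  rewrite /step' !(flat_le0 _ t1') !mulr0 addr0 mul0r normr0.
  by rewrite divr_ge0 ?exprn_ge0 ?(ltW h0)//; rewrite mulr_ge0// mulr_ge0.
have b (K s : R) : 0 <= K -> 0 < s < 1 -> K * s ^+ 2 <= K.
  by move=> K0 /andP[s0 s1]; rewrite ler_piMr// expr_le1// ltW.
have i1 : 0 < t < 1 by rewrite t0 t1.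
have i2 : 0 < 1 - t < 1 by apply/andP; split; lra.
rewrite /step' normrM normfV [X in _ * X^-1]ger0_norm ?sqr_ge0//.
apply: ler_pM; rewrite ?invr_ge0 ?sqr_ge0//; last first.
  rewrite lef_pV2 ?posrE ?exprn_gt0 ?step_den_gt0//.
  by rewrite ler_pXn2r ?nnegrE ?(ltW h0) ?(ltW (step_den_gt0 t))// step_den.
apply: le_trans (ler_normD _ _) _; rewrite !normrM mulrDl mul1r; apply: lerD.
  apply: ler_pM => //; [exact: le_trans (HC t) (b _ _ C0 i1)|exact: le_trans (HD _) (b _ _ D0 i2)].
rewrite mulrC; apply: ler_pM => //; [exact: le_trans (HC _) (b _ _ C0 i2)|exact: le_trans (HD _) (b _ _ D0 i1)].
Qed.

Lemma smooth_step s c j : smooth (fun x => step (s * coord j x + c)).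
Proof.
apply: smoothM; first exact: smooth_flat.
apply: smoothV; first by move=> x; rewrite gt_eqF// step_den_gt0.
apply: smoothD; first exact: smooth_flat.
have := smooth_flat (- s) (1 - c) j; congr smooth; apply/funext => x.
by congr (flat 1 _); ring.
Qed.

Lemma partial_step s c j k : partial k (fun x => step (s * coord j x + c)) =
  fun x => (k == j)%:R * (s * step' (s * coord j x + c)).
Proof.
have H t : is_derive t 1 (fun t => step (s * t + c)) (s * step' (s * t + c)).
  have h : is_derive t 1 (fun t : R => s * t + c) s.
    have h1 : is_derive t 1 (fun t : R => s * t) s.
      by have := @is_deriveZ _ _ _ id s t 1 1 (is_derive_id t 1); rewrite /GRing.scale /= mulr1.
    by have := is_deriveD h1 (is_derive_cst c t 1); rewrite addr0.
  have := @is_derive1_comp _ step (fun t : R => s * t + c) t _ _ (is_derive_step _) h.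
  by rewrite mulrC.
exact: (@partial_coord_comp _ (fun t => step (s * t + c)) (fun t => s * step' (s * t + c)) j k H).
Qed.

(** a partition of unity on the half-line [t >= 1]; [beta i] lives on [[i, i + 2]] *)
Definition beta (i : nat) t : R := step (t - i%:R) - step (t - i.+1%:R).

(** equal to one on the support of [beta i], and vanishing on the supports of
    [beta k] for [k] at distance at least three from [i] *)
Definition beta_cut (i : nat) t : R := step (t - i%:R + 1) - step (t - i%:R - 2).

Lemma beta_eq0 i t : ~~ (i%:R < t < i%:R + 2) -> beta i t = 0.
Proof.
rewrite negb_and -!leNgt => /orP[h|h]; rewrite /beta -natr1.
  by rewrite !step0 ?subrr//; lra.
by rewrite !step1 ?subrr//; lra.
Qed.

Lemma beta_bound i t : 0 <= beta i t <= 1.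
Proof.
have a0 := step_ge0 (t - i%:R); have a1 := step_le1 (t - i%:R); rewrite /beta -natr1.
have b0 := step_ge0 (t - (i%:R + 1)).
have [h|h] := leP 1 (t - i%:R).
  have := step_le1 (t - (i%:R + 1)); rewrite (step1 h) => ?; apply/andP; split; lra.
have -> : step (t - (i%:R + 1)) = 0 by rewrite step0//; lra.
by rewrite subr0 a0 a1.
Qed.

Lemma sum_beta n t : 1 <= t <= n%:R -> \sum_(i < n) beta i t = 1.
Proof.
move=> /andP[t1 tn].
have -> : \sum_(i < n) beta i t = step t - step (t - n%:R).
  elim: n {tn} => [|n ih]; first by rewrite big_ord0 subr0 subrr.
  by rewrite big_ord_recr /= ih /beta addrA subrK.
by rewrite step1// step0 ?subr0//; lra.
Qed.

Lemma beta_cut_eq1 i t : beta i t != 0 -> beta_cut i t = 1.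
Proof.
move=> n0; have [/andP[h1 h2]|/beta_eq0 b0] := boolP (i%:R < t < i%:R + 2).
  by rewrite /beta_cut step1 ?step0 ?subr0//; lra.
by rewrite b0 eqxx in n0.
Qed.

Lemma beta_cut_eq0 (i k : nat) t : (k + 3 <= i)%N || (i + 3 <= k)%N -> beta k t != 0 ->
  beta_cut i t = 0.
Proof.
move=> far n0; have [/andP[h1 h2]|/beta_eq0 b0] := boolP (k%:R < t < k%:R + 2); last first.
  by rewrite b0 eqxx in n0.
case/orP : far; rewrite -(ler_nat R) natrD => far.
  by rewrite /beta_cut !step0 ?subrr//; lra.
by rewrite /beta_cut !step1 ?subrr//; lra.
Qed.

End step.

(** * Kernel relations produce functions of zero trace *)

Section arctangent.
Context {R : realType}.
Variable s : R.
Hypothesis s0 : 0 < s.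

(** The arctangent is a bounded function, strictly increasing along the first
    coordinate, whose second derivative is at most [s] times the first. *)
Definition arct (x : R3 R) : R := atan (s * coord ord0 x).
Definition arct' (x : R3 R) : R := s / (1 + (s * coord ord0 x) ^+ 2).
Definition arct_ratio (x : R3 R) : R := 2 * s * (s * coord ord0 x) / (1 + (s * coord ord0 x) ^+ 2).

Lemma arct_den_gt0 (t : R) : 0 < 1 + t ^+ 2.
Proof. by rewrite ltr_wpDr// sqr_ge0. Qed.

Lemma smooth_arct_den : smooth (fun x => 1 + (s * coord ord0 x) ^+ 2).
Proof.
apply: smoothD; first exact: smooth_cst.
by apply: smooth_exp; apply: smoothZ; exact: smooth_coord.
Qed.

Lemma smooth_arct' : smooth arct'.
Proof.
apply: smoothM; first exact: smooth_cst.
by apply: smoothV; [move=> x; rewrite gt_eqF// arct_den_gt0|exact: smooth_arct_den].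
Qed.

Lemma smooth_arct_ratio : smooth arct_ratio.
Proof.
apply: smoothM; first by apply: smoothZ; apply: smoothZ; exact: smooth_coord.
by apply: smoothV; [move=> x; rewrite gt_eqF// arct_den_gt0|exact: smooth_arct_den].
Qed.

Lemma is_derive_arct1 (t : R) : is_derive t 1 (fun t : R => atan (s * t)) (s / (1 + (s * t) ^+ 2)).
Proof.
have h1 : is_derive t 1 (fun t : R => s * t) s.
  by have := @is_deriveZ _ _ _ id s t 1 1 (is_derive_id t 1); rewrite /GRing.scale /= mulr1.
have := @is_derive1_comp _ atan (fun t : R => s * t) t _ _ (is_derive1_atan _) h1.
by rewrite mulrC.
Qed.

Lemma partial_arct k : partial k arct = fun x => (k == ord0)%:R * arct' x.
Proof. exact: (@partial_coord_comp _ _ _ ord0 k is_derive_arct1). Qed.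

Lemma smooth_arct : smooth arct.
Proof.
apply/smoothP; split.
  by move=> x; apply: continuous_comp; [apply: cvgM; [exact: cvg_cst|exact: continuous_coord]|exact: continuous_atan].
move=> k; split; last by rewrite partial_arct; apply: smoothZ; exact: smooth_arct'.
by move=> x; have [] := coord_comp_derive ord0 k x is_derive_arct1.
Qed.

Lemma partial_arct' k :
  partial k arct' = fun x => (k == ord0)%:R * - (arct_ratio x * arct' x).
Proof.
apply/funext => x; have sd := smooth_arct_den.
have n0 y : 1 + (s * coord ord0 y) ^+ 2 != 0 by rewrite gt_eqF// arct_den_gt0.
rewrite /arct' partialM; [|exact: derivable_cst|by apply: smooth_derivable; exact: smoothV].
rewrite partial_cst mulr0 addr0 partialV//; last exact: smooth_derivable.
have sc : smooth (fun x : R3 R => s * coord ord0 x) by apply: smoothZ; exact: smooth_coord.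
have E : (fun x : R3 R => 1 + (s * coord ord0 x) ^+ 2) = fun x => 1 + (s * coord ord0 x) * (s * coord ord0 x).
  by apply/funext => y; rewrite expr2.
have -> : partial k (fun x : R3 R => 1 + (s * coord ord0 x) ^+ 2) x =
    2 * s * (s * coord ord0 x) * (k == ord0)%:R.
  rewrite E partialD; [|exact: derivable_cst|by apply: smooth_derivable; exact: smoothM].
  rewrite partial_cst add0r partialM; try exact: smooth_derivable.
  by rewrite partialZ ?partial_coord; [ring|exact: smooth_coord].
rewrite /arct_ratio; have := n0 x; move: (s * coord ord0 x) => t h; field; exact: h.
Qed.

Lemma arct'_gt0 x : 0 < arct' x.
Proof. by rewrite divr_gt0// arct_den_gt0. Qed.

Lemma arct'_le x : arct' x <= s.
Proof. by rewrite ler_pdivrMr ?arct_den_gt0// ler_peMr ?(ltW s0)// lerDl sqr_ge0. Qed.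

Lemma arct_ratio_le x : `|arct_ratio x| <= s.
Proof.
rewrite /arct_ratio -[2 * s * _]mulrA mulrCA -mulrA normrM (gtr0_norm s0) ler_piMr ?(ltW s0)//.
rewrite normrM normfV [X in _ / X]gtr0_norm ?arct_den_gt0// ler_pdivrMr ?arct_den_gt0// mul1r.
move: (s * coord ord0 x) => t; have := sqr_ge0 (t - 1); have := sqr_ge0 (t + 1).
by rewrite ler_norml => h1 h2; apply/andP; split; nra.
Qed.

Lemma arct_bound x : `|arct x| <= pi.
Proof.
have h1 := atan_gtNpi2 (s * coord ord0 x); have h2 := atan_ltpi2 (s * coord ord0 x).
by have := @pi_gt0 R; rewrite /arct ler_norml => p0; apply/andP; split; lra.
Qed.

End arctangent.

Section bumps.
Context {R : realType}.
Variables (Om : set (R3 R)) (oOm : open Om).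
Let mOm : measurable (Om : set (mR3 R)) := open_measurable_R3 oOm.
Implicit Types (u v psi : R3 R -> R[i]) (G H : 'I_3 -> R3 R -> R[i]).

Lemma rL2_sub (a : R3 R -> R) : rL2 setT a -> rL2 Om a.
Proof.
move=> [ma ia]; split; first exact: measurable_funS ma.
by apply: integrableS ia.
Qed.

(** The support may leave [Om]: such functions are square integrable on [Om] but in
    general not of zero trace. *)
Lemma bump_cL2 psi : ctest setT psi -> cL2 Om psi.
Proof.
by move=> [t1 t2]; split; apply: rL2_sub; apply: test_function_rL2 => //; exact: (open_measurable_R3 openT).
Qed.

Lemma bump_has_grad psi : ctest setT psi -> has_grad Om psi (fun j => dC j psi).
Proof.
move=> t; split; first exact: bump_cL2.
  by move=> j; apply: bump_cL2; exact: ctest_dC.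
by move=> j; exact: (csmooth_cwd oOm j (ctest_smooth t)).
Qed.

Lemma has_gradB u G v H : has_grad Om u G -> has_grad Om v H ->
  has_grad Om (fun x => u x - v x) (fun j x => G j x - H j x).
Proof.
move=> [Lu LG wu] [Lv LH wv]; split; first exact: cL2B.
  by move=> j; exact: (cL2B mOm (LG j) (LH j)).
by move=> j; apply: (cwdB oOm Lu (LG j) Lv (LH j)); [exact: wu|exact: wv].
Qed.

Definition zero_trace psi := cl10 Om psi (fun j => dC j psi).

Lemma zero_traceM (m : R3 R -> R) (C : R) psi : ctest setT psi -> smooth m ->
  (forall x, `|m x| <= C) -> (forall j x, `|partial j m x| <= C) ->
  zero_trace psi -> zero_trace (fun x => (m x)%:C * psi x).
Proof.
move=> t sm mC dmC /(cl10_mul oOm sm mC dmC); rewrite /zero_trace.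
have [_ E] := ctestM sm t.
by congr cl10; apply/funext => j; rewrite E.
Qed.

Lemma ctest_sum (U : set (R3 R)) (oU : open U) (I : Type) (s : seq I) (F : I -> R3 R -> R[i]) :
  (forall i, ctest U (F i)) -> ctest U (fun x => \sum_(i <- s) F i x) /\
  forall j, dC j (fun x => \sum_(i <- s) F i x) = fun x => \sum_(i <- s) dC j (F i) x.
Proof.
move=> tF; elim: s => [|i s [ih1 ih2]].
  have E : (fun x : R3 R => \sum_(i <- [::]) F i x) = fun=> 0 by apply/funext => x; rewrite big_nil.
  rewrite E; split; first exact: ctest0.
  move=> j; apply/funext => x; rewrite big_nil /dC.
  by rewrite (_ : re _ = fun=> 0)// (_ : im _ = fun=> 0)// partial_cst.
have E : (fun x => \sum_(i <- i :: s) F i x) = fun x => F i x + \sum_(i <- s) F i x.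
  by apply/funext => x; rewrite big_cons.
rewrite E; split; first exact: ctestD.
move=> j; rewrite (dCD j (ctest_smooth (tF i)) (ctest_smooth ih1)) ih2.
by apply/funext => x; rewrite big_cons.
Qed.

Variable K : R.
Hypothesis K0 : 0 < K.
Hypothesis poinc : forall u G, cl10 Om u G -> nsq Om u <= K * gsq Om G.

Variable s : R.
Hypothesis s0 : 0 < s.
Hypothesis sK : 4 * K * s ^+ 2 <= 1.
Let l := arct s.
Let d := arct' s.
Let r := arct_ratio s.

(** [psi - u] is locally constant.  Were it nonzero, [v := u' - l u] would be a
    function of zero trace with gradient [(psi - u) grad l]; but [l''] is so
    small compared with [l'] that integrating by parts contradicts Poincare. *)
Lemma locally_constant_eq0 psi u U u' U' : ctest setT psi -> cl10 Om u U -> cl10 Om u' U' ->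
  (forall j, ceq0 Om (fun x => dC j psi x - U j x)) ->
  (forall j, ceq0 Om (fun x => dC j (fun x => (l x)%:C * psi x) x - U' j x)) ->
  ceq0 Om (fun x => psi x - u x).
Proof.
move=> t cu cu' e e'; have sl : smooth l := smooth_arct s; have sd : smooth d := smooth_arct' s.
have [tl El] := ctestM sl t; have [td Ed] := ctestM sd t.
(* a common bound for [l], [d] and their first derivatives *)
pose C := Num.max (pi : R) (Num.max s (s * s)).
have Cs x : `|d x| <= s by rewrite gtr0_norm ?arct'_gt0// arct'_le.
have pdk k x : `|partial k d x| <= s * s.
  rewrite partial_arct' normrM normr_nat normrN normrM.
  apply: (@le_trans _ _ (1 * (s * s))); last by rewrite mul1r.
  apply: ler_pM => //; first by case: (k == _).
  by apply: ler_pM => //; exact: arct_ratio_le.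
have plk k x : `|partial k l x| <= s.
  rewrite partial_arct normrM normr_nat.
  apply: (@le_trans _ _ (1 * s)); last by rewrite mul1r.
  by apply: ler_pM => //; case: (k == _).
have clu := cl10_mul oOm sl (C := C) _ _ cu.
have {}clu : cl10 Om (fun x => (l x)%:C * u x) (fun j x => (l x)%:C * U j x + (partial j l x)%:C * u x).
  apply: clu => [x|j x]; rewrite !le_max; first by rewrite arct_bound.
  by rewrite plk orbT.
have cdu := cl10_mul oOm sd (C := C) _ _ cu.
have {}cdu : cl10 Om (fun x => (d x)%:C * u x) (fun j x => (d x)%:C * U j x + (partial j d x)%:C * u x).
  by apply: cdu => [x|j x]; rewrite !le_max; [rewrite Cs|rewrite pdk]; rewrite !orbT.
have [Lu LU _] := cu; have Lp := bump_cL2 t.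
pose c x := psi x - u x.
pose w x := (d x)%:C * psi x - (d x)%:C * u x.
pose v x := u' x - (l x)%:C * u x.
pose V j x := U' j x - ((l x)%:C * U j x + (partial j l x)%:C * u x).
have cv : cl10 Om v V by exact: cl10B.
have [Lv LV _] := cv.
pose W j x := dC j (fun x => (d x)%:C * psi x) x - ((d x)%:C * U j x + (partial j d x)%:C * u x).
have hw : has_grad Om w W by apply: has_gradB; [exact: bump_has_grad|exact: (cl10_has_grad oOm cdu)].
have [Lw LW _] := hw.
have V_ae j : ceq0 Om (fun x => V j x - (j == ord0)%:R * w x).
  apply: filterS2 (e j) (e' j) => x h h' Ox.
  have := h Ox => /eqP; rewrite subr_eq0 => /eqP hU.
  have := h' Ox => /eqP; rewrite subr_eq0 => /eqP hU'.
  rewrite /V /w -hU -hU' El partial_arct -/d.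
  by case: (j == ord0); rewrite ?mul1r ?mul0r /=; ring.
have W_ae : ceq0 Om (fun x => W ord0 x - - ((r x)%:C * w x)).
  apply: filterS (e ord0) => x h Ox.
  have := h Ox => /eqP; rewrite subr_eq0 => /eqP hU.
  have E : (- (r x * d x))%:C = - ((r x)%:C * (d x)%:C) :> R[i].
    by rewrite rmorphN rmorphM.
  by rewrite /W /w -hU Ed partial_arct' eqxx mul1r -/d -/r E; ring.
have mr : measurable_fun (Om : set (mR3 R)) (r : mR3 R -> R).
  by apply: continuous_measurable_R3 => //; apply: smooth_continuous; exact: smooth_arct_ratio.
have [Lrw le_rw] := cL2_bounded_mul oOm mr (arct_ratio_le s0) Lw.
have X1 : rip Om w (V ord0) = nsq Om w.
  apply: rip_aer => //; move: (V_ae ord0); rewrite eqxx.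
  by congr ceq0; apply/funext => x; rewrite mul1r.
have X2 : nsq Om v <= K * nsq Om w.
  apply: le_trans (poinc cv) _; rewrite ler_pM2l// /gsq /grip (bigD1 ord0)//= big1 ?addr0.
    rewrite -/(nsq Om _) (nsq_ae oOm (LV ord0) Lw)//; move: (V_ae ord0); rewrite eqxx.
    by congr ceq0; apply/funext => x; rewrite mul1r.
  move=> j /negbTE j0; apply: (ceq0_nsq oOm (LV j)); move: (V_ae j); rewrite j0.
  by congr ceq0; apply/funext => x; rewrite mul0r subr0.
have X3 : nsq Om (W ord0) <= s ^+ 2 * nsq Om w.
  by rewrite (nsq_ae oOm (LW ord0) (cL2N mOm Lrw) W_ae) (nsqN mOm Lrw).
have X4 : nsq Om w = - rip Om (W ord0) v by rewrite -(has_grad_ibp oOm ord0 hw cv) X1.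
(* Young with weight [2 K] leaves half of [nsq w] for each of the two terms *)
have K2 : 0 < 2 * K by rewrite mulr_gt0.
have := rip_young mOm K2 (cL2N mOm (LW ord0)) Lv; rewrite (nsqN mOm (LW ord0)) (ripNl mOm (LW ord0) Lv) -X4.
have w0 := nsq_ge0 Om w; have K2V : (2 * K)^-1 * nsq Om v <= 2^-1 * nsq Om w.
  rewrite invfM -mulrA ler_pM2l ?invr_gt0// ler_pdivrMl//.
have X5 : 2 * K * nsq Om (W ord0) <= 2^-1 * nsq Om w.
  apply: (@le_trans _ _ (2 * K * (s ^+ 2 * nsq Om w))); first by rewrite ler_pM2l.
  by rewrite mulrA ler_wpM2r//; move: sK; lra.
move=> Y; have {}w0 : nsq Om w = 0 by move: w0 Y K2V X5; lra.
apply: filterS (nsq_eq0 mOm Lw w0) => x h Ox; have := h Ox; rewrite /w -mulrBr => /eqP.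
rewrite mulf_eq0 => /orP[/eqP/(congr1 (@complex.Re _)) /= dx|/eqP//].
by have := arct'_gt0 s0 x; rewrite -/d dx ltxx.
Qed.

End bumps.

Section kernel_relations.
Context {R : realType}.
Variables (Om : set (R3 R)) (oOm : open Om).
Let mOm : measurable (Om : set (mR3 R)) := open_measurable_R3 oOm.
Variable m : R.
Implicit Types (u v psi : R3 R -> R[i]) (G H : 'I_3 -> R3 R -> R[i]) (a b : 'I_2).

(** [sigma . nabla] of [w] times the [a]-th basis spinor, where [W = grad w] *)
Definition kernel_spinor a G : field R (2 + 2) :=
  bispinor (sg (gsingle a G)) (fun _ _ => 0).

Lemma sg_gsingle a G b x : sg (gsingle a G) b x = \sum_j pauli j b a * G j x.
Proof.
apply: eq_bigr => j _; rewrite (bigD1 a)//= /gsingle eqxx big1 ?addr0// => c /negbTE ->.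
by rewrite mulr0.
Qed.

(** [sigma . nabla] maps [w] to the kernel of [sigma . nabla] when [w] is weakly
    harmonic, because its square is the Laplacian. *)
Lemma kernel_spinorP a u G : has_grad Om u G ->
  (forall v H, cl10 Om v H -> grip Om G H = 0) ->
  kernel_at (dirac_zigzag Om m) m%:C (kernel_spinor a G).
Proof.
move=> hu orth; have [Lu LG _] := hu.
have hs b : has_grad Om (single a u b) (gsingle a G b).
  rewrite /single /gsingle; case: eqP => // _; apply: (cl10_has_grad oOm); exact: cl10_0.
have Lsg : sL2 Om (sg (gsingle a G)) by apply: (sg_L2 oOm) => b; have [] := hs b.
have L0 : sL2 Om (fun _ _ => 0) by move=> b; exact: cL2_0.
have W0 : weakS Om (sg (gsingle a G)) (fun _ _ => 0).
  move=> v V cv; rewrite (sip_sg oOm hs cv).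
  have -> : \sum_b grip Om (gsingle a G b) (V b) = grip Om G (V a).
    rewrite (bigD1 a)//= big1 ?addr0 /gsingle ?eqxx// => b /negbTE ->.
    by rewrite /grip big1// => j _; rewrite (rip0l mOm).
  rewrite (orth _ _ (cv a)) /sip big1 ?oppr0// => b _; exact: (rip0l mOm).
have c0 : scl10 Om (fun _ _ => 0) (fun _ _ _ => 0) by move=> b; exact: (cl10_0 oOm).
have := dirac_bispinor oOm m Lsg L0 W0 c0; rewrite /kernel_at /=.
have s0 b x : sg (fun _ _ _ => 0) b x = 0 :> R[i].
  by rewrite /sg big1// => j _; rewrite big1// => c _; rewrite mulr0.
congr (dirac_zigzag Om m (_, _)); apply: bispinor_inj => b; apply/funext => x.
  rewrite upper_bispinor s0 mulr0 subr0 -[m%:C *: _]add0r upper_shift upper_bispinor.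
  by rewrite /upper /entry mxE add0r.
rewrite lower_bispinor mulr0 oppr0 add0r -[m%:C *: _]add0r lower_shift lower_bispinor.
by rewrite /lower /entry mxE add0r mulr0 oppr0.
Qed.

Lemma upper_sum n (c : 'I_n -> R[i]) (t : 'I_n -> field R (2 + 2)) b x :
  upper (\sum_i c i *: t i) b x = \sum_i c i * upper (t i) b x.
Proof.
rewrite /upper /entry; elim/big_ind2 : _ => [|y p z q <- <-|i _]; rewrite ?mxE//.
Qed.

Lemma pauli_inj (w : 'I_3 -> R[i]) :
  (forall a b, \sum_j pauli j b a * w j = 0) -> forall j, w j = 0.
Proof.
move=> H; have z := H 0 0; have p := H 0 1; have q := H 1 0.
rewrite !big_ord_recl !big_ord0 /pauli /mx2 !mxE /= in z p q.
rewrite ?mul0r ?mul1r ?add0r ?addr0 in z p q.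
have i0 : 'i%C <> 0 :> R[i] by move=> /(congr1 (@complex.Im _)) /= /eqP; rewrite oner_eq0.
have w1 : w (lift ord0 ord0) = 0.
  have : 2 * ('i%C * w (lift ord0 ord0)) = 0.
    transitivity ((w ord0 + 'i%C * w (lift ord0 ord0)) - (w ord0 + - 'i%C * w (lift ord0 ord0))).
      by ring.
    by rewrite p q subrr.
  by move/eqP; rewrite !mulf_eq0 pnatr_eq0 /= => /orP[/eqP//|/eqP].
have w0 : w ord0 = 0 by move: p; rewrite w1 mulr0 addr0.
have w2 : w (lift ord0 (lift ord0 ord0)) = 0 by [].
move=> j; case: (unliftP ord0 j) => [k ->|->//].
by case: (unliftP ord0 k) => [k' ->|->//]; rewrite (ord1 k').
Qed.

(** A relation for both basis spinors [a] is a relation for the gradients, since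
    [sigma . p] determines the vector [p]. *)
Lemma kernel_spinor_relation n (c : 'I_n -> R[i]) (G : 'I_n -> 'I_3 -> R3 R -> R[i]) :
  (forall a, eq_ae Om (\sum_i c i *: kernel_spinor a (G i)) 0) ->
  forall j, ceq0 Om (fun x => \sum_i c i * G i j x).
Proof.
move=> H j.
have H' : {ae lebesgue3, forall x : mR3 R, forall ab : 'I_2 * 'I_2, Om x ->
    \sum_j pauli j ab.2 ab.1 * \sum_i c i * G i j x = 0}.
  apply: filter_forall => -[a b] /=.
  have /(eq_ae0_bispinor)[/(_ b) h _] := H a; apply: filterS h => x h Ox.
  rewrite -[RHS](h Ox) upper_sum; under [RHS]eq_bigr do rewrite upper_bispinor sg_gsingle mulr_sumr.
  rewrite exchange_big; apply: eq_bigr => k _; rewrite mulr_sumr; apply: eq_bigr => i _.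
  by rewrite mulrCA.
apply: filterS H' => x h Ox.
by apply: (@pauli_inj (fun j => \sum_i c i * G i j x)) => a b; exact: (h (a, b) Ox).
Qed.

Variable mu : nat -> R.
Hypothesis discr : purely_discrete Om (dirichlet_laplacian Om).
Hypothesis muP : enumerates_eigenvalues Om (dirichlet_laplacian Om) mu.

Definition real_bump (f : R3 R -> R) : R3 R -> R[i] := fun x => (f x)%:C.

Lemma real_bump_ctest (f : R3 R -> R) : test_function setT f -> ctest setT (real_bump f).
Proof. by move=> t; split => //; exact: test_function0. Qed.

(** Finite rank of the kernel of [A - m] forces finite rank of the compactly
    supported smooth functions modulo those of zero trace: each [f i] and each
    [l f i], where [l] is the arctangent of [locally_constant_eq0], differs
    from a function of zero trace by a weakly harmonic one, and so yields four
    kernel elements.  A common linear relation between them says that some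
    combination of the [f i] agrees, up to a locally constant function, with one
    of zero trace; the locally constant function vanishes, and the cut-offs [c i]
    isolate an [f i] with nonzero coefficient. *)
Lemma separated_bumps k :
  ~ (exists2 v : 'I_k -> field R (2 + 2),
       forall i, kernel_at (dirac_zigzag Om m) m%:C (v i) & lin_indep Om v) ->
  exists N, forall n (f c : 'I_n -> R3 R -> R), (N < n)%N ->
    (forall i, test_function setT (f i)) ->
    (forall i, smooth (c i)) ->
    (forall i, exists C : R, forall x, `|c i x| <= C /\ forall j, `|partial j (c i) x| <= C) ->
    (forall i x, c i x * f i x = f i x) ->
    (forall i k x, i != k -> c i x * f k x = 0) ->
    exists i, zero_trace Om (real_bump (f i)).
Proof.
move=> nk; have [K K0 HK] := poincare_dirichlet oOm discr muP.
pose K1 := K + 1; have K1_gt0 : 0 < K1 by rewrite ltr_wpDl.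
have HK1 u G : cl10 Om u G -> nsq Om u <= K1 * gsq Om G.
  move=> /HK/le_trans; apply; rewrite ler_wpM2r ?gsq_ge0//.
  by rewrite lerDl.
(* small enough for [locally_constant_eq0] *)
pose s := Num.sqrt (4 * K1)^-1.
have s0 : 0 < s by rewrite sqrtr_gt0 invr_gt0 mulr_gt0.
have sK : 4 * K1 * s ^+ 2 <= 1.
  by rewrite sqr_sqrtr ?invr_ge0 ?mulr_ge0 ?(ltW K1_gt0)// divff// mulf_neq0 ?gt_eqF.
pose Ker f := kernel_at (dirac_zigzag Om m) m%:C f.
pose Null (f : field R (2 + 2)) := {ae lebesgue3, forall x : mR3 R, Om x -> f x = 0}.
have ND x y : Null x -> Null y -> Null (x + y).
  move=> hx hy; apply: filterS2 hx hy => z h1 h2 Oz.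
  by rewrite /GRing.add /= h1// h2// addr0.
have NZ (a : R[i]) x : Null x -> Null (a *: x).
  by move=> hx; apply: filterS hx => z h Oz; rewrite /GRing.scale /= h// scaler0.
have N0 : Null 0 by apply: (filterS (P := setT)) => //; exact: filterT.
have [rk Hrk] := common_relation (X := Ker) ND NZ N0 (k := k) nk.
(* the four families are indexed by the basis spinor and by whether [l] is present *)
exists (#|{: 'I_2 * bool}| * rk)%N => n f c nN tf sc bc cf cf0.
pose l : R3 R -> R := arct s; have sl : smooth l := smooth_arct s.
pose psi (b : bool) i : R3 R -> R[i] :=
  if b then fun x => (l x)%:C * real_bump (f i) x else real_bump (f i).
have tpsi (b : bool) i : ctest setT (psi b i).
  by rewrite /psi; case: b; [have [] := ctestM sl (real_bump_ctest (tf i))|exact: real_bump_ctest].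
have /choice[u /choice[U HU]] : forall bi : bool * 'I_n, exists u G, cl10 Om u G /\
    forall v H, cl10 Om v H -> grip Om G H = grip Om (fun j => dC j (psi bi.1 bi.2)) H.
  move=> [b i]; apply: (gradient_projection oOm HK1) => j.
  by apply: (bump_cL2 oOm); exact: ctest_dC.
pose W (b : bool) i j x := dC j (psi b i) x - U (b, i) j x.
have hW (b : bool) i : has_grad Om (fun x => psi b i x - u (b, i) x) (W b i).
  apply: (has_gradB oOm); first exact: bump_has_grad.
  by apply: (cl10_has_grad oOm); have [] := HU (b, i).
pose t (ab : 'I_(#|{: 'I_2 * bool}|)) i := kernel_spinor (enum_val ab).1 (W (enum_val ab).2 i).
have [|al [i0 al0] rel] := Hrk _ n t nN.
  move=> ab i; apply: kernel_spinorP (hW _ i) _ => v H cv; set b := (enum_val ab).2.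
  have [[_ LU _] E] := HU (b, i); have [_ LH _] := cv.
  rewrite (gripBl oOm _ LU LH) ?(E _ _ cv) ?subrr// => j.
  by apply: (bump_cL2 oOm); exact: ctest_dC.
have rel' (b : bool) j : ceq0 Om (fun x => \sum_i al i * W b i j x).
  apply: kernel_spinor_relation => a; have := rel (enum_rank (a, b)).
  by rewrite /t enum_rankK.
pose Psi x := \sum_i al i * psi false i x.
have [tPsi dPsi] : ctest setT Psi /\ forall j, dC j Psi = fun x => \sum_i dC j (fun x => al i * psi false i x) x.
  by apply: (ctest_sum openT) => i; exact: ctestZ.
have cu (b : bool) : cl10 Om (fun x => \sum_i al i * u (b, i) x) (fun j x => \sum_i al i * U (b, i) j x).
  by apply: (cl10_sum oOm) => i; apply: (cl10Z oOm); have [] := HU (b, i).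
have sep (b : bool) j : ceq0 Om (fun x => \sum_i al i * dC j (psi b i) x - \sum_i al i * U (b, i) j x).
  apply: filterS (rel' b j) => x h Ox; rewrite -[RHS](h Ox) -sumrB.
  by apply: eq_bigr => i _; rewrite mulrBr.
have dZ (b : bool) i j : dC j (fun x => al i * psi b i x) = fun x => al i * dC j (psi b i) x.
  exact: (dCZ j _ (ctest_smooth (tpsi b i))).
have sep0 j : ceq0 Om (fun x => dC j Psi x - \sum_i al i * U (false, i) j x).
  by apply: filterS (sep false j) => x h Ox; rewrite -[RHS](h Ox) dPsi; under eq_bigr do rewrite dZ.
have lPsi : (fun x => (l x)%:C * Psi x) = fun x => \sum_i al i * psi true i x.
  by apply/funext => x; rewrite mulr_sumr; apply: eq_bigr => i _; rewrite mulrCA.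
have [_ dlPsi] : ctest setT (fun x => \sum_i al i * psi true i x) /\
    forall j, dC j (fun x => \sum_i al i * psi true i x) = fun x => \sum_i dC j (fun x => al i * psi true i x) x.
  by apply: (ctest_sum openT) => i; exact: ctestZ.
have sep1 j : ceq0 Om (fun x => dC j (fun x => (l x)%:C * Psi x) x - \sum_i al i * U (true, i) j x).
  apply: filterS (sep true j) => x h Ox; rewrite -[RHS](h Ox) lPsi dlPsi.
  by under eq_bigr do rewrite dZ.
have Psi0 := locally_constant_eq0 oOm K1_gt0 HK1 s0 sK tPsi (cu false) (cu true) sep0 sep1.
have zPsi : zero_trace Om Psi.
  apply: (cl10_ae oOm (cu false) (bump_cL2 oOm tPsi) _ Psi0 sep0) => j.
  by apply: (bump_cL2 oOm); exact: ctest_dC.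
exists i0; have [C HC] := bc i0.
have := zero_traceM oOm tPsi (sc i0) (fun x => (HC x).1) (fun j x => (HC x).2 j) zPsi.
have -> : (fun x => (c i0 x)%:C * Psi x) = fun x => al i0 * real_bump (f i0) x.
  apply/funext => x; rewrite /Psi mulr_sumr (bigD1 i0)//= big1 ?addr0; last first.
    by move=> i ii0; rewrite mulrCA /real_bump -rmorphM /= cf0 1?eq_sym// mulr0.
  by rewrite mulrCA /real_bump -rmorphM /= cf.
move=> /(cl10Z oOm (al i0)^-1); rewrite /zero_trace; congr cl10.
  by apply/funext => x; rewrite mulrA mulVf// mul1r.
apply/funext => j; apply/funext => x.
by rewrite (dCZ j _ (ctest_smooth (real_bump_ctest (tf i0)))) mulrA mulVf// mul1r.
Qed.

End kernel_relations.

(** * Bumps concentrated in small cubes *)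

Section volumes.
Context {R : realType}.
Variables (Om : set (R3 R)) (oOm : open Om).
Let mOm : measurable (Om : set (mR3 R)) := open_measurable_R3 oOm.
Implicit Types (a b : R3 R) (f : R3 R -> R).

Definition cvol a b : R := Int Om (\1_(cbox a b) : R3 R -> R).

Lemma integ_cbox a b : integ Om (\1_(cbox a b) : R3 R -> R).
Proof.
apply: (@integrable_compact_bounded _ _ a b 1) => //.
- apply: measurable_funS (measurableT) _ _ => //; apply: measurable_indic; exact: measurable_cbox.
- by move=> x _; rewrite indicE ger0_norm//; case: (_ \in _).
- by move=> x nx; rewrite indicE memNset.
Qed.

Lemma cvolE a b : cvol a b = fine (lebesgue3 (Om `&` cbox a b)).
Proof.
rewrite /cvol /Int /Rintegral integral_indic//; last exact: measurable_cbox.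
by rewrite setIC.
Qed.

Lemma cvol_ge0 a b : 0 <= cvol a b.
Proof. by rewrite cvolE fine_ge0. Qed.

Lemma lebesgue3_cbox a b : (forall j, coord j a <= coord j b) ->
  lebesgue3 (cbox a b) = (\prod_j (coord j b - coord j a))%:E.
Proof.
move=> ab; rewrite cboxE /lebesgue3 product_measure1E//; last exact: measurableX.
rewrite [X in (X * _)%E]lebesgue2_setX//.
have seg (s t : R) : s <= t -> lebesgue_measure `[s, t]%classic = (t - s)%:E.
  move=> st; rewrite lebesgue_measure_itv /= lte_fin; case: ltP => [|ts]; first by rewrite EFinN EFinD.
  by rewrite (le_anti (introT andP (conj st ts))) subrr.
rewrite (seg a.1.1 b.1.1 (ab (@Ordinal 3 0 isT))) (seg a.1.2 b.1.2 (ab (@Ordinal 3 1 isT))).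
rewrite [X in (_ * X)%E](seg a.2 b.2 (ab (@Ordinal 3 2 isT))).
by rewrite -!EFinM !big_ord_recl big_ord0 /= /coord /= mulr1 mulrA.
Qed.

Lemma le_cvol a b : (forall j, coord j a <= coord j b) ->
  cvol a b <= \prod_j (coord j b - coord j a).
Proof.
move=> ab; rewrite cvolE -lee_fin -(lebesgue3_cbox ab).
have le : (lebesgue3 (Om `&` cbox a b) <= lebesgue3 (cbox a b))%E.
  by apply: le_measure; rewrite ?inE; [apply: measurableI => //; exact: measurable_cbox|exact: measurable_cbox|exact: subIsetr].
by rewrite fineK// ge0_fin_numE//; apply: le_lt_trans le (cbox_lty a b).
Qed.

Lemma cvol_gt0 a b : (forall j, coord j a < coord j b) -> cbox a b `<=` Om -> 0 < cvol a b.
Proof.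
move=> ab sub; rewrite cvolE (setIidr sub) lebesgue3_cbox; last by move=> j; exact: ltW.
by apply: prodr_gt0 => j _; rewrite subr_gt0.
Qed.

Lemma le_cvolS a b a' b' : cbox a b `<=` cbox a' b' -> cvol a b <= cvol a' b'.
Proof.
move=> sub; apply: (le_Int mOm) => [||x _]; try exact: integ_cbox.
by rewrite !indicE ler_nat; case: (boolP (x \in cbox a b)) => //; rewrite !inE => /sub /mem_set ->.
Qed.

Lemma nsq_real_bump f : nsq Om (real_bump f) = Int Om (fun x => f x ^+ 2).
Proof.
rewrite /nsq ripE [X in _ + X](_ : _ = 0) ?addr0.
  by congr Int; apply/funext => x; rewrite expr2.
by rewrite -[RHS](Int0 mOm); congr Int; apply/funext => x; rewrite /im /= mulr0.
Qed.

Lemma le_nsq_cube f (A : R) a b : test_function setT f -> (forall x, `|f x| <= A) ->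
  (forall x, ~ cbox a b x -> f x = 0) -> nsq Om (real_bump f) <= A ^+ 2 * cvol a b.
Proof.
move=> tf fA f0; have A0 : 0 <= A by apply: le_trans (fA 0).
rewrite nsq_real_bump -(IntZ mOm); last exact: integ_cbox.
have [_ i2] : rL2 Om f by apply: (rL2_sub oOm); apply: test_function_rL2 => //; exact: (open_measurable_R3 openT).
apply: (le_Int mOm) => // [|x _]; first by apply: (integZ mOm); exact: integ_cbox.
rewrite indicE; case: (boolP (x \in cbox a b)) => [_|]; last first.
  by rewrite notin_setE => /f0 ->; rewrite expr0n mulr0.
by rewrite mulr1 -norm_le_sqr.
Qed.

Lemma le_cvol_nsq f a b : test_function setT f -> (forall x, cbox a b x -> f x = 1) ->
  cvol a b <= nsq Om (real_bump f).
Proof.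
move=> tf f1; rewrite nsq_real_bump.
have [_ i2] : rL2 Om f by apply: (rL2_sub oOm); apply: test_function_rL2 => //; exact: (open_measurable_R3 openT).
apply: (le_Int mOm) => // [|x _]; first exact: integ_cbox.
rewrite indicE; case: (boolP (x \in cbox a b)) => [|_]; last by rewrite sqr_ge0.
by rewrite inE => /f1 ->; rewrite expr1n.
Qed.

Lemma dC_real_bump j f : dC j (real_bump f) = real_bump (partial j f).
Proof.
apply/funext => x; rewrite /dC /real_bump; apply: complexP => //=.
by rewrite (_ : im _ = fun=> 0)// partial_cst.
Qed.

Lemma partial_off_cube j f a b : (forall x, ~ cbox a b x -> f x = 0) ->
  forall x, ~ cbox a b x -> partial j f x = 0.
Proof.
move=> f0 x nx; apply: partial_notin_support => Sx; apply: nx.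
rewrite (closure_id (cbox a b)).1; last exact: closed_cbox.
by apply: closureS Sx => y /=; apply: contra_neqP => /f0.
Qed.

Lemma nsq_sum (I : Type) (s : seq I) (F : I -> R3 R -> R[i]) (B : R) :
  0 <= B -> (forall i, cL2 Om (F i)) -> (forall i, nsq Om (F i) <= B) ->
  nsq Om (fun x => \sum_(i <- s) F i x) <= 4 ^+ size s * B.
Proof.
move=> B0 LF HF; elim: s => [|i s ih].
  by under eq_fun do rewrite big_nil; rewrite /nsq (rip0l mOm) mul1r.
under eq_fun do rewrite big_cons.
apply: le_trans (nsqD_le mOm (LF i) (cL2_sum mOm s LF)) _.
have := HF i; have : 1 <= 4 ^+ size s :> R by rewrite exprn_ege1// ler1n.
rewrite /= exprS -mulrA; move: ih; move: (nsq _ _) (nsq _ _) (4 ^+ size s) => x y z; nra.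
Qed.

End volumes.

Section product_bounds.
Context {R : realType}.
Implicit Types (f : R3 R -> R) (g : 'I_3 -> R3 R -> R) (r : seq 'I_3).

Lemma smooth_prod g r f : (forall j, smooth (g j)) -> smooth f ->
  smooth (fun x => (\prod_(j <- r) g j x) * f x).
Proof.
move=> sg sf; elim: r => [|j r ih].
  by under eq_fun do rewrite big_nil mul1r.
by under eq_fun do rewrite big_cons -mulrA; exact: smoothM.
Qed.

Lemma prod_bound (A A' B : R) g r f : 0 <= A -> (forall j, smooth (g j)) -> smooth f ->
  (forall j x, `|g j x| <= 1) -> (forall j k x, `|partial k (g j) x| <= B) ->
  (forall x, `|f x| <= A) -> (forall k x, `|partial k f x| <= A') ->
  (forall x, `|(\prod_(j <- r) g j x) * f x| <= A) /\
  (forall k x, `|partial k (fun x => (\prod_(j <- r) g j x) * f x) x| <= A' + (size r)%:R * (A * B)).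
Proof.
move=> A0 sg sf g1 dg fA dfA; elim: r => [|j r [ih1 ih2]].
  rewrite mul0r addr0; have -> : (fun x => (\prod_(j <- [::]) g j x) * f x) = f.
    by apply/funext => x; rewrite big_nil mul1r.
  by split => // x; rewrite big_nil mul1r.
pose F x := (\prod_(j <- r) g j x) * f x.
have sF : smooth F by exact: smooth_prod.
have -> : (fun x => (\prod_(i <- j :: r) g i x) * f x) = fun x => g j x * F x.
  by apply/funext => x; rewrite big_cons mulrA.
split=> [x|k x].
  by rewrite big_cons -mulrA normrM -[leRHS]mul1r; apply: ler_pM => //; exact: ih1.
rewrite partialM; try exact: smooth_derivable.
apply: le_trans (ler_normD _ _) _.
rewrite (normrM (g j x)) (normrM (F x)) /= -natr1 mulrDl mul1r addrA; apply: lerD.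
  by rewrite -[leRHS]mul1r; apply: ler_pM => //; exact: ih2.
by apply: ler_pM => //; exact: ih1.
Qed.

End product_bounds.

Section slabs.
Context {R : realType}.
Variables (Om : set (R3 R)) (oOm : open Om).
Let mOm : measurable (Om : set (mR3 R)) := open_measurable_R3 oOm.
Variables (C0 : R) (HC0 : forall t : R, `|step' t| <= C0).
Variables (s c : R) (s0 : 0 <= s).
Implicit Types (j k : 'I_3) (i : nat) (f : R3 R -> R).

Definition slab j i (x : R3 R) : R := beta i (s * coord j x + c).
Definition slab_cut j i (x : R3 R) : R := beta_cut i (s * coord j x + c).

Lemma step_diff_smooth j (p q : R) :
  smooth (fun x : R3 R => step (s * coord j x + p) - step (s * coord j x + q)).
Proof. by apply: smoothB; exact: smooth_step. Qed.

Lemma step_diff_partial j k (p q : R) x :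
  `|partial k (fun x : R3 R => step (s * coord j x + p) - step (s * coord j x + q)) x| <= 2 * (s * C0).
Proof.
have E : (fun x : R3 R => step (s * coord j x + p) - step (s * coord j x + q)) =
    (fun x => step (s * coord j x + p) + -1 * step (s * coord j x + q)).
  by apply/funext => y; rewrite mulN1r.
have sp := smooth_step s p j; have sq := smooth_step s q j.
rewrite E partialD; [|exact: smooth_derivable|by apply: smooth_derivable; exact: smoothZ].
rewrite partialZ// !partial_step mulN1r.
have b t : `|(k == j)%:R * (s * step' t)| <= s * C0.
  rewrite normrM normr_nat normrM (ger0_norm s0) -[leRHS]mul1r.
  apply: ler_pM; rewrite ?mulr_ge0//; first by case: (k == j).
  by rewrite ler_wpM2l.
by apply: le_trans (ler_normB _ _) _; rewrite mulr2n mulrDl mul1r; apply: lerD; exact: b.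
Qed.

Lemma slabE j i : slab j i = fun x => step (s * coord j x + (c - i%:R)) - step (s * coord j x + (c - i.+1%:R)).
Proof. by apply/funext => x; rewrite /slab /beta !addrA. Qed.

Lemma slab_cutE j i : slab_cut j i =
  fun x => step (s * coord j x + (c - i%:R + 1)) - step (s * coord j x + (c - i%:R - 2)).
Proof. by apply/funext => x; rewrite /slab_cut /beta_cut !addrA. Qed.

Lemma smooth_slab j i : smooth (slab j i).
Proof. by rewrite slabE; exact: step_diff_smooth. Qed.

Lemma slab_le1 j i x : `|slab j i x| <= 1.
Proof. by have /andP[h1 h2] := beta_bound i (s * coord j x + c); rewrite ger0_norm. Qed.

Lemma slab_partial j i k x : `|partial k (slab j i) x| <= 2 * (s * C0).
Proof. by rewrite slabE; exact: step_diff_partial. Qed.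

Lemma smooth_slab_cut j i : smooth (slab_cut j i).
Proof. by rewrite slab_cutE; exact: step_diff_smooth. Qed.

Lemma step_diff_le1 (p q : R) : `|step p - step q| <= 1.
Proof.
have := step_ge0 p; have := step_le1 p; have := step_ge0 q; have := step_le1 q.
by rewrite ler_norml => h1 h2 h3 h4; apply/andP; split; lra.
Qed.

Lemma slab_cut_bounded j i : exists C : R, forall x, `|slab_cut j i x| <= C /\
  forall k, `|partial k (slab_cut j i) x| <= C.
Proof.
exists (Num.max 1 (2 * (s * C0))) => x; rewrite !le_max slab_cutE step_diff_le1; split => // k.
by rewrite le_max step_diff_partial orbT.
Qed.

Lemma real_bumpM (m f : R3 R -> R) :
  real_bump (fun x => m x * f x) = fun x => (m x)%:C * real_bump f x.
Proof. by apply/funext => x; rewrite /real_bump rmorphM. Qed.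

Lemma zero_trace_slab f j i : test_function setT f -> zero_trace Om (real_bump f) ->
  zero_trace Om (real_bump (fun x => slab j i x * f x)).
Proof.
move=> tf zf; rewrite real_bumpM.
apply: (zero_traceM oOm (C := Num.max 1 (2 * (s * C0))) (real_bump_ctest tf)) => //.
- exact: smooth_slab.
- by move=> x; rewrite le_max slab_le1.
- by move=> k x; rewrite le_max slab_partial orbT.
Qed.

Definition slab_prod (t : 'I_3 -> nat) (r : seq 'I_3) f (x : R3 R) : R :=
  (\prod_(j <- r) slab j (t j) x) * f x.

Lemma slab_prod_nil t f : slab_prod t [::] f = f.
Proof. by apply/funext => x; rewrite /slab_prod big_nil mul1r. Qed.

Lemma slab_prod_cons t j r f : slab_prod t (j :: r) f = fun x => slab j (t j) x * slab_prod t r f x.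
Proof. by apply/funext => x; rewrite /slab_prod big_cons mulrA. Qed.

Lemma slab_prod_test t r f : test_function setT f -> test_function setT (slab_prod t r f).
Proof.
move=> tf; elim: r => [|j r ih]; first by rewrite slab_prod_nil.
by rewrite slab_prod_cons; apply: test_functionMl => //; exact: smooth_slab.
Qed.

Lemma zero_trace_slab_prod t r f : test_function setT f -> zero_trace Om (real_bump f) ->
  zero_trace Om (real_bump (slab_prod t r f)).
Proof.
move=> tf zf; elim: r => [|j r ih]; first by rewrite slab_prod_nil.
by rewrite slab_prod_cons; apply: zero_trace_slab => //; exact: slab_prod_test.
Qed.

(** [cube_lo] and [cube_hi] are opposite corners of the cube of side [2 / s] that
    carries a product of three slabs. *)
Definition cube_lo (t : 'I_3 -> nat) : R3 R :=
  let v (j : 'I_3) := ((t j)%:R - c) / s in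
  (v (@Ordinal 3 0 isT), v (@Ordinal 3 1 isT), v (@Ordinal 3 2 isT)).

Definition cube_hi (t : 'I_3 -> nat) : R3 R :=
  let v (j : 'I_3) := ((t j)%:R + 2 - c) / s in
  (v (@Ordinal 3 0 isT), v (@Ordinal 3 1 isT), v (@Ordinal 3 2 isT)).

Lemma coord_cube_lo t j : coord j (cube_lo t) = ((t j)%:R - c) / s.
Proof.
by case: j => [[|[|[|//]]] p]; rewrite /coord /cube_lo /=; congr (((t _)%:R - c) / s); apply: val_inj.
Qed.

Lemma coord_cube_hi t j : coord j (cube_hi t) = ((t j)%:R + 2 - c) / s.
Proof.
by case: j => [[|[|[|//]]] p]; rewrite /coord /cube_hi /=; congr (((t _)%:R + 2 - c) / s); apply: val_inj.
Qed.

Lemma slab_prod_off_cube t f x : 0 < s -> ~ cbox (cube_lo t) (cube_hi t) x ->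
  slab_prod t (enum 'I_3) f x = 0.
Proof.
move=> sp nx; rewrite /slab_prod.
suff /eqP -> : \prod_(j <- enum 'I_3) slab j (t j) x == 0 by rewrite mul0r.
rewrite prodf_seq_eq0; apply/hasP.
have [j nj] : exists j, ~ (coord j (cube_lo t) <= coord j x <= coord j (cube_hi t)).
  by apply: contrapT => H; apply: nx => j; apply: contrapT => nj; apply: H; exists j.
exists j; first by rewrite mem_enum.
rewrite /= /slab beta_eq0//; apply/negP => /andP[h1 h2]; apply: nj.
rewrite coord_cube_lo coord_cube_hi ler_pdivrMr// ler_pdivlMr// !(mulrC _ s).
by apply/andP; split; lra.
Qed.

Lemma cube_volume t : 0 < s -> cvol Om (cube_lo t) (cube_hi t) <= (2 / s) ^+ 3.
Proof.
move=> sp; have E j : coord j (cube_hi t) - coord j (cube_lo t) = 2 / s.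
  by rewrite coord_cube_lo coord_cube_hi -mulrBl; congr (_ / s); ring.
apply: le_trans (le_cvol oOm _) _.
  by move=> j; rewrite -subr_ge0 E; apply: divr_ge0 => //; exact: ltW.
by under eq_bigr do rewrite E; rewrite prodr_const card_ord.
Qed.

(** slabs that are not adjacent come with the cut-offs of [separated_bumps] *)
Lemma slab_cut_eq1 j i f x : slab_cut j i x * (slab j i x * f x) = slab j i x * f x.
Proof.
have [->|n0] := eqVneq (slab j i x) 0; first by rewrite mul0r mulr0.
by rewrite /slab_cut beta_cut_eq1// mul1r.
Qed.

Lemma slab_cut_eq0 j i (i' : nat) f x : (i + 3 <= i')%N || (i' + 3 <= i)%N ->
  slab_cut j i x * (slab j i' x * f x) = 0.
Proof.
move=> far; have [->|n0] := eqVneq (slab j i' x) 0; first by rewrite mul0r mulr0.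
by rewrite orbC in far; rewrite /slab_cut (beta_cut_eq0 far n0) mul0r.
Qed.

End slabs.

Section all_bumps.
Context {R : realType}.
Variables (Om : set (R3 R)) (oOm : open Om).
Let mOm : measurable (Om : set (mR3 R)) := open_measurable_R3 oOm.

Lemma far_apart (a b : nat) : a != b -> (a %% 3 = b %% 3)%N -> (a + 3 <= b)%N || (b + 3 <= a)%N.
Proof.
wlog ab : a b / (a < b)%N => [H|_ /eqP].
  by rewrite neq_ltn => /orP[l|l] e; [|rewrite orbC]; apply: H => //; rewrite neq_ltn l.
rewrite eq_sym (eqn_mod_dvd _ (ltnW ab)) => /dvdn_leq; rewrite subn_gt0 => /(_ ab).
by rewrite (leq_subRL _ (ltnW ab)) => ->.
Qed.

Lemma card_family_le n (bad : 'I_3 -> {set 'I_n}) B : (forall j, #|bad j| <= B)%N ->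
  (#|[set t : {ffun 'I_3 -> 'I_n} | [forall j, t j \in bad j]]%SET| <= B ^ 3)%N.
Proof.
move=> badB.
have -> : #|[set t : {ffun 'I_3 -> 'I_n} | [forall j, t j \in bad j]]%SET| =
    #|family (fun j => mem (bad j))|.
  by apply: eq_card => t; rewrite finset.in_set; apply/idP/idP => [/forallP H|/familyP H];
    [apply/familyP|apply/forallP] => j; exact: H.
rewrite card_family /image_mem -[X in (B ^ X)%N](size_enum_ord 3).
elim: (enum 'I_3) => [|j r ih] /=; first by rewrite expn0.
by rewrite expnS; apply: leq_mul; [exact: badB|exact: ih].
Qed.

(** The bound depends neither on [f] nor on the width [1 / s] of the slabs. *)
Definition few_bad_slabs (N : nat) := forall (f : R3 R -> R) (s c : R) j n, 0 < s ->
  test_function setT f ->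
  leq #|[set i : 'I_n | `[< ~ zero_trace Om (real_bump (fun x => slab s c j i x * f x)) >]]%SET| N.

Lemma separated_few_bad (N : nat) :
  (forall n (f c : 'I_n -> R3 R -> R), (N < n)%N ->
    (forall i, test_function setT (f i)) ->
    (forall i, smooth (c i)) ->
    (forall i, exists C : R, forall x, `|c i x| <= C /\ forall j, `|partial j (c i) x| <= C) ->
    (forall i x, c i x * f i x = f i x) ->
    (forall i k x, i != k -> c i x * f k x = 0) ->
    exists i, zero_trace Om (real_bump (f i))) ->
  few_bad_slabs (N + N + N).
Proof.
move=> sep f s c j n s0 tf; set bad := finset _.
(* slabs with the same index modulo three are separated *)
pose A (q : nat) := [set i in bad | (i %% 3 == q)%N]%SET.
have cA q : (#|A q| <= N)%N.
  rewrite leqNgt; apply/negP => NA.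
  have [C0 C0_ge0 HC0] := @step'_bound R.
  have AP (i : 'I_(#|A q|)) : enum_val i \in bad /\ (enum_val i %% 3 = q)%N.
    by have := enum_valP i; rewrite inE => /andP[? /eqP].
  have [|||||i zi] := sep _ (fun i : 'I_(#|A q|) => fun x => slab s c j (enum_val i) x * f x)
    (fun i : 'I_(#|A q|) => slab_cut s c j (enum_val i)) NA.
  - by move=> i; apply: test_functionMl => //; exact: smooth_slab.
  - by move=> i; exact: smooth_slab_cut.
  - by move=> i; apply: (slab_cut_bounded HC0); exact: ltW.
  - by move=> i x; exact: slab_cut_eq1.
  - move=> i k x ik; apply: slab_cut_eq0; apply: far_apart.
      by apply: contra_neqN ik => /eqP/val_inj/enum_val_inj.
    by rewrite (AP i).2 (AP k).2.
  - by have [] := AP i; rewrite inE => /asboolP + _; apply.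
have sub : bad \subset A 0 :|: A 1 :|: A 2.
  apply/fintype.subsetP => i ib; have Ai q : (i \in A q) = (i %% 3 == q)%N.
    by rewrite /A finset.in_set ib.
  rewrite !finset.in_setU !Ai.
  by have := ltn_pmod i (isT : (0 < 3)%N); case: (i %% 3)%N => [|[|[|]]]//; rewrite ?orbT.
apply: leq_trans (subset_leq_card sub) _.
apply: leq_trans (leq_card_setU _ _) _; apply: leq_add => //.
by apply: leq_trans (leq_card_setU _ _) _; apply: leq_add.
Qed.

(** Points have zero capacity: partition [f] into bumps on cubes of side [2 / s];
    those without zero trace are boundedly many, so their energy, of order
    [s ^ 2 s ^ - 3] each, vanishes as [s] grows. *)
Lemma few_bad_zero_trace N f : few_bad_slabs N -> test_function setT f ->
  zero_trace Om (real_bump f).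
Proof.
move=> few tf; have [C0 C0_ge0 HC0] := @step'_bound R.
have [M M0 HM] := test_function_cube tf.
have sf : smooth f by case: tf.
have [A [fA dfA]] : exists A : R, (forall x, `|f x| <= A) /\ forall k x, `|partial k f x| <= A.
  have [A0 HA0] := test_function_bounded tf.
  have /choice[A' HA'] : forall k, exists C : R, forall x, `|partial k f x| <= C.
    by move=> k; exact: (test_function_bounded (test_function_partial k tf)).
  exists (Num.max A0 (\big[Num.max/A0]_k A' k)); split=> [x|k x]; rewrite le_max ?HA0//.
  by apply/orP; right; apply: le_trans (HA' k x) _; exact: le_bigmax_cond.
have A0 : 0 <= A by apply: le_trans (fA 0).
apply: (cl10_closed oOm); first exact: (bump_cL2 oOm (real_bump_ctest tf)).
  by move=> j; apply: (bump_cL2 oOm); apply: ctest_dC; exact: real_bump_ctest.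
(* each of the at most [N ^ 3] bad products, and each of its derivatives, is
   bounded by [D s] on a cube of volume [8 / s ^ 3]; in total this is [Q / s] *)
move=> e e0; pose D := A * (1 + 6 * C0); have D0 : 0 <= D by rewrite mulr_ge0//; lra.
pose Q := 4 ^+ (N ^ 3) * (8 * D ^+ 2); have Q0 : 0 <= Q by rewrite mulr_ge0// mulr_ge0// sqr_ge0.
pose s := Q / e + 1; have s1 : 1 <= s by rewrite lerDr divr_ge0// ltW.
have s0 : 0 < s by apply: lt_le_trans s1.
have Qs : Q / s < e.
  by rewrite ltr_pdivrMr// /s mulrDr mulrCA divff ?gt_eqF// mulr1 mulr1 ltrDl.
(* the support of [f] is mapped into [[1, n]], where the [beta i] with [i < n] add
   up to one *)
pose c := s * M + 1.
have sM0 : 0 <= s * M by rewrite mulr_ge0// ltW.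
pose n := Num.bound (2 * (s * M) + 1).
have nb : 2 * (s * M) + 1 < n%:R by apply: archi_boundP; lra.
pose F (t : {ffun 'I_3 -> 'I_n}) := slab_prod s c (fun j => t j) (enum 'I_3) f.
have tF t : test_function setT (F t) by exact: slab_prod_test.
have LF t : cL2 Om (real_bump (F t)) by apply: (bump_cL2 oOm); exact: real_bump_ctest.
have LdF j t : cL2 Om (dC j (real_bump (F t))).
  by apply: (bump_cL2 oOm); apply: ctest_dC; exact: real_bump_ctest.
have partition : f = fun x => \sum_t F t x.
  apply/funext => x; rewrite /F /slab_prod -mulr_suml.
  have [->|fx] := eqVneq (f x) 0; first by rewrite mulr0.
  under eq_bigr do rewrite big_enum /=.
  rewrite -(bigA_distr_bigA (fun j (i : 'I_n) => slab s c j i x)) big1 ?mul1r// => j _.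
  apply: sum_beta; have := HM x fx j; rewrite ler_norml => /andP[l1 l2].
  have m1 : s * - M <= s * coord j x by rewrite ler_pM2l.
  have m2 : s * coord j x <= s * M by rewrite ler_pM2l.
  by rewrite /c; apply/andP; split; move: m1 m2 nb; rewrite mulrN; lra.
have rpartition : real_bump f = fun x => \sum_t real_bump (F t) x.
  by rewrite {1}partition; apply/funext => x; rewrite /real_bump rmorph_sum.
have [_ dpartition] : ctest setT (fun x => \sum_t real_bump (F t) x) /\
    forall j, dC j (fun x => \sum_t real_bump (F t) x) = fun x => \sum_t dC j (real_bump (F t)) x.
  by apply: (ctest_sum openT) => t; exact: real_bump_ctest.
pose bad j := [set i : 'I_n | `[< ~ zero_trace Om (real_bump (fun x => slab s c j i x * f x)) >]]%SET.
have card_bad j : (#|bad j| <= N)%N by exact: few.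
pose S := [set t : {ffun 'I_3 -> 'I_n} | [forall j, t j \in bad j]]%SET.
have cS : (#|S| <= N ^ 3)%N by exact: card_family_le.
have good t : t \notin S -> zero_trace Om (real_bump (F t)).
  rewrite inE negb_forall => /existsP[j]; rewrite inE => /asboolP/contrapT zj.
  have -> : F t = slab_prod s c (fun j => t j) (rem j (enum 'I_3)) (fun x => slab s c j (t j) x * f x).
    apply/funext => x; rewrite /F /slab_prod (big_rem j) ?mem_enum//=.
    by rewrite -mulrA mulrCA.
  apply: (zero_trace_slab_prod oOm HC0 c (ltW s0)) => //.
  by apply: test_functionMl => //; exact: smooth_slab.
pose v x := \sum_t (if t \in S then 0 else real_bump (F t) x).
pose H j x := \sum_t (if t \in S then 0 else dC j (real_bump (F t)) x).
have cv : cl10 Om v H.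
  apply: (@cl10_sum _ _ oOm _ _ (fun t x => if t \in S then 0 else real_bump (F t) x)
    (fun t j x => if t \in S then 0 else dC j (real_bump (F t)) x)) => t.
  by case: (boolP (t \in S)) => [_|/good//]; exact: (cl10_0 oOm).
have bnd (X : {ffun 'I_3 -> 'I_n} -> R3 R -> R) : (forall t, test_function setT (X t)) ->
    (forall t x, `|X t x| <= D * s) ->
    (forall (t : {ffun 'I_3 -> 'I_n}) x, ~ cbox (cube_lo s c (fun j => t j)) (cube_hi s c (fun j => t j)) x -> X t x = 0) ->
    nsq Om (fun x => \sum_(t in S) real_bump (X t) x) < e.
  move=> tX XD X0; apply: le_lt_trans Qs.
  pose B := (D * s) ^+ 2 * (2 / s) ^+ 3.
  have B0 : 0 <= B by rewrite mulr_ge0 ?sqr_ge0// exprn_ge0// divr_ge0// ltW.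
  have BE : 4 ^+ (N ^ 3) * B = Q / s.
    rewrite /B /Q -mulrA; congr (_ * _); rewrite expr_div_n exprMn.
    by field; rewrite gt_eqF.
  rewrite -BE; have -> : (fun x => \sum_(t in S) real_bump (X t) x) =
      fun x => \sum_(t <- enum S) real_bump (X t) x.
    by apply/funext => x; rewrite big_enum.
  apply: le_trans (nsq_sum oOm _ B0 _ _) _.
  - by move=> t; apply: (bump_cL2 oOm); exact: real_bump_ctest.
  - move=> t; apply: le_trans (le_nsq_cube oOm (tX t) (XD t) (X0 t)) _.
    by rewrite ler_wpM2l ?sqr_ge0//; exact: (cube_volume oOm c (ltW s0) _ s0).
  - by rewrite -cardE ler_wpM2r// ler_weXn2l// ler1n.
have off (t : {ffun 'I_3 -> 'I_n}) : forall x, ~ cbox (cube_lo s c (fun j => t j)) (cube_hi s c (fun j => t j)) x -> F t x = 0.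
  by move=> x; exact: slab_prod_off_cube.
have C1 : 1 <= 1 + 6 * C0 by rewrite lerDl mulr_ge0.
have ADs : A <= D * s.
  by rewrite /D -mulrA ler_peMr// mulr_ege1.
have PB (t : {ffun 'I_3 -> 'I_n}) := prod_bound (enum 'I_3) A0 (fun j => smooth_slab s c j (t j)) sf
  (fun j x => slab_le1 s c j (t j) x) (fun j k x => slab_partial HC0 c (ltW s0) j (t j) k x) fA dfA.
exists v, H; split => //.
  have -> : (fun x => real_bump f x - v x) = fun x => \sum_(t in S) real_bump (F t) x.
    apply/funext => x; rewrite rpartition -sumrB [RHS]big_mkcond; apply: eq_bigr => t _.
    by case: (t \in S); rewrite ?subr0// subrr.
  by apply: bnd => // t x; apply: le_trans ADs; have [+ _] := PB t; apply.
move=> j.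
have -> : (fun x => dC j (real_bump f) x - H j x) = fun x => \sum_(t in S) real_bump (partial j (F t)) x.
  apply/funext => x; rewrite rpartition dpartition -sumrB [RHS]big_mkcond; apply: eq_bigr => t _.
  by rewrite dC_real_bump; case: (t \in S); rewrite ?subr0// subrr.
apply: bnd => [t|t x|t x].
- exact: test_function_partial.
- have [_ /(_ j x)] := PB t; rewrite size_enum_ord => /le_trans; apply.
  have -> : D * s = A * s + 3 * (A * (2 * (s * C0))) by rewrite /D; ring.
  by rewrite lerD2r ler_peMr.
- by apply: partial_off_cube => y; exact: off.
Qed.

End all_bumps.

(** * The kernel of [A - m] is infinite dimensional *)

Section infinite_kernel.
Context {R : realType}.
Variables (Om : set (R3 R)) (oOm : open Om).
Let mOm : measurable (Om : set (mR3 R)) := open_measurable_R3 oOm.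

Definition corner (T : R) : R3 R := (T, T, T).

Lemma coord_corner j T : coord j (corner T) = T.
Proof. by case: j => [[|[|[|]]]]. Qed.

Definition hvol T := cvol Om (corner (- T)) (corner T).

(** equal to one on the cube of half-side [T], to zero off that of half-side [2 T] *)
Definition plateau (T : R) (x : R3 R) : R :=
  (\prod_(j <- enum 'I_3) (step (T^-1 * coord j x + 2) - step (T^-1 * coord j x + -1))) * 1.

Lemma plateau1 T x : 0 < T -> cbox (corner (- T)) (corner T) x -> plateau T x = 1.
Proof.
move=> T0 bx; rewrite /plateau mulr1 big1_seq// => j _.
have := bx j; rewrite !coord_corner => /andP[l1 l2].
have h1 : -1 <= T^-1 * coord j x by rewrite mulrC ler_pdivlMr// mulN1r.
have h2 : T^-1 * coord j x <= 1 by rewrite mulrC ler_pdivrMr// mul1r.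
by rewrite step1 ?step0 ?subr0//; lra.
Qed.

Lemma plateau0 T x : 0 < T -> ~ cbox (corner (- (2 * T))) (corner (2 * T)) x -> plateau T x = 0.
Proof.
move=> T0 nx; rewrite /plateau.
suff /eqP -> : \prod_(j <- enum 'I_3) (step (T^-1 * coord j x + 2) - step (T^-1 * coord j x + -1)) == 0.
  by rewrite mul0r.
rewrite prodf_seq_eq0; apply/hasP.
have [j nj] : exists j, ~ (coord j (corner (- (2 * T))) <= coord j x <= coord j (corner (2 * T))).
  by apply: contrapT => H; apply: nx => j; apply: contrapT => nj; apply: H; exists j.
exists j; first by rewrite mem_enum.
move: nj; rewrite !coord_corner /= => /negP; rewrite negb_and -!ltNge => /orP[h|h].
  have h1 : T^-1 * coord j x < - 2 by rewrite mulrC ltr_pdivrMr// mulNr.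
  by rewrite !step0 ?subrr//; lra.
have h1 : 2 < T^-1 * coord j x by rewrite mulrC ltr_pdivlMr.
by rewrite !step1 ?subrr//; lra.
Qed.

Lemma smooth_plateau T : smooth (plateau T).
Proof. by apply: smooth_prod => [j|]; [exact: step_diff_smooth|exact: smooth_cst]. Qed.

Lemma plateau_test T : 0 < T -> test_function setT (plateau T).
Proof.
move=> T0; split => //; first exact: smooth_plateau.
apply: (@subclosed_compact _ _ (cbox (corner (- (2 * T))) (corner (2 * T)))).
- exact: closed_closure.
- exact: compact_cbox.
- rewrite [X in _ `<=` X](closure_id _).1; last exact: closed_cbox.
  by apply: closureS => x /=; apply: contra_neqP => /(plateau0 T0).
Qed.

Lemma plateau_bound C0 T : (forall t : R, `|step' t| <= C0) -> 0 < T ->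
  (forall x, `|plateau T x| <= 1) /\ forall k x, `|partial k (plateau T) x| <= 6 * (C0 / T).
Proof.
move=> HC0 T0; have T1 : 0 <= T^-1 by rewrite invr_ge0 ltW.
have [|||||||b1 b2] := @prod_bound _ 1 0 (2 * (T^-1 * C0))
  (fun j x => step (T^-1 * coord j x + 2) - step (T^-1 * coord j x + -1)) (enum 'I_3) (fun=> 1).
- by [].
- by move=> j; exact: step_diff_smooth.
- exact: smooth_cst.
- by move=> j x; exact: step_diff_le1.
- by move=> j k x; exact: step_diff_partial.
- by move=> x; rewrite normr1.
- by move=> k x; rewrite partial_cst normr0.
split=> // k x; apply: le_trans (b2 k x) _.
by rewrite size_enum_ord add0r le_eqVlt; apply/orP; left; apply/eqP; ring.
Qed.

Lemma pow2_bound (x y : R) : (forall n, 2 ^+ n * x <= y) -> x <= 0.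
Proof.
move=> H; rewrite leNgt; apply/negP => x0.
have y0 : 0 <= y / x by rewrite divr_ge0 ?(ltW x0)//; apply: le_trans (H 0); rewrite mul1r ltW.
have := archi_boundP y0; set n := Num.bound _; rewrite ltr_pdivrMr// => lt.
have := H n; apply/negP; rewrite -ltNge; apply: lt_le_trans lt _.
by rewrite ler_pM2r// -natrX ler_nat ltnW// ltn_expl.
Qed.

Variable mu : nat -> R.
Hypothesis discr : purely_discrete Om (dirichlet_laplacian Om).
Hypothesis muP : enumerates_eigenvalues Om (dirichlet_laplacian Om) mu.

(** If all plateaus have zero trace, Poincare bounds the volume of [Om] in a
    large cube by a sixteenth of its volume in the cube twice as big, whereas
    volumes grow at most by a factor eight. *)
Lemma not_all_zero_trace : Om !=set0 ->
  ~ (forall f, test_function setT f -> zero_trace Om (real_bump f)).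
Proof.
move=> [x0 Ox0] all0; have [K K0 HK] := poincare_dirichlet oOm discr muP.
have [C0 C0_ge0 HC0] := @step'_bound R.
(* Poincare for [plateau T] reads [hvol T <= K * 3 * (6 * C0 / T) ^+ 2 * hvol (2 * T)] *)
pose L := 16 * (108 * (K * C0 ^+ 2)); pose T0 := L + 1.
have L0 : 0 <= L by rewrite /L !mulr_ge0// sqr_ge0.
have shrink T : T0 <= T -> 16 * hvol T <= hvol (2 * T).
  move=> TT; have T1 : 1 <= T by apply: le_trans TT; rewrite lerDr.
  have Tp : 0 < T by apply: lt_le_trans T1.
  have tp := plateau_test Tp; have [b1 b2] := plateau_bound HC0 Tp.
  have h1 : hvol T <= nsq Om (real_bump (plateau T)).
    by apply: (le_cvol_nsq oOm tp) => x; exact: plateau1.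
  have h2 j : nsq Om (dC j (real_bump (plateau T))) <= (6 * (C0 / T)) ^+ 2 * hvol (2 * T).
    rewrite dC_real_bump; apply: (le_nsq_cube oOm) => //.
    - exact: test_function_partial.
    - by apply: partial_off_cube => x; exact: plateau0.
  have h3 : gsq Om (fun j => dC j (real_bump (plateau T))) <= 3 * ((6 * (C0 / T)) ^+ 2 * hvol (2 * T)).
    apply: (@le_trans _ _ (\sum_(j < 3) (6 * (C0 / T)) ^+ 2 * hvol (2 * T))).
      by apply: ler_sum => j _; exact: h2.
    by rewrite sumr_const card_ord -[_ *+ 3]mulr_natl.
  have h4 := le_trans h1 (HK _ _ (all0 _ tp)).
  have h5 : hvol T <= K * (3 * ((6 * (C0 / T)) ^+ 2 * hvol (2 * T))).
    by apply: le_trans h4 _; rewrite ler_wpM2l.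
  have v0 : 0 <= hvol (2 * T) by exact: cvol_ge0.
  apply: (@le_trans _ _ (16 * (K * (3 * ((6 * (C0 / T)) ^+ 2 * hvol (2 * T)))))); first by rewrite ler_pM2l.
  have -> : 16 * (K * (3 * ((6 * (C0 / T)) ^+ 2 * hvol (2 * T)))) = L / T ^+ 2 * hvol (2 * T).
    by rewrite /L; field; rewrite gt_eqF.
  rewrite ler_piMl// ler_pdivrMr ?exprn_gt0// mul1r.
  apply: (@le_trans _ _ T); first by apply: le_trans TT; rewrite lerDl.
  by rewrite expr2 ler_peMl// ltW.
have grow T n : T0 <= T -> 16 ^+ n * hvol T <= hvol (2 ^+ n * T).
  move=> TT; elim: n => [|n ih]; first by rewrite !mul1r.
  have TnT : T0 <= 2 ^+ n * T.
    have Tp : 0 <= T by apply: le_trans TT; rewrite addr_ge0.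
    by apply: (le_trans TT); rewrite ler_peMl// exprn_ege1// ler1n.
  rewrite !exprS -!mulrA; apply: le_trans (shrink _ TnT).
  by rewrite ler_pM2l.
have null T : T0 <= T -> hvol T <= 0.
  move=> TT; have Tp : 0 <= T by apply: le_trans TT; rewrite addr_ge0.
  apply: (@pow2_bound _ (8 * T ^+ 3)) => n.
  have e : 0 < (8 ^+ n : R) by rewrite exprn_gt0.
  rewrite -(ler_pM2l e) mulrA -exprMn -natrM; apply: le_trans (grow T n TT) _.
  apply: le_trans (le_cvol oOm _) _.
    have h : 0 <= 2 ^+ n * T by rewrite mulr_ge0// exprn_ge0.
    by move=> j; rewrite !coord_corner; lra.
  under eq_bigr do rewrite !coord_corner; rewrite prodr_const card_ord.
  have -> : 2 ^+ n * T - - (2 ^+ n * T) = 2 * (2 ^+ n * T) by ring.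
  rewrite !exprMn -exprM mulnC exprM.
  have -> : 2 ^+ 3 = 8 :> R by ring.
  by rewrite mulrCA.
have [e /= e0 be] : exists2 e : R, 0 < e & ball x0 e `<=` Om.
  have := oOm; rewrite openE => /(_ _ Ox0) /nbhs_ballP[e e0 be].
  by exists e.
pose a : R3 R := x0 - corner (e / 2); pose b : R3 R := x0 + corner (e / 2).
have e2 : 0 < e / 2 by rewrite divr_gt0.
have ca j : coord j a = coord j x0 - e / 2.
  by rewrite /a -scaleN1r coordD coordZ coord_corner mulN1r.
have cb j : coord j b = coord j x0 + e / 2 by rewrite /b coordD coord_corner.
have sub : cbox a b `<=` Om.
  move=> y by_; apply: be; rewrite -ball_normE /=.
  have close j : `|coord j x0 - coord j y| < e.
    have := by_ j; rewrite ca cb => /andP[l1 l2].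
    by rewrite ltr_norml; apply/andP; split; lra.
  rewrite !prod_normE /= !gt_max.
  by rewrite (close (@Ordinal 3 0 isT)) (close (@Ordinal 3 1 isT)) (close (@Ordinal 3 2 isT)).
pose T := T0 + `|x0| + e.
have T0T : T0 <= T by rewrite /T -addrA lerDl addr_ge0// ltW.
have : 0 < hvol T.
  have pos : 0 < cvol Om a b.
    by apply: cvol_gt0 => // j; rewrite ca cb; lra.
  apply: (lt_le_trans pos).
  apply: (le_cvolS oOm) => y by_ j; have := by_ j; rewrite ca cb !coord_corner /T.
  have := le_norm_coord j x0; rewrite ler_norml => /andP[n1 n2] /andP[l1 l2].
  have : 0 <= T0 by rewrite addr_ge0.
  by move=> T00; apply/andP; split; lra.
by rewrite ltNge null.
Qed.

Lemma dirac_infinite_multiplicity (m : R) : Om !=set0 ->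
  infinite_multiplicity Om (dirac_zigzag Om m) m%:C.
Proof.
move=> nO k; apply: contrapT => nk.
have [N HN] := separated_bumps oOm discr muP nk.
apply: (not_all_zero_trace nO) => f tf.
exact: (few_bad_zero_trace oOm (separated_few_bad HN) tf).
Qed.

Lemma infinite_multiplicity_eigenvalue n (A : set (field R n * field R n)) z :
  infinite_multiplicity Om A z -> eigenvalue_of Om A z.
Proof.
move=> /(_ 1%N)[v kv iv]; exists (v ord0) => // v0.
have := iv (fun=> 1) _ ord0; rewrite big_ord1 scale1r => /(_ v0) /eqP.
by rewrite oner_eq0.
Qed.

End infinite_kernel.

Theorem corollary3p5 (R : realType) (Om : set (R3 R))
  (Om_open : open Om) (Om_nonempty : Om !=set0)
  (discr : purely_discrete Om (dirichlet_laplacian Om))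
  (mu : nat -> R)
  (muP : enumerates_eigenvalues Om (dirichlet_laplacian Om) mu)
  (m : R) :
  spectrum Om (dirac_zigzag Om m) =
    [set m%:C] `|`
    [set z | exists k : nat, z = (Num.sqrt (m ^+ 2 + mu k))%:C \/
                             z = - (Num.sqrt (m ^+ 2 + mu k))%:C] /\
  eigenvalue_of Om (dirac_zigzag Om m) m%:C /\
  infinite_multiplicity Om (dirac_zigzag Om m) m%:C.
Proof.
have im := dirac_infinite_multiplicity Om_open discr muP m Om_nonempty.
have em := infinite_multiplicity_eigenvalue im.
by split; [exact: dirac_spectrum|split].
Qed.
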